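(* Consider initial concentrations $c_0(a,m)\ge0$, $a\in\mathbb N$, $m\in\mathbb N^*$, such that $\langle c_0,1\rangle<+\infty$, $A_0:=\langle c_0,a\rangle\in(0,+\infty]$, and set $K:=\langle c_0,a(a-1)\rangle\in[0,+\infty]$. Then $K=+\infty$ whenever $A_0=+\infty$. Let $$T_{\rm gel}=\begin{cases}\frac1{K-A_0}&\text{if }A_0<K<+\infty,\\0&\text{if }K=+\infty,\\+\infty&\text{if }K\le A_0<+\infty.\end{cases}$$ Then Smoluchowski's equation with arms has a unique solution $(c_t)$ defined on $\mathbb R^+=[0,+\infty)$ with initial condition $c_0$. When $T_{\rm gel}<+\infty$, this solution enjoys the following properties, where for $t\ge0$ $$A_t:=\langle c_t,a\rangle,\qquad\alpha_t:=\exp\Big(\int_0^tA_s\,\mathrm ds\Big),\qquad\beta_t:=\int_0^t\frac1{\alpha_s^2}\,\mathrm ds.$$ (1) The number of arms $A_t$ is continuous, strictly decreasing, and for all $t>0$ $$A_t\le\frac{A_0}{1+tA_0}\ \text{ if }A_0<+\infty,\qquad A_t\le\frac1t\ \text{ if }A_0=+\infty.$$ Moreover $\alpha_t=1+A_0t$ for $t<T_{\rm gel}$, and for $t\ge T_{\rm gel}$ $$\alpha_t=\begin{cases}\Gamma^{-1}(1+A_0T_{\rm gel}+t-T_{\rm gel})&\text{if }A_0<+\infty,\\\Gamma^{-1}(1+t)&\text{if }A_0=+\infty,\end{cases}$$ where $$\Gamma(x)=1+A_0T_{\rm gel}+\int_{1+A_0T_{\rm gel}}^x\frac{\mathrm dr}{k_0(H(1/r),1)},\qquad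 x\ge1+A_0T_{\rm gel},$$ and $H:[G(0),G(1))\to[0,1)$ is the right inverse of the increasing function $G:[0,1)\to[G(0),G(1))$, $$G(x):=x-\frac{k_0(x,1)}{k_0'(x,1)},\quad x\in[0,1),$$ with $G(0):=G(0^+)\le0$ and $$0<G(1):=G(1^-)=\begin{cases}1-\frac{A_0}K&\text{if }A_0<+\infty,\\1&\text{if }A_0=+\infty.\end{cases}$$ (2) Let $\phi_t(x,y):=\alpha_t(x-\beta_tk_0(x,y))$, $t\ge0$, $x,y\in[0,1]$. Then: - $\phi_t(\cdot,1)$ attains its maximum at a point $\ell_t$ such that $\phi_t(\ell_t,1)=1$. For $t\le T_{\rm gel}$, $\ell_t=1$, and for $t>T_{\rm gel}$, $0<\ell_t<1$ and $\frac{\partial\phi_t}{\partial x}(\ell_t,1)=0$. In particular, for $t>T_{\rm gel}$, $\ell_t=H(1/\alpha_t)$. - For every $y\in[0,1]$, $\phi_t(\cdot,y)$ has a right inverse $h_t(\cdot,y):[0,1]\to[0,1]$ (i.e. $\phi_t(h_t(x,y),y)=x$ for all $x\in[0,1]$), for which (3) below holds. (3) The generating function $k_t$ is given by $$k_t(x,y)=\frac1{\alpha_t}\,k_0(h_t(x,y),y),\qquad x\in[0,1],\ y\in[0,1].$$ In particular, for $t>0$, $$\alpha_tA_t=\alpha_tk_t(1,1)=k_0(\ell_t,1),\qquad A_t=\frac{k_0(\ell_t,1)}{1+\int_0^tk_0(\ell_s,1)\,\mathrm ds}.$$ (4) The second moment $\langle c_t,a^2\rangle$ is finite for $t\in[0,T_{\rm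 gel})$ and infinite for $t\in[T_{\rm gel},+\infty)$.
   Context: $\mathbb N=\{0,1,2,\dots\}$, $\mathbb N^*=\{1,2,\dots\}$. For $c=(c(a,m))_{a\in\mathbb N,m\in\mathbb N^*}$ non-negative and $f\geq 0$ a function of $(a,m)$, $\langle c,f\rangle=\sum_{a\ge0}\sum_{m\ge1}f(a,m)c(a,m)$ (so $\langle c,a\rangle$, $\langle c,a(a-1)\rangle$, $\langle c,a^2\rangle$ are moments in the variable $a$). The generating function is $$k_t(x,y):=\sum_{a\ge1}\sum_{m\ge1}a\,c_t(a,m)\,x^{a-1}y^m ,$$ with values in $[0,+\infty]$, and $k_0'(x,1)$ denotes the derivative of $x\mapsto k_0(x,1)$. Conventions: $0\cdot(+\infty)=0$ (in particular $A_0T_{\rm gel}=0$ when $A_0=+\infty$, $T_{\rm gel}=0$, and $\phi_0(x,y)=x$) and $A_0/K=0$ when $A_0<+\infty$, $K=+\infty$. When $A_0=+\infty$, continuity of $A$ at $t=0$ is understood in $[0,+\infty]$. Definition (solution of Smoluchowski's equation with arms). Given $c_0(a,m)\ge0$, a family $(c_t(a,m))$, $t\ge0$, $a\in\mathbb N$, $m\in\mathbb N^*$, of non-negative numbers is a solution if: (i) for every $t>0$, $\int_0^t\langle c_s,a\rangle^2\,\mathrm ds<+\infty$; (ii) for all $a\in\mathbb N$, $m\in\mathbb N^*$, $t>0$, $$c_t(a,m)=c_0(a,m)+\int_0^t\frac12\sum_{a'=1}^{a+1}\sum_{m'=1}^{m-1}a'(a+2-a')\,c_s(a',m')\,c_s(a+2-a',m-m')\,\mathrm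 ds-\int_0^t\sum_{a'\ge1}\sum_{m'\ge1}aa'\,c_s(a,m)\,c_s(a',m')\,\mathrm ds;$$ (iii) if $\langle c_0,a^2\rangle<+\infty$, then $t\mapsto\langle c_t,a^2\rangle$ is bounded in a right neighborhood of $0$. *)

(* Defs.v *)
From HB Require Import structures.
From mathcomp Require Export all_boot all_order all_algebra.
From mathcomp Require Export all_classical all_reals all_analysis.
Export Order.TTheory GRing.Theory Num.Theory.
Export numFieldNormedType.Exports.

Set Implicit Arguments.
Unset Strict Implicit.
Unset Printing Implicit Defensive.

Local Open Scope classical_set_scope.
Local Open Scope ring_scope.

(* Concentrations c(a, m), with a in N and m in N^*, are functions
   nat -> nat -> R whose values at m = 0 are irrelevant: every sum over m
   starts at 1, and every requirement on c is restricted to 0 < m. *)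

Definition pairing {R : realType} (c f : nat -> nat -> R) : \bar R :=
  (\sum_(0 <= a <oo) \sum_(1 <= m <oo) (f a m * c a m)%:E)%E.

Definition total_mass {R : realType} (c : nat -> nat -> R) : \bar R :=
  pairing c (fun _ _ => 1).

Definition arms {R : realType} (c : nat -> nat -> R) : \bar R :=
  pairing c (fun a _ => a%:R).

Definition factorial_moment2 {R : realType} (c : nat -> nat -> R) : \bar R :=
  pairing c (fun a _ => a%:R * (a%:R - 1)).

Definition moment2 {R : realType} (c : nat -> nat -> R) : \bar R :=
  pairing c (fun a _ => a%:R ^+ 2).

(* The generating function k; note that 0 ^+ 0 = 1. *)
Definition genfun {R : realType} (c : nat -> nat -> R) (x y : R) : \bar R :=
  (\sum_(1 <= a <oo) \sum_(1 <= m <oo)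
     (a%:R * c a m * x ^+ a.-1 * y ^+ m)%:E)%E.

Definition gain {R : realType} (c : nat -> nat -> R) (a m : nat) : R :=
  2^-1 * \sum_(1 <= a' < a.+2) \sum_(1 <= m' < m)
    a'%:R * (a + 2 - a')%:R * c a' m' * c (a + 2 - a')%N (m - m')%N.

Definition loss {R : realType} (c : nat -> nat -> R) (a m : nat) : \bar R :=
  (\sum_(1 <= a' <oo) \sum_(1 <= m' <oo)
     (a%:R * a'%:R * c a m * c a' m')%:E)%E.

(* Only the values c t for 0 <= t are relevant. Given the measurability clause
   and the integrability clause, both integrals in the equation are finite, so
   that no indeterminate difference occurs there. *)
Record smoluchowski_solution {R : realType}
    (c0 : nat -> nat -> R) (c : R -> nat -> nat -> R) : Prop := {
  solution_ge0 : forall (t : R) (a m : nat),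
    0 <= t -> (0 < m)%N -> 0 <= c t a m ;
  solution_init : forall a m : nat, (0 < m)%N -> c 0 a m = c0 a m ;
  solution_measurable : forall a m : nat, (0 < m)%N ->
    measurable_fun (`[0, +oo[ : set R) (fun s : R => c s a m) ;
  solution_integrable : forall t : R, 0 < t ->
    (\int[lebesgue_measure]_(s in `[0%R, t]) (arms (c s) ^+ 2) < +oo)%E ;
  solution_eq : forall (t : R) (a m : nat), 0 < t -> (0 < m)%N ->
    ((c t a m)%:E = (c0 a m)%:E
       + \int[lebesgue_measure]_(s in `[0%R, t]) (gain (c s) a m)%:E
       - \int[lebesgue_measure]_(s in `[0%R, t]) loss (c s) a m)%E ;
  solution_moment2 : (moment2 c0 < +oo)%E ->
    exists M : R, \forall t \near 0^'+, (moment2 (c t) <= M%:E)%E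
}.

Definition Tgel {R : realType} (c0 : nat -> nat -> R) : \bar R :=
  let A0 := arms c0 in
  let K := factorial_moment2 c0 in
  if (K == +oo)%E then 0%E
  else if (A0 < K)%E then ((K - A0)^-1)%E
  else +oo%E.

(* For a solution c, the integral is finite for all t by solution_integrable
   and the Cauchy-Schwarz inequality. *)
Definition alpha {R : realType} (c : R -> nat -> nat -> R) (t : R) : R :=
  expR (fine (\int[lebesgue_measure]_(s in `[0%R, t]) arms (c s))%E).

Definition beta {R : realType} (c : R -> nat -> nat -> R) (t : R) : R :=
  Rintegral lebesgue_measure `[0%R, t] (fun s => 1 / alpha c s ^+ 2).

(* The convention 0 * +oo = 0 of \bar R gives phi_0(x, y) = x. *)
Definition phi {R : realType} (c0 : nat -> nat -> R)
    (c : R -> nat -> nat -> R) (t x y : R) : \bar R :=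
  ((alpha c t)%:E * (x%:E - (beta c t)%:E * genfun c0 x y))%E.

(* k_0(., 1) is finite on [0, 1[ as soon as <c_0, 1> is. *)
Definition genfun1 {R : realType} (c0 : nat -> nat -> R) (x : R) : R :=
  fine (genfun c0 x 1).

(* The value at 0 is the right limit, which may be -oo. *)
Definition Gfun {R : realType} (c0 : nat -> nat -> R) (x : R) : \bar R :=
  let g := fun u : R => (u - genfun1 c0 u / derive1 (genfun1 c0) u)%:E in
  if x == 0 then lim (g u @[u --> 0^'+]) else g x.

Definition G1 {R : realType} (c0 : nat -> nat -> R) : \bar R :=
  lim (Gfun c0 x @[x --> 1^'-]).

Definition Hfun {R : realType} (c0 : nat -> nat -> R) : \bar R -> R :=
  pinv (`[0, 1[ : set R) (Gfun c0).

(* 1 + A_0 T_gel, where A_0 T_gel = 0 if A_0 = +oo and T_gel = 0. *)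
Definition alpha_gel {R : realType} (c0 : nat -> nat -> R) : R :=
  fine (1 + arms c0 * Tgel c0)%E.

(* The left end point r = alpha_gel c0 is left out because 1 / r = G(1) is not
   in the domain of H. *)
Definition Gamma {R : realType} (c0 : nat -> nat -> R) (x : R) : R :=
  alpha_gel c0 +
  Rintegral lebesgue_measure `]alpha_gel c0, x]
    (fun r => 1 / genfun1 c0 (Hfun c0 (1 / r)%:E)).

Definition Gamma_inv {R : realType} (c0 : nat -> nat -> R) : R -> R :=
  pinv (`[alpha_gel c0, +oo[ : set R) (Gamma c0).

(* Main.v *)
Require Import Defs.
From mathcomp Require Import zify ring lra measurable_realfun.

Set Implicit Arguments.
Unset Strict Implicit.
Unset Printing Implicit Defensive.

Local Open Scope classical_set_scope.
Local Open Scope ring_scope.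

(* Put k(x, y) = k_0(x, y). In the variables z = x / alpha_t and b = beta_t, the
   function u(b, z, y) = alpha_t k_t(x, y) solves the Burgers equation
   d_b u = u d_z u with u(0, ., .) = k, and its expansion in b has non-negative
   coefficients. The transport equation gives u = k(z + b u, y), and u(b, z, 1)
   is finite as soon as z <= x - b k(x, 1) for some x.

   Let M(b) be the maximum over x of x - b k(x, 1). Existence: define beta as the
   inverse of b |-> int_0^b ds / M(s)^2, set 1 / alpha_t = M(beta_t), and rescale
   u. The derivative of M is -u(b, M(b), 1), which makes the equation for the
   number of arms consistent. Uniqueness: for any solution, c_t is the rescaling
   of u by its own alpha and beta, so only 1 / alpha = M(beta) has to be shown; if
   1 / alpha > M(beta) the number of arms is at least A_0 / alpha and 1 / alpha
   decreases too fast, and if 1 / alpha < M(beta) it decreases too slowly.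

   The maximum M(b) is attained at 1 as long as b k'(1, 1) <= 1, that is until
   T_gel, and afterwards at the point where b k' = 1. Since G(x) = M(1 / k'(x)),
   this point is H(1 / alpha_t). *)

(** * The formal Burgers equation *)

(** The obstacle is that [alpha] is defined through the number of arms, that is through the
    generating function at x = 1, exactly where the inversion of x - b k(x) breaks down at gelation
    and where k or its derivative may be infinite from the start. Two facts get around it. In the
    variables z and b, the concentration at mass m is a polynomial in b of degree less than m: the
    evolution is built formally, with no convergence question, and power series enter only through
    monotone limits of non-negative partial sums. Moreover M is a supremum of functions affine in b,
    hence convex: tangent inequalities and monotone slopes take the place of derivatives, and
    increments bounded by products of increments of monotone functions take the place of absolute
    continuity. The integrand 1 / M^2 is what the relation beta' = 1 / alpha^2 imposes on the
    inverse of beta. Integrability of the squared number of arms comes from the balance of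
    particles: a gain of A^2 / 2 against a loss of A^2, so the total lost controls the integral. *)

Section FormalBurgers.
Variable R : realType.
Implicit Types (k : {poly R}) (p q f g : {poly {poly R}}).

(* Divisibility by 'X^N. *)
Definition sdvd (N : nat) p := forall i, (i < N)%N -> p`_i = 0.

Lemma sdvdD N p q : sdvd N p -> sdvd N q -> sdvd N (p + q).
Proof. by move=> hp hq i iN; rewrite coefD hp // hq // addr0. Qed.

Lemma sdvdMl N p q : sdvd N p -> sdvd N (q * p).
Proof.
move=> hp i iN; rewrite coefM big1// => j _.
by rewrite hp ?mulr0// (leq_ltn_trans (leq_subr _ _)).
Qed.

Lemma sdvd_sum N (I : Type) (r : seq I) (P : pred I) (F : I -> {poly {poly R}}) :
  (forall i, P i -> sdvd N (F i)) -> sdvd N (\sum_(i <- r | P i) F i).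
Proof.
move=> h; elim/big_ind : _ => //; first by move=> i _; rewrite coef0.
exact: sdvdD.
Qed.

(* In {poly {poly R}} the outer variable is b and the inner one is z. *)
Definition compP k f := \sum_(i < size k) (k`_i)%:P%:P * f ^+ i.

Definition dz := map_poly (fun p : {poly R} => p^`()).

Lemma coef_dz p i : (dz p)`_i = (p`_i)^`().
Proof. by rewrite coef_map_id0// deriv0. Qed.

Lemma dzD p q : dz (p + q) = dz p + dz q.
Proof. by apply/polyP => i; rewrite coefD !coef_dz coefD derivD. Qed.

Lemma dzM p q : dz (p * q) = dz p * q + p * dz q.
Proof.
apply/polyP => i; rewrite coefD !coefM coef_dz coefM raddf_sum -big_split/=.
by apply: eq_bigr => j _; rewrite derivM !coef_dz.
Qed.

(** The derivation d_b - U d_z. With U the truncated solution, it annihilates u modulo a power of b,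
    hence also z + b u and every polynomial in z + b u. *)
Definition transport (U p : {poly {poly R}}) := p^`() - U * dz p.

Lemma transportD U p q : transport U (p + q) = transport U p + transport U q.
Proof. by rewrite /transport derivD dzD; ring. Qed.

Lemma transportM U p q :
  transport U (p * q) = transport U p * q + p * transport U q.
Proof. by rewrite /transport derivM dzM; ring. Qed.

Lemma transportC U (c : R) : transport U c%:P%:P = 0.
Proof.
rewrite /transport derivC sub0r; apply/eqP; rewrite oppr_eq0; apply/eqP.
rewrite (_ : dz _ = 0) ?mulr0//; apply/polyP => i.
by rewrite coef_dz coefC coef0; case: ifP => _; rewrite ?derivC ?deriv0.
Qed.

Lemma transportX U f n : transport U (f ^+ n.+1) = (f ^+ n *+ n.+1) * transport U f.
Proof.
elim: n => [|n IH]; first by rewrite expr0 mul1r expr1.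
rewrite exprS transportM IH [in RHS]mulrSr exprS; ring.
Qed.

Lemma sdvd_transport_comp N U k f :
  sdvd N (transport U f) -> sdvd N (transport U (compP k f)).
Proof.
move=> h; rewrite /compP.
have -> : forall n (F : 'I_n -> {poly {poly R}}),
    transport U (\sum_(i < n) F i) = \sum_(i < n) transport U (F i).
  elim=> [F|n IH F]; first by rewrite !big_ord0 -(polyC0) -polyC0 transportC.
  by rewrite !big_ord_recr/= transportD IH.
apply: sdvd_sum => i _; rewrite transportM transportC mul0r add0r.
apply: sdvdMl; case: (nat_of_ord i) => [|n]; last first.
  by rewrite transportX; apply: sdvdMl.
by move=> j _; rewrite expr0 (transportC U 1) coef0.
Qed.

Section Burgers.
Variables (k : {poly R}) (u : nat -> {poly R}).
Hypothesis u0 : u 0 = k.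
Hypothesis uS : forall n,
  n.+1%:R *: u n.+1 = \sum_(j < n.+1) u j * (u (n - j)%N)^`().

(* zeta is the starting point z + b u of the characteristic through z. *)
Definition trunc N : {poly {poly R}} := \poly_(n < N.+1) u n.
Definition zeta N : {poly {poly R}} := 'X%:P + 'X * trunc N.

Lemma coef_trunc N i : (i <= N)%N -> (trunc N)`_i = u i.
Proof. by move=> iN; rewrite coef_poly ltnS iN. Qed.

Lemma transport_trunc N : sdvd N (transport (trunc N) (trunc N)).
Proof.
move=> i iN; rewrite coefB coef_deriv coef_trunc// coefM.
rewrite -scaler_nat uS; apply/eqP; rewrite subr_eq0; apply/eqP.
apply: eq_bigr => j _; have ji : (j <= i)%N by rewrite -ltnS.
by rewrite coef_dz !coef_trunc// ?(leq_trans _ (ltnW iN))// leq_subr.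
Qed.

Lemma transport_zeta N : sdvd N (transport (trunc N) (zeta N)).
Proof.
(* The term u produced by d_b (b u) cancels U d_z z = U. *)
have -> : transport (trunc N) (zeta N) = 'X * transport (trunc N) (trunc N).
  rewrite transportD transportM {1}/transport derivC sub0r.
  rewrite [transport _ 'X]/transport derivX.
  have -> : dz 'X = 0.
    by apply/polyP => i; rewrite coef_dz coefX coef0; case: eqP => _; rewrite ?derivC ?deriv0 // derivC.
  have -> : dz 'X%:P = 1.
    by apply/polyP => i; rewrite coef_dz coefC coef1; case: eqP => _; rewrite ?derivX ?deriv0.
  ring.
exact/sdvdMl/transport_trunc.
Qed.

Lemma coef_compP0 f : f`_0 = 'X -> (compP k f)`_0 = k.
Proof.
move=> f0; rewrite /compP coef_sum -[RHS]coefK poly_def; apply: eq_bigr => i _.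
rewrite coefCM mul_polyC; congr (_ *: _).
by elim: (nat_of_ord i) => [|n IH]; rewrite ?expr0 ?coefC// !exprS coef0M f0 IH.
Qed.

(** Formally u = k(z + b u). The difference P of the two sides vanishes at b = 0 and satisfies the
    linear equation d_b P = u d_z P modulo b ^ N, so each coefficient vanishes once the preceding
    ones do. *)
Lemma coef_compP_zeta N i : (i <= N)%N -> (compP k (zeta N))`_i = u i.
Proof.
set P := trunc N - compP k (zeta N).
have LP : sdvd N (transport (trunc N) P).
  have -> : P = trunc N + (-1)%:P%:P * compP k (zeta N).
    by rewrite /P !polyCN; ring.
  rewrite transportD transportM transportC mul0r add0r; apply: sdvdD.
    exact: transport_trunc.
  exact/sdvdMl/sdvd_transport_comp/transport_zeta.
suff invalpha0 j : (j <= N)%N -> P`_j = 0.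
  by move=> /[dup] /invalpha0 + iN; rewrite coefB coef_trunc// => /eqP; rewrite subr_eq0 => /eqP.
elim/ltn_ind: j => -[_ _|j IH jN].
  rewrite coefB coef_trunc// u0 coef_compP0 ?subrr//.
  by rewrite coefD coefC coefXM/= addr0.
have := LP j jN; rewrite coefB coef_deriv coefM big1 => [|l _]; last first.
  by rewrite coef_dz IH ?deriv0 ?mulr0 ?ltnS ?leq_subr// (leq_trans (leq_subr _ _)) ?(ltnW jN).
by rewrite subr0 -scaler_nat => /eqP; rewrite scaler_eq0 pnatr_eq0/= => /eqP.
Qed.

(** * Evaluation at non-negative b and z *)

Section Eval.
Variables (b z : R).
Hypothesis k_ge0 : forall i, 0 <= k`_i.
Hypothesis b_ge0 : 0 <= b.
Hypothesis z_ge0 : 0 <= z.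

(** Non-negativity coefficient by coefficient in b, after evaluation in z; truncations are compared
    in this order. *)
Definition nng p := forall i, 0 <= (p`_i).[z].

Lemma nngD p q : nng p -> nng q -> nng (p + q).
Proof. by move=> hp hq i; rewrite coefD hornerD addr_ge0. Qed.

Lemma nngM p q : nng p -> nng q -> nng (p * q).
Proof.
by move=> hp hq i; rewrite coefM horner_sum sumr_ge0// => j _; rewrite hornerM mulr_ge0.
Qed.

Lemma nngC (c : R) : 0 <= c -> nng c%:P%:P.
Proof. by move=> c0 i; rewrite coefC; case: eqP => _; rewrite hornerC. Qed.

Lemma nng_sum (I : Type) (r : seq I) (P : pred I) (F : I -> {poly {poly R}}) :
  (forall i, P i -> nng (F i)) -> nng (\sum_(i <- r | P i) F i).
Proof.
move=> h; elim/big_ind : _ => //; first by move=> i; rewrite coef0 horner0.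
exact: nngD.
Qed.

Lemma nngX p n : nng p -> nng (p ^+ n).
Proof.
by move=> hp; elim: n => [|n IH]; rewrite ?expr0 ?exprS; [exact: (@nngC 1)|exact: nngM].
Qed.

Lemma u_horner_ge0 n : (forall j, (j <= n)%N -> forall i, 0 <= (u j)`_i).
Proof.
elim: n => [|n IH] j; first by rewrite leqn0 => /eqP -> i; rewrite u0.
rewrite leq_eqVlt => /predU1P[-> i|]; last exact: IH.
rewrite -(pmulr_rge0 _ (ltr0Sn R n)) -coefZ uS coef_sum sumr_ge0// => l _.
rewrite coefM sumr_ge0// => m _; rewrite mulr_ge0//.
  by apply: IH; rewrite -ltnS.
by rewrite coef_deriv mulrn_wge0// IH// leq_subr.
Qed.

Lemma horner_u_ge0 n : 0 <= (u n).[z].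
Proof.
rewrite horner_coef sumr_ge0// => i _.
by rewrite mulr_ge0 ?exprn_ge0//; exact: (@u_horner_ge0 n).
Qed.

Lemma nng_zetaB N N' : (N <= N')%N -> nng (zeta N' - zeta N).
Proof.
move=> NN; rewrite /zeta opprD addrACA subrr add0r -mulrBr; apply: nngM.
  move=> i; rewrite coefX; case: eqP => _; rewrite ?hornerC ?horner0//.
move=> i; rewrite coefB !coef_poly; case: ifPn => iN'; case: ifPn => iN.
- by rewrite subrr horner0.
- by rewrite subr0 horner_u_ge0.
- by rewrite (leq_trans iN) in iN'.
- by rewrite subrr horner0.
Qed.

Lemma nng_zeta N : nng (zeta N).
Proof.
apply: nngD => [i|]; first by rewrite coefC; case: eqP => _; rewrite ?hornerX ?horner0.
apply: nngM => i; first by rewrite coefX; case: eqP => _; rewrite hornerC.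
by rewrite coef_poly; case: ifP => _; rewrite ?horner0// horner_u_ge0.
Qed.

Lemma nng_compP N : nng (compP k (zeta N)).
Proof.
apply: nng_sum => i _; apply: nngM; first exact: nngC.
exact/nngX/nng_zeta.
Qed.

Lemma nng_compPB N N' : (N <= N')%N -> nng (compP k (zeta N') - compP k (zeta N)).
Proof.
move=> NN; rewrite /compP -sumrB; apply: nng_sum => i _.
rewrite -mulrBr subrXX; apply: nngM; first exact: nngC.
apply: nngM; first exact: nng_zetaB.
by apply: nng_sum => j _; apply: nngM; apply: nngX; apply: nng_zeta.
Qed.

Definition burgers_sum N := \sum_(n < N.+1) b ^+ n * (u n).[z].

Lemma eval_sum p : (p.[b%:P]).[z] = \sum_(n < size p) b ^+ n * (p`_n).[z].
Proof.
rewrite (horner_coef p) horner_sum; apply: eq_bigr => i _.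
by rewrite hornerM -polyC_exp hornerC mulrC.
Qed.

Lemma eval_widen p N : (size p <= N)%N ->
  (p.[b%:P]).[z] = \sum_(n < N) b ^+ n * (p`_n).[z].
Proof.
move=> pN; rewrite eval_sum (big_ord_widen N (fun n => b ^+ n * (p`_n).[z]))// big_mkcond/=.
apply: eq_bigr => i _; case: ifPn => //; rewrite -leqNgt => /leq_sizeP -> //.
by rewrite horner0 mulr0.
Qed.

Lemma eval_trunc N : ((trunc N).[b%:P]).[z] = burgers_sum N.
Proof.
rewrite (@eval_widen _ N.+1) ?size_poly//; apply: eq_bigr => i _.
by rewrite coef_trunc// -ltnS.
Qed.

Lemma eval_compP N :
  ((compP k (zeta N)).[b%:P]).[z] = k.[z + b * burgers_sum N].
Proof.
rewrite /compP !horner_sum [RHS]horner_coef; apply: eq_bigr => i _.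
rewrite !(hornerM, hornerC, hornerE_comm)//; congr (_ * _).
by rewrite !horner_exp /zeta !(hornerD, hornerM, hornerX, hornerC) eval_trunc.
Qed.

(** Since zeta contains b times the truncation, k(zeta) is already exact up to degree [N.+1] in b,
    and its further coefficients are non-negative. This is the induction step behind every upper
    bound on u. *)
Lemma burgers_sum_le N : burgers_sum N.+1 <= k.[z + b * burgers_sum N].
Proof.
set s := maxn N.+2 (size (compP k (zeta N))).
rewrite -eval_compP (@eval_widen _ s) ?leq_maxr//.
rewrite /burgers_sum (big_ord_widen s (fun n => b ^+ n * (u n).[z])) ?leq_maxl//.
rewrite [leLHS]big_mkcond/= ler_sum// => i _; case: ifPn => iN; last first.
  by rewrite mulr_ge0 ?exprn_ge0// nng_compP.
rewrite ler_wpM2l ?exprn_ge0// -(@coef_compP_zeta N.+1)//.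
suff /(_ i iN) : sdvd N.+2 (compP k (zeta N.+1) - compP k (zeta N)).
  by rewrite coefB => /eqP; rewrite subr_eq0 => /eqP ->.
rewrite /compP -sumrB; apply: sdvd_sum => j _.
rewrite -mulrBr subrXX; apply: sdvdMl; rewrite mulrC; apply: sdvdMl => l lN.
rewrite /zeta opprD addrACA subrr add0r -mulrBr coefXM.
case: eqP => // /eqP l0; rewrite coefB !coef_trunc ?subrr// -ltnS prednK ?lt0n//.
exact: ltnW.
Qed.

(** The polynomial k(zeta) has finitely many powers of b, and each of its coefficients is at most
    that of u, because truncating zeta only drops non-negative terms. *)
Lemma le_burgers_sum N : exists N', k.[z + b * burgers_sum N] <= burgers_sum N'.
Proof.
exists (size (compP k (zeta N))); rewrite -eval_compP.
rewrite (@eval_widen _ (size (compP k (zeta N))).+1)//.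
apply: ler_sum => i _; rewrite ler_wpM2l ?exprn_ge0//.
set N' := maxn i N.
rewrite -(@coef_compP_zeta N') ?leq_maxl//.
by have := nng_compPB (leq_maxr i N) i; rewrite coefB hornerD hornerN subr_ge0.
Qed.

Lemma burgers_sum0 : burgers_sum 0 = k.[z].
Proof. by rewrite /burgers_sum big_ord1 expr0 mul1r u0. Qed.

End Eval.

End Burgers.

End FormalBurgers.

(** * Double series *)

Section DoubleSeries.
Variable R : realType.
Implicit Types (f g : nat -> nat -> R) (N L : nat) (B : \bar R).

Definition dsum N f : \bar R :=
  (\sum_(N <= a <oo) \sum_(1 <= m <oo) (f a m)%:E)%E.

Definition psum N L f : R := \sum_(N <= a < L) \sum_(1 <= m < L) f a m.

Lemma eq_dsum N f g : (forall a m, (N <= a)%N -> (0 < m)%N -> f a m = g a m) ->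
  dsum N f = dsum N g.
Proof.
move=> fg; rewrite /dsum; congr (lim (_ @ \oo)); apply/funext => n.
apply: eq_big_nat => a /andP[Na _]; congr (lim (_ @ \oo)); apply/funext => k.
by apply: eq_big_nat => m /andP[m0 _]; rewrite fg.
Qed.

Lemma eq_psum N L f g : (forall a m, (N <= a)%N -> (0 < m)%N -> f a m = g a m) ->
  psum N L f = psum N L g.
Proof.
move=> fg; apply: eq_big_nat => a /andP[Na _].
by apply: eq_big_nat => m /andP[m0 _]; rewrite fg.
Qed.

Lemma ler_psum N L f g : (forall a m, (N <= a)%N -> (0 < m)%N -> f a m <= g a m) ->
  psum N L f <= psum N L g.
Proof.
move=> fg; apply: ler_sum_nat => a /andP[Na _].
by apply: ler_sum_nat => m /andP[m0 _]; rewrite fg.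
Qed.

Lemma psum_ge0 N L f : (forall a m, 0 <= f a m) -> 0 <= psum N L f.
Proof. by move=> f0; apply: sumr_ge0 => a _; apply: sumr_ge0. Qed.

Lemma psum_nd N L L' f : (forall a m, 0 <= f a m) -> (L <= L')%N ->
  psum N L f <= psum N L' f.
Proof.
move=> f0 LL; rewrite /psum; case: (leqP N L) => NL; last first.
  by rewrite big_geq 1?ltnW// sumr_ge0// => a _; apply: sumr_ge0.
rewrite (big_cat_nat (n:=L) NL LL)/= ler_wpDr//.
  by apply: sumr_ge0 => a _; apply: sumr_ge0.
apply: ler_sum => a _; case: (leqP 1 L) => L1; last first.
  by rewrite big_geq 1?ltnW// sumr_ge0.
by rewrite (big_cat_nat (n:=L) L1 LL)/= ler_wpDr// sumr_ge0.
Qed.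

Lemma psum_le_dsum N L f : (forall a m, 0 <= f a m) -> ((psum N L f)%:E <= dsum N f)%E.
Proof.
move=> f0; have h := @nneseries_lim_ge R
  (fun a => (\sum_(1 <= m <oo) (f a m)%:E)%E) xpredT N L.
apply: (le_trans _ (h _)); last first.
  by move=> a _ _; apply: nneseries_ge0 => m _ _; rewrite lee_fin.
rewrite /psum -sumEFin; apply: lee_sum => a _; rewrite -sumEFin.
by apply: nneseries_lim_ge => m _ _; rewrite lee_fin.
Qed.

(** A finite outer sum commutes with the inner series, so both limits are reached through
    rectangles, and each rectangle lies in a square. *)
Lemma dsum_le N f B : (forall a m, 0 <= f a m) ->
  (forall L, ((psum N L f)%:E <= B)%E) -> (dsum N f <= B)%E.
Proof.
move=> f0 fB; apply: lime_le.
  by apply: is_cvg_nneseries => a _ _; apply: nneseries_ge0 => m _ _; rewrite lee_fin.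
near=> L; rewrite -nneseries_sum; last by move=> *; rewrite lee_fin.
apply: lime_le.
  by apply: is_cvg_nneseries => m _ _; apply: sume_ge0 => a _; rewrite lee_fin.
near=> M; apply: le_trans (fB (maxn L M)).
rewrite exchange_big/= /psum.
under eq_bigr do rewrite sumEFin.
rewrite sumEFin lee_fin; apply: (@le_trans _ _ (\sum_(N <= a < L) \sum_(1 <= m < maxn L M) f a m)).
  apply: ler_sum => a _; case: (leqP 1 M) => M1; last by rewrite big_geq 1?ltnW// sumr_ge0.
  by rewrite (big_cat_nat (n:=M) M1 (leq_maxr _ _))/= ler_wpDr// sumr_ge0.
case: (leqP N L) => NL; last by rewrite big_geq 1?ltnW// sumr_ge0// => a _; apply: sumr_ge0.
rewrite (big_cat_nat (n:=L) NL (leq_maxl _ _))/= ler_wpDr//.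
by apply: sumr_ge0 => a _; apply: sumr_ge0.
Unshelve. all: by end_near. Qed.

Lemma dsum_ge0 N f : (forall a m, 0 <= f a m) -> (0 <= dsum N f)%E.
Proof.
by move=> f0; apply: nneseries_ge0 => a _ _; apply: nneseries_ge0 => m _ _; rewrite lee_fin.
Qed.

Lemma lee_dsum N f g : (forall a m, 0 <= f a m) -> (forall a m, (N <= a)%N -> (0 < m)%N -> f a m <= g a m) ->
  (forall a m, 0 <= g a m) -> (dsum N f <= dsum N g)%E.
Proof.
move=> f0 fg g0; apply: dsum_le => // L.
by apply: le_trans (psum_le_dsum N L g0); rewrite lee_fin ler_psum.
Qed.

Lemma dsumZ N f (x : R) : (forall a m, 0 <= f a m) ->
  dsum N (fun a m => x * f a m) = (x%:E * dsum N f)%E.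
Proof.
move=> f0; rewrite /dsum -nneseriesZl; last first.
  by move=> a _; apply: nneseries_ge0 => m _ _; rewrite lee_fin.
congr (lim (_ @ \oo)); apply/funext => n; apply: eq_bigr => a _.
by rewrite -nneseriesZl// => m _; rewrite lee_fin.
Qed.

Lemma dsumD N f g : (forall a m, 0 <= f a m) -> (forall a m, 0 <= g a m) ->
  dsum N (fun a m => f a m + g a m) = (dsum N f + dsum N g)%E.
Proof.
move=> f0 g0; rewrite /dsum -nneseriesD; first last.
- by move=> a _ _; apply: nneseries_ge0 => m _ _; rewrite lee_fin.
- by move=> a _ _; apply: nneseries_ge0 => m _ _; rewrite lee_fin.
congr (lim (_ @ \oo)); apply/funext => n; apply: eq_bigr => a _.
by rewrite -nneseriesD// => m _ _; rewrite lee_fin.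
Qed.

Lemma dsum_widen1 f : (forall a m, 0 <= f a m) -> (forall m, f 0 m = 0) ->
  dsum 0 f = dsum 1 f.
Proof.
move=> f0 f00; rewrite /dsum nneseries_recl//; last first.
  by move=> a _; apply: nneseries_ge0 => m _ _; rewrite lee_fin.
rewrite [X in (X + _)%E](_ : _ = 0%E) ?add0e//.
by rewrite eseries0// => m _ _; rewrite f00.
Qed.

Lemma dsum_gt0 N f : (forall a m, 0 <= f a m) -> (0 < dsum N f)%E ->
  exists a m, [/\ (N <= a)%N, (0 < m)%N & 0 < f a m].
Proof.
move=> f0; apply: contraPP => h; apply/negP; rewrite -leNgt; apply: dsum_le => // L.
rewrite lee_fin /psum big_nat big1// => a /andP[Na _]; rewrite big_nat big1// => m /andP[m0 _].
apply/eqP; rewrite eq_le f0 andbT leNgt; apply/negP => fam; apply: h.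
by exists a, m.
Qed.

Lemma psum_ge1 N L f a m : (forall a m, 0 <= f a m) -> (N <= a < L)%N -> (0 < m < L)%N ->
  f a m <= psum N L f.
Proof.
move=> f0 aL mL; rewrite /psum (bigD1_seq a)/= ?iota_uniq ?mem_index_iota//.
rewrite (bigD1_seq m)/= ?iota_uniq ?mem_index_iota// -addrA ler_wpDr// addr_ge0//.
  by rewrite sumr_ge0.
by apply: sumr_ge0 => b _; apply: sumr_ge0.
Qed.

Lemma dsum_ge1 N f a m : (forall a m, 0 <= f a m) -> (N <= a)%N -> (0 < m)%N ->
  ((f a m)%:E <= dsum N f)%E.
Proof.
move=> f0 Na m0; apply: le_trans (psum_le_dsum N (maxn a m).+1 f0).
by rewrite lee_fin psum_ge1// ?Na ?m0 ltnS ?leq_maxl ?leq_maxr.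
Qed.

Lemma gee0_dsum_approx N f (u e : R) : (forall a m, 0 <= f a m) -> dsum N f = u%:E ->
  0 < e -> exists L, u - e < psum N L f.
Proof.
move=> f0 fu e0; apply: contrapT => /forallNP h.
suff : (dsum N f <= (u - e)%:E)%E by rewrite fu lee_fin lerBrDr gerDl leNgt e0.
by apply: dsum_le => // L; rewrite lee_fin leNgt; apply/negP/h.
Qed.

End DoubleSeries.

(** * Coefficients of the evolution *)

Section Coefficients.
Variable R : realType.
Variable c : nat -> nat -> R.
Hypothesis c_ge0 : forall a m, 0 <= c a m.
Hypothesis c_0 : forall a, c a 0 = 0.
Implicit Types (a m n L N : nat).

(* The outer variable counts the arms and the inner one the mass. [stage L n] is
   the coefficient of b ^ n in the solution v of d_b v = (d_x v)^2 / 2 started from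
   the truncation of the generating function of c to a, m < L; the coefficient at
   (a, m) does not depend on L once a + m < L. *)
Definition init L : {poly {poly R}} := \poly_(a < L) \poly_(m < L) c a m.

(** Course-of-values recursion: the list keeps all earlier stages. The factor 1 / (2 (n + 1))
    combines the derivative in b with the one half of (d_x v)^2 / 2. *)
Fixpoint stages L n : seq {poly {poly R}} :=
  if n is n'.+1 then
    let s := stages L n' in
    rcons s (((n'.+1.*2)%:R^-1)%:P *:
      \sum_(j < n'.+1) (nth 0 s j)^`() * (nth 0 s (n' - j))^`())
  else [:: init L].

Definition stage L n := nth 0 (stages L n) n.

Lemma size_stages L n : size (stages L n) = n.+1.
Proof. by elim: n => //= n IH; rewrite size_rcons IH. Qed.

Lemma nth_stages L n j : (j <= n)%N -> nth 0 (stages L n) j = stage L j.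
Proof.
elim: n => [|n IH]; first by rewrite leqn0 => /eqP ->.
rewrite leq_eqVlt => /predU1P[-> //|]; rewrite ltnS => jn.
by rewrite /= nth_rcons size_stages ltnS jn IH.
Qed.

Lemma stageS L n : stage L n.+1 = ((n.+1.*2)%:R^-1)%:P *:
  \sum_(j < n.+1) (stage L j)^`() * (stage L (n - j))^`().
Proof.
rewrite {1}/stage /= nth_rcons size_stages ltnn eqxx; congr (_ *: _).
by apply: eq_bigr => j _; rewrite !nth_stages ?leq_subr// -ltnS.
Qed.

Definition cf L n a m : R := ((stage L n)`_a)`_m.

Lemma cf0 L a m : cf L 0 a m = if (a < L)%N && (m < L)%N then c a m else 0.
Proof.
by rewrite /cf /stage/= coef_poly; case: ifPn => aL; rewrite ?coef0// coef_poly.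
Qed.

Lemma cfS L n a m : cf L n.+1 a m = (n.+1.*2)%:R^-1 *
  \sum_(j < n.+1) \sum_(l < a.+1) \sum_(k < m.+1)
    (l.+1%:R * cf L j l.+1 k) *
    ((a - l).+1%:R * cf L (n - j) (a - l).+1 (m - k)).
Proof.
rewrite /cf stageS coefZ coefCM coef_sum coef_sum; congr (_ * _).
apply: eq_bigr => j _; rewrite coefM coef_sum; apply: eq_bigr => l _.
rewrite coefM; apply: eq_bigr => k _.
by rewrite !coef_deriv !coefMn !mulr_natl.
Qed.

Lemma cf_ge0 L n a m : 0 <= cf L n a m.
Proof.
elim/ltn_ind: n a m => -[_|n IH] a m; first by rewrite cf0; case: ifP.
rewrite cfS mulr_ge0 ?invr_ge0 ?ler0n// sumr_ge0// => j _; rewrite sumr_ge0// => l _.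
by rewrite sumr_ge0// => k _; rewrite !mulr_ge0// ?IH// ?ltnS// leq_subr.
Qed.

(** The coefficient of b ^ n describes particles formed by n coagulations, hence out of n + 1
    initial particles, each of mass at least 1. This is why each concentration is a polynomial in
    b. *)
Lemma cf_eq0 L n a m : (m <= n)%N -> cf L n a m = 0.
Proof.
elim/ltn_ind: n a m => -[_|n IH] a m mn.
  by move: mn; rewrite leqn0 => /eqP ->; rewrite cf0 c_0 if_same.
rewrite cfS big1 ?mulr0// => j _; rewrite big1// => l _; rewrite big1// => k _.
case: (leqP k j) => kj; first by rewrite (IH j)// mulr0 mul0r.
rewrite (IH (n - j)%N) ?mulr0 ?ltnS ?leq_subr// leq_subLR.
have := ltn_ord j; lia.
Qed.

Lemma cf_m0 L n a : cf L n a 0 = 0.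
Proof. exact: cf_eq0. Qed.

(** With a' + a'' = a + 2, m' + m'' = m and a'', m'' >= 1, a coagulating particle satisfies a' + m'
    <= a + m. A truncation beyond a + m is therefore never felt. *)
Lemma cf_stable L L' n a m : (a + m < L)%N -> (a + m < L')%N ->
  cf L n a m = cf L' n a m.
Proof.
elim/ltn_ind: n a m => -[_|n IH] a m aL aL'.
  by rewrite !cf0 !(leq_ltn_trans (leq_addr _ _) aL, leq_ltn_trans (leq_addl _ _) aL,
    leq_ltn_trans (leq_addr _ _) aL', leq_ltn_trans (leq_addl _ _) aL').
rewrite !cfS; congr (_ * _); apply: eq_bigr => j _; apply: eq_bigr => l _.
apply: eq_bigr => k _.
have [->|k0] := eqVneq (nat_of_ord k) 0; first by rewrite !cf_m0 !mulr0 !mul0r.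
have [km|km] := leqP m k.
  have -> : (m - k = 0)%N by apply/eqP.
  by rewrite !cf_m0 !mulr0.
have h1 : (l.+1 + k <= a + m)%N.
  have := ltn_ord l; lia.
have h2 : ((a - l).+1 + (m - k) <= a + m)%N.
  lia.
rewrite (IH j (ltn_ord j) _ _ (leq_ltn_trans h1 aL) (leq_ltn_trans h1 aL')).
rewrite (IH (n - j)%N _ _ _ (leq_ltn_trans h2 aL) (leq_ltn_trans h2 aL'))//.
by rewrite ltnS leq_subr.
Qed.

Lemma cf_nd L L' n a m : (L <= L')%N -> cf L n a m <= cf L' n a m.
Proof.
move=> LL; elim/ltn_ind: n a m => -[_|n IH] a m.
  rewrite !cf0; case: ifPn => [/andP[aL mL]|_]; first by rewrite !(leq_trans _ LL).
  by case: ifP.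
rewrite !cfS ler_wpM2l ?invr_ge0 ?ler0n// ler_sum// => j _; rewrite ler_sum// => l _.
rewrite ler_sum// => k _; apply: ler_pM; rewrite ?mulr_ge0 ?cf_ge0//.
  by rewrite ler_wpM2l// IH.
by rewrite ler_wpM2l// IH// ltnS leq_subr.
Qed.

Definition ecoef n a m := cf (a + m).+1 n a m.

Lemma ecoef_ge0 n a m : 0 <= ecoef n a m. Proof. exact: cf_ge0. Qed.

Lemma ecoefE L n a m : (a + m < L)%N -> ecoef n a m = cf L n a m.
Proof. by move=> aL; apply: cf_stable. Qed.

Lemma cf_le_ecoef L n a m : cf L n a m <= ecoef n a m.
Proof.
rewrite (@ecoefE (maxn L (a + m).+1)) ?leq_maxr//.
exact/cf_nd/leq_maxl.
Qed.

Lemma ecoef_eq0 n a m : (m <= n)%N -> ecoef n a m = 0.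
Proof. exact: cf_eq0. Qed.

Lemma ecoefS n a m : ecoef n.+1 a m = (n.+1.*2)%:R^-1 *
  \sum_(j < n.+1) \sum_(l < a.+1) \sum_(k < m.+1)
    (l.+1%:R * ecoef j l.+1 k) *
    ((a - l).+1%:R * ecoef (n - j) (a - l).+1 (m - k)).
Proof.
rewrite {1}/ecoef cfS; congr (_ * _); apply: eq_bigr => j _; apply: eq_bigr => l _.
apply: eq_bigr => k _.
have [->|k0] := eqVneq (nat_of_ord k) 0.
  by rewrite cf_m0 ecoef_eq0// !mulr0 !mul0r.
have [km|km] := leqP m k.
  have -> : (m - k = 0)%N by apply/eqP.
  by rewrite cf_m0 (@ecoef_eq0 _ _ 0)// !mulr0.
have h1 : (l.+1 + k <= a + m)%N.
  have := ltn_ord l; lia.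
have h2 : ((a - l).+1 + (m - k) <= a + m)%N.
  lia.
rewrite (@ecoefE (a + m).+1 j)// (@ecoefE (a + m).+1 (n - j)%N)//.
Qed.

Definition evolution a m : {poly R} := \poly_(n < m) ecoef n a m.

Lemma coef_evolution a m n : (evolution a m)`_n = ecoef n a m.
Proof. by rewrite coef_poly; case: ltnP => // mn; rewrite ecoef_eq0. Qed.

Definition evol (b : R) a m : R := (evolution a m).[b].

Lemma evolE b a m : evol b a m = \sum_(n < m) ecoef n a m * b ^+ n.
Proof. by rewrite /evol horner_poly. Qed.

Lemma evol_ge0 b a m : 0 <= b -> 0 <= evol b a m.
Proof.
by move=> b0; rewrite evolE sumr_ge0// => n _; rewrite mulr_ge0 ?ecoef_ge0 ?exprn_ge0.
Qed.

Lemma evol_0 a m : evol 0 a m = c a m.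
Proof.
rewrite /evol horner_coef0 coef_evolution /ecoef cf0 ltnS leq_addr ltnS leq_addl//.
Qed.

Lemma evol_m0 b a : evol b a 0 = 0.
Proof. by rewrite evolE big_ord0. Qed.

Lemma evolution_deriv a m : (evolution a m)^`() = 2^-1 *:
  \sum_(1 <= a' < a.+2) \sum_(1 <= m' < m)
    (a'%:R * (a + 2 - a')%:R) *: (evolution a' m' * evolution (a + 2 - a') (m - m')).
Proof.
apply/polyP => n; rewrite coef_deriv coef_evolution ecoefS coefZ.
rewrite -[LHS]mulr_natl mulrA -muln2 natrM invfM mulrA divff ?pnatr_eq0// mul1r.
congr (_ * _); rewrite coef_sum.
under [RHS]eq_bigr do rewrite coef_sum.
rewrite exchange_big/=.
rewrite big_add1/= big_mkord; apply: eq_bigr => l _.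
under [RHS]eq_bigr do rewrite coefZ coefM.
rewrite exchange_big/=.
rewrite -(big_mkord xpredT (fun k => \sum_(j < n.+1) l.+1%:R * ecoef j l.+1 k *
  ((a - l).+1%:R * ecoef (n - j) (a - l).+1 (m - k)))).
have -> : (a + 2 - l.+1 = (a - l).+1)%N by rewrite addn2 subSS subSn// -ltnS.
rewrite big_nat_recr//= [X in _ + X]big1 ?addr0; last first.
  by move=> j _; rewrite subnn (@ecoef_eq0 _ _ 0)// !mulr0.
rewrite [LHS]big_mkcond [in RHS]big_mkcond/=.
case: m => [|m]; first by rewrite !big_geq.
rewrite big_nat_recl//= [X in X + _]big1 ?add0r; last first.
  by move=> j _; rewrite ecoef_eq0// mulr0 mul0r.
rewrite big_add1/=; apply: eq_big_nat => k /andP[_ km].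
rewrite mulr_sumr; apply: eq_bigr => j _.
by rewrite !coef_evolution mulrACA.
Qed.

Lemma evolution_gain b a m : (evolution a m)^`().[b] = gain (evol b) a m.
Proof.
rewrite evolution_deriv hornerZ horner_sum /gain; congr (_ * _).
apply: eq_bigr => a' _; rewrite horner_sum; apply: eq_bigr => m' _.
by rewrite hornerZ hornerM mulrA.
Qed.

End Coefficients.

(** * The fixed-point equation u = k(z + b u) *)

Section FixedPoint.
Variable R : realType.
Variable c : nat -> nat -> R.
Hypothesis c_ge0 : forall a m, 0 <= c a m.
Hypothesis c_0 : forall a, c a 0 = 0.
Variable y : R.
Hypothesis y_ge0 : 0 <= y.
Implicit Types (a m n L N S : nat) (b x z u : R).

Definition gterm (f : nat -> nat -> R) x a m : R := a%:R * f a m * x ^+ a.-1 * y ^+ m.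

Lemma gterm_ge0 (f : nat -> nat -> R) x : (forall a m, 0 <= f a m) -> 0 <= x -> forall a m, 0 <= gterm f x a m.
Proof. by move=> f0 x0 a m; rewrite /gterm !mulr_ge0 ?exprn_ge0. Qed.

Lemma ler_gterm (f g : nat -> nat -> R) x a m : f a m <= g a m -> 0 <= x -> gterm f x a m <= gterm g x a m.
Proof. by move=> fg x0; rewrite /gterm !ler_wpM2r ?exprn_ge0// ler_wpM2l. Qed.

(** If d_b v = (d_x v)^2 / 2, then d_x v solves the Burgers equation; here v is a stage with y
    substituted for the mass variable. *)
Definition ustage L n : {poly R} := (map_poly (horner_eval y) (stage c L n))^`().

Lemma ustageS L n : n.+1%:R *: ustage L n.+1 =
  \sum_(j < n.+1) ustage L j * (ustage L (n - j))^`().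
Proof.
rewrite /ustage stageS map_polyZ/= horner_evalE hornerC derivZ scalerA.
rewrite -muln2 natrM invfM mulrA divff ?pnatr_eq0// mul1r.
rewrite rmorph_sum raddf_sum/=.
under eq_bigr => j _ do rewrite rmorphM/= derivM -!deriv_map.
(* Reversing the index turns one half of the product rule into the other, which cancels the factor 1
   / 2. *)
rewrite big_split/= (reindex_inj rev_ord_inj)/=.
have -> : \sum_(j < n.+1) (map_poly (horner_eval y) (stage c L (n.+1 - j.+1)))^`()^`() *
      (map_poly (horner_eval y) (stage c L (n - (n.+1 - j.+1))))^`() =
    \sum_(j < n.+1) (map_poly (horner_eval y) (stage c L j))^`() *
      (map_poly (horner_eval y) (stage c L (n - j)))^`()^`().
  apply: eq_bigr => j _; rewrite mulrC subSS; congr (_^`() * _).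
  by rewrite subKn// -ltnS.
by rewrite -[X in _ *: X]mulr2n -[X in _ *: X]scaler_nat scalerA mulVf ?scale1r// pnatr_eq0.
Qed.

(** A polynomial has finitely many terms, so a large square is exact; the column of mass 0, absent
    from [psum], vanishes. *)
Lemma ustage_psum L n : exists S0, forall S z, (S0 <= S)%N ->
  (ustage L n).[z] = psum 1 S (gterm (cf c L n) z).
Proof.
set p : {poly {poly R}} := stage c L n.
exists (size p + \sum_(i < size p) size (p`_i)%R)%N => S z S0.
have sp i : (size (p`_i)%R <= S)%N.
  case: (ltnP i (size p)) => [ip|/leq_sizeP -> //]; last by rewrite size_poly0.
  apply: leq_trans S0; rewrite (bigD1 (Ordinal ip))//= addnA addnAC.
  exact: leq_addl.
have sS : (size p <= S)%N by rewrite (leq_trans (leq_addr _ _) S0).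
rewrite /psum big_add1 (@horner_coef_wide _ S.-1); last first.
  apply: leq_trans (size_poly _ _) _; rewrite -!subn1 leq_sub2r//.
  exact: leq_trans (size_poly _ _) sS.
rewrite big_mkord; apply: eq_bigr => i _.
rewrite /ustage -/p coef_deriv coef_map_id0 ?horner_evalE ?horner0//.
rewrite (@horner_coef_wide _ S (p`_i.+1))//.
case: S S0 sp sS i => [|S] S0 sp sS i; first by case: i.
rewrite big_ord_recl/= -[X in X * _ + _]/(cf c L n i.+1 0) cf_m0// mul0r add0r.
rewrite big_add1/= big_mkord -mulr_natl mulr_sumr mulr_suml; apply: eq_bigr => j _.
rewrite /gterm /= -[X in _ * (X * _) * _]/(cf c L n i.+1 j.+1).
by rewrite mulrA mulrAC.
Qed.

Let k L := ustage L 0.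

Lemma k_ge0 L i : 0 <= (k L)`_i.
Proof.
rewrite /k /ustage coef_deriv coef_map_id0 ?horner_evalE ?horner0//.
rewrite mulrn_wge0// horner_coef sumr_ge0// => j _.
by rewrite mulr_ge0 ?exprn_ge0//; exact: (@cf_ge0 _ _ c_ge0 L 0).
Qed.

Lemma k_nd L z z' : 0 <= z -> z <= z' -> (k L).[z] <= (k L).[z'].
Proof.
move=> z0 zz; rewrite !horner_coef ler_sum// => i _.
by rewrite ler_wpM2l ?k_ge0// lerXn2r// nnegrE (le_trans z0).
Qed.

Lemma k_le L x : 0 <= x -> (((k L).[x])%:E <= genfun c x y)%E.
Proof.
move=> x0; have [S hS] := ustage_psum L 0; rewrite /k (hS S)//.
apply: le_trans (psum_le_dsum 1 S (gterm_ge0 c_ge0 x0)).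
rewrite lee_fin; apply: ler_psum => a m _ _; apply: ler_gterm => //.
by rewrite cf0; case: ifP.
Qed.

Lemma le_k S L x : 0 <= x -> (S <= L)%N -> psum 1 S (gterm c x) <= (k L).[x].
Proof.
move=> x0 SL; have [S' hS'] := ustage_psum L 0; rewrite /k (hS' (maxn S S')) ?leq_maxr//.
apply: (@le_trans _ _ (psum 1 S (gterm (cf c L 0) x))).
  rewrite /psum ler_sum_nat// => a /andP[_ aS]; rewrite ler_sum_nat// => m /andP[_ mS].
  by rewrite ler_gterm// cf0 (leq_trans aS)// (leq_trans mS).
by apply: psum_nd; rewrite ?leq_maxl//; apply: gterm_ge0 => // a m; apply: cf_ge0.
Qed.

Notation bsum L := (burgers_sum (ustage L)).

Lemma psum_lin N S (F : nat -> nat -> nat -> R) (b z : R) :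
  \sum_(n < N) b ^+ n * psum 1 S (gterm (F n) z) =
  psum 1 S (gterm (fun a m => \sum_(n < N) F n a m * b ^+ n) z).
Proof.
rewrite /psum; under eq_bigr do rewrite mulr_sumr.
rewrite exchange_big/=; apply: eq_bigr => a _.
under eq_bigr do rewrite mulr_sumr.
rewrite exchange_big/=; apply: eq_bigr => m _.
rewrite /gterm mulr_sumr !mulr_suml; apply: eq_bigr => n _; ring.
Qed.

Lemma bsum_le L N b z : 0 <= b -> 0 <= z ->
  ((bsum L b z N)%:E <= genfun (evol c b) z y)%E.
Proof.
move=> b0 z0.
have [S hS] : exists S, forall n, (n <= N)%N -> (ustage L n).[z] = psum 1 S (gterm (cf c L n) z).
  have [f hf] := choice (ustage_psum L).
  exists (\sum_(n < N.+1) f n)%N => n nN; apply: hf.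
  by rewrite -ltnS in nN; rewrite (bigD1 (Ordinal nN))//= leq_addr.
rewrite /burgers_sum; under eq_bigr => n _ do rewrite hS -1?ltnS//.
rewrite psum_lin.
have e0 := @evol_ge0 _ c c_ge0 b.
apply: le_trans (psum_le_dsum 1 S (gterm_ge0 (fun a m => e0 a m b0) z0)).
rewrite lee_fin ler_psum// => a m _ _; apply: ler_gterm => //; rewrite evolE.
rewrite (big_ord_widen (maxn N.+1 m) (fun n => cf c L n a m * b ^+ n)) ?leq_maxl//.
rewrite (big_ord_widen (maxn N.+1 m) (fun n => ecoef c n a m * b ^+ n)) ?leq_maxr//.
rewrite big_mkcond [leRHS]big_mkcond/= ler_sum// => n _.
case: (ltnP n m) => nm; last first.
  by rewrite cf_eq0// mul0r if_same.
case: ifP => _; last by rewrite mulr_ge0 ?exprn_ge0// ecoef_ge0.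
by rewrite ler_wpM2r ?exprn_ge0// cf_le_ecoef.
Qed.

(** For a, m < S the truncation at L >= S + S leaves the coefficients exact, and only powers of b
    below m < S occur in them. *)
Lemma le_bsum S L b z : 0 <= b -> 0 <= z -> (S + S <= L)%N ->
  psum 1 S (gterm (evol c b) z) <= bsum L b z S.
Proof.
move=> b0 z0 SL.
apply: (@le_trans _ _ (\sum_(n < S.+1) b ^+ n * psum 1 S (gterm (cf c L n) z))).
  rewrite psum_lin /psum ler_sum_nat// => a /andP[_ aS]; rewrite ler_sum_nat// => m /andP[_ mS].
  apply: ler_gterm => //; rewrite evolE.
  rewrite (big_ord_widen S.+1 (fun n => ecoef c n a m * b ^+ n)) 1?ltnW 1?ltnS 1?ltnW//.
  rewrite big_mkcond/= ler_sum// => n _; rewrite (@ecoefE _ _ c_0 L); last by lia.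
  by case: ifP => // _; rewrite mulr_ge0 ?exprn_ge0// cf_ge0.
apply: ler_sum => n _; rewrite ler_wpM2l ?exprn_ge0//.
have [S' hS'] := ustage_psum L n; rewrite (hS' (maxn S S')) ?leq_maxr//.
by apply: psum_nd; rewrite ?leq_maxl//; apply: gterm_ge0 => // a m; apply: cf_ge0.
Qed.

(** The point x is a barrier for the iteration of [burgers_sum_le]: a partial sum s <= C gives z + b
    s <= x, so the next one is at most k(x) <= C. *)
Lemma genfun_evol_le b x z C : 0 <= b -> 0 <= z -> 0 <= x ->
  (genfun c x y <= C%:E)%E -> z + b * C <= x -> (genfun (evol c b) z y <= C%:E)%E.
Proof.
move=> b0 z0 x0 hC zx.
have C0 : 0 <= C.
  by rewrite -lee_fin (le_trans _ hC)//; apply: dsum_ge0; apply: gterm_ge0.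
have kC L : (k L).[x] <= C by rewrite -lee_fin (le_trans (k_le L x0)).
have bC L N : bsum L b z N <= C.
  have zb : z <= x by apply: le_trans zx; rewrite lerDl mulr_ge0.
  elim: N => [|N IH].
    by rewrite (@burgers_sum0 _ (k L))// (le_trans (k_nd L z0 zb)).
  apply: le_trans (@burgers_sum_le _ (k L) _ erefl (ustageS L) _ _ (k_ge0 L) b0 z0 N) _.
  have s0 : 0 <= bsum L b z N.
    rewrite /burgers_sum sumr_ge0// => n _; rewrite mulr_ge0 ?exprn_ge0//.
    exact: (@horner_u_ge0 _ (k L) _ erefl (ustageS L) _ (k_ge0 L)).
  apply: le_trans (kC L); apply: k_nd; first by rewrite addr_ge0// mulr_ge0.
  by apply: le_trans zx; rewrite lerD2l ler_wpM2l.
apply: dsum_le => [|S]; first by apply: gterm_ge0 => // a m; apply: evol_ge0.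
by rewrite lee_fin; apply: le_trans (le_bsum b0 z0 (leqnn _)) (bC _ _).
Qed.

(** The bound k(z + b u) <= u comes from [le_burgers_sum], as the partial sums approach u.
    Conversely, once k(z + b u) is finite and at most u, the point z + b u is itself a barrier for
    [genfun_evol_le], whence u <= k(z + b u). *)
Lemma genfun_evol_fix b z u : 0 <= b -> 0 <= z ->
  genfun (evol c b) z y = u%:E -> genfun c (z + b * u) y = u%:E.
Proof.
move=> b0 z0 hu.
have e0 := gterm_ge0 (fun a m => @evol_ge0 _ c c_ge0 b a m b0) z0.
have u0 : 0 <= u by rewrite -lee_fin -hu; apply: dsum_ge0.
have h0 : 0 <= z + b * u by rewrite addr_ge0// mulr_ge0.
have h_le : (genfun c (z + b * u) y <= u%:E)%E.
  apply: dsum_le => [|S]; first exact: gterm_ge0.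
  rewrite lee_fin; apply: (@le_trans _ _ (k S).[z + b * u]); first exact: le_k.
  have kS L N : (S <= L)%N -> (k S).[z + b * bsum L b z N] <= u.
    move=> SL; have s0 : 0 <= bsum L b z N.
      rewrite /burgers_sum sumr_ge0// => n _; rewrite mulr_ge0 ?exprn_ge0//.
      exact: (@horner_u_ge0 _ (k L) _ erefl (ustageS L) _ (k_ge0 L)).
    have [N' hN'] := @le_burgers_sum _ (k L) _ erefl (ustageS L) b z (k_ge0 L) b0 z0 N.
    have zb0 : 0 <= z + b * bsum L b z N by rewrite addr_ge0// mulr_ge0.
    apply: le_trans (le_trans hN' _); last first.
      by rewrite -lee_fin -hu; apply: bsum_le.
    have [S1 h1] := ustage_psum S 0; have [S2 h2] := ustage_psum L 0.
    rewrite /k (h1 (maxn S1 S2)) ?leq_maxl// (h2 (maxn S1 S2)) ?leq_maxr//.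
    by apply: ler_psum => a m _ _; apply: ler_gterm => //; apply: cf_nd.
  (* Continuity is used for the truncated polynomial only; nothing is known yet about the full
     series at z + b u. *)
  rewrite leNgt; apply/negP => ltu.
  have cont : continuous (fun x => (k S).[x]) by exact: continuous_horner.
  have [e /= e_gt0 he] : exists2 e, 0 < e & forall x, `|z + b * u - x| < e -> u < (k S).[x].
    have /= := cont (z + b * u) [set v | u < v].
    move=> /(_ _)/nbhs_ballP[]; first exact: lt_nbhsr.
    by move=> e e0' he; exists e => // x xe; apply: he.
  (* Dividing by b + 1 rather than by b covers b = 0 and makes b times the tolerance smaller than
     e. *)
  have d_gt0 : 0 < e / (b + 1) by rewrite divr_gt0// ltr_wpDl.
  have [S1 hS1] := gee0_dsum_approx e0 hu d_gt0.
  set S2 := maxn S S1.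
  have hS2 : u - e / (b + 1) < bsum (S2 + S2) b z S2.
    apply: lt_le_trans hS1 (le_trans _ (le_bsum b0 z0 (leqnn _))).
    exact/psum_nd/leq_maxr.
  have hu2 : bsum (S2 + S2) b z S2 <= u by rewrite -lee_fin -hu; apply: bsum_le.
  suff /he : `|z + b * u - (z + b * bsum (S2 + S2) b z S2)| < e.
    by rewrite ltNge kS// (leq_trans (leq_maxl S S1))// leq_addr.
  rewrite opprD addrACA subrr add0r -mulrBr normrM ger0_norm// ger0_norm ?subr_ge0//.
  have hd : u - bsum (S2 + S2) b z S2 < e / (b + 1) by rewrite ltrBlDl -ltrBlDr.
  apply: (@le_lt_trans _ _ (b * (e / (b + 1)))); first by rewrite ler_wpM2l// ltW.
  by rewrite mulrCA gtr_pMr// ltr_pdivrMr ?mul1r ?ltrDl// ltr_wpDl.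
apply/eqP; rewrite eq_le h_le /=.
have hfin : genfun c (z + b * u) y \is a fin_num.
  rewrite ge0_fin_numE; first exact: le_lt_trans h_le (ltry _).
  exact/dsum_ge0/gterm_ge0.
rewrite -hu -(fineK hfin); apply: (@genfun_evol_le b (z + b * u)) => //.
  by rewrite fineK.
by rewrite lerD2l ler_wpM2l// -lee_fin fineK.
Qed.

End FixedPoint.

(** * Indefinite integrals *)

Section IncrementLemmas.
Variable R : realType.
Implicit Types (F La Om : R -> R) (a b s t : R).

Lemma continuous_subitv F a b s t : {within `[a, b], continuous F} ->
  a <= s -> t <= b -> {within `[s, t], continuous F}.
Proof.
move=> cF as_ tb; apply: continuous_subspaceW cF.
by apply: subset_itv; rewrite bnd_simp.
Qed.

(* The sum of the products (La t - La s) (Om t - Om s) over a fine subdivision is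
   small because Om is uniformly continuous; no regularity of F is used. *)
Lemma increment_le0 F La Om a b : a <= b ->
  (forall s t, a <= s -> s <= t -> t <= b -> La s <= La t) ->
  (forall s t, a <= s -> s <= t -> t <= b -> Om s <= Om t) ->
  {within `[a, b], continuous Om} ->
  (forall s t, a <= s -> s <= t -> t <= b ->
    F t - F s <= (La t - La s) * (Om t - Om s)) ->
  F b <= F a.
Proof.
move=> ab La_nd Om_nd Om_cont FLO.
have key n s t : a <= s -> s <= t -> t <= b ->
    F t - F s <= 2^-1 ^+ n * ((La t - La s) * (Om t - Om s)).
  elim: n s t => [|n IH] s t as_ st tb; first by rewrite expr0 mul1r FLO.
  have Ost := Om_nd _ _ as_ st tb.
  (* The cut is at the midpoint of the values of [Om], not of time, so that the bounds on the two
     pieces add up to half of the original one. *)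
  have [r rst Or] : exists2 r, r \in `[s, t] & Om r = (Om s + Om t) / 2.
    apply: IVT => //; first exact: continuous_subitv Om_cont as_ tb.
    by rewrite min_l// max_r//; apply/andP; split; lra.
  move: rst; rewrite in_itv/= => /andP[sr rt].
  have h1 := IH _ _ as_ sr (le_trans rt tb).
  have h2 := IH _ _ (le_trans as_ sr) rt tb.
  rewrite Or in h1 h2; rewrite exprS.
  set q := 2^-1 ^+ n in h1 h2 *.
  have -> : F t - F s = (F t - F r) + (F r - F s) by ring.
  apply: le_trans (lerD h2 h1) _; rewrite le_eqVlt; apply/orP; left; apply/eqP.
  by field.
rewrite leNgt -subr_gt0; apply/negP => Fab.
set B := (La b - La a) * (Om b - Om a).
have [n hn] : exists n, 2^-1 ^+ n * B < F b - F a.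
  have B1 : 0 < `|B| + 1 by rewrite ltr_wpDl.
  have : (fun n => (2^-1 : R) ^+ n) @ \oo --> (0 : R).
    by apply: cvg_expr; rewrite gtr0_norm ?invr_gt0// invf_lt1// ltr1n.
  move=> /cvgrPdist_lt /(_ ((F b - F a) / (`|B| + 1))).
  rewrite divr_gt0// => /(_ isT)[n _ /(_ n (leqnn _))/=].
  rewrite sub0r normrN ger0_norm ?exprn_ge0 ?invr_ge0// ltr_pdivlMr// => hn.
  exists n; apply: le_lt_trans hn; rewrite ler_wpM2l ?exprn_ge0 ?invr_ge0//.
  by rewrite (le_trans (ler_norm _))// lerDl.
by have := key n a b (lexx _) ab (lexx _); rewrite leNgt hn.
Qed.

Lemma increment_eq F La Om a b : a <= b ->
  (forall s t, a <= s -> s <= t -> t <= b -> La s <= La t) ->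
  (forall s t, a <= s -> s <= t -> t <= b -> Om s <= Om t) ->
  {within `[a, b], continuous Om} ->
  (forall s t, a <= s -> s <= t -> t <= b ->
    `|F t - F s| <= (La t - La s) * (Om t - Om s)) ->
  F b = F a.
Proof.
move=> ab La_nd Om_nd Om_cont FLO; apply/eqP; rewrite eq_le; apply/andP; split.
  apply: (@increment_le0 F La Om) => // s t as_ st tb.
  exact: le_trans (ler_norm _) (FLO _ _ as_ st tb).
rewrite -lerN2; apply: (@increment_le0 (\- F) La Om) => // s t as_ st tb /=.
by rewrite -opprD; apply: le_trans (FLO _ _ as_ st tb); rewrite -normrN ler_norm.
Qed.

(** If F b > 0, take the last point where F <= 0, which continuity provides. F is positive after it
    up to b, so the hypothesis bounds F b by the value of F there. *)
Lemma barrier F b : 0 <= b -> {within `[0, b], continuous F} -> F 0 <= 0 ->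
  (forall s t, 0 <= s -> s <= t -> t <= b ->
    (forall r, s < r -> r <= t -> 0 < F r) -> F t <= F s) ->
  F b <= 0.
Proof.
move=> b0 cF F0 hF; rewrite leNgt; apply/negP => Fb.
pose Z := [set s | 0 <= s <= b /\ F s <= 0].
have Z0 : Z 0 by split; rewrite ?lexx.
have Zub : ubound Z b by move=> s [/andP[]].
have supZ : has_sup Z by split; [exists 0|exists b].
have Zs : 0 <= sup Z by apply: ub_le_sup => //; exists b.
have Zb : sup Z <= b by apply: sup_le_ub => //; exists 0.
have [Fs|Fs] := leP (F (sup Z)) 0.
  suff : F b <= F (sup Z) by rewrite leNgt (le_lt_trans Fs).
  apply: hF => // r Zr rb; rewrite ltNge; apply/negP => Fr.
  have : r <= sup Z by apply: ub_le_sup; [exists b|split => //; rewrite rb (le_trans Zs)//= ltW].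
  by rewrite leNgt Zr.
have := (@subspace_continuousP _ `[0, b] _ F).1 cF (sup Z).
rewrite /= in_itv/= Zs Zb => /(_ isT) /(_ [set v | 0 < v]) /=.
move=> /(_ (lt_nbhsr Fs)); rewrite /within/= => /nbhs_ballP[e /= e0 he].
have [s [/andP[s0 sb] Fs0] es] := sup_adherent e0 supZ.
have sZ : s <= sup Z by apply: ub_le_sup; [exists b|split => //; rewrite s0].
have /= := he s; rewrite in_itv/= s0 sb => /(_ _ isT).
rewrite ltNge Fs0 => /(_ _)/notF; apply.
by rewrite /ball/= ger0_norm ?subr_ge0// ltrBlDr -ltrBlDl.
Qed.

End IncrementLemmas.

Section Primitives.
Variable R : realType.
Local Notation mu := (@lebesgue_measure R).
Implicit Types (f g phi psi : R -> R) (s t T : R).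

(* Indefinite integrals on [0, +oo[; the value of the integrand at 0 is
   irrelevant. *)
Definition primitive f phi := forall t, 0 <= t ->
  mu.-integrable `]0, t] (EFin \o phi) /\
  f t = f 0 + \int[mu]_(r in `]0, t]) phi r.

Lemma primitive_integrable f phi s t : primitive f phi -> 0 <= s -> s <= t ->
  mu.-integrable `]s, t] (EFin \o phi).
Proof.
move=> fphi s0 st; have [h _] := fphi t (le_trans s0 st).
by apply: integrableS h => //; apply: subset_itv; rewrite bnd_simp.
Qed.

Lemma primitiveB f phi s t : primitive f phi -> 0 <= s -> s <= t ->
  f t - f s = \int[mu]_(r in `]s, t]) phi r.
Proof.
move=> fphi s0 st.
have [h ->] := fphi t (le_trans s0 st); have [_ ->] := fphi s s0.
rewrite opprD addrACA subrr add0r (@Rintegral_itvB _ phi (BRight 0) (BRight t) s)//.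
Qed.

Lemma integrable_norm_itv phi s t : mu.-integrable `]s, t] (EFin \o phi) ->
  mu.-integrable `]s, t] (EFin \o (fun r => `|phi r|)).
Proof.
by move=> h; apply: eq_integrable (integrable_abse h).
Qed.

Definition variation phi t := \int[mu]_(r in `]0, t]) `|phi r|.

Lemma primitive_variation f phi : primitive f phi ->
  primitive (variation phi) (fun r => `|phi r|).
Proof.
move=> fphi t t0; split; first by apply: integrable_norm_itv; exact: (primitive_integrable fphi).
by rewrite /variation [X in X + _](_ : _ = 0) ?add0r// set_itvoc0 Rintegral_set0.
Qed.

Lemma variation_nd f phi s t : primitive f phi -> 0 <= s -> s <= t ->
  variation phi s <= variation phi t.
Proof.
move=> /primitive_variation h s0 st; rewrite -subr_ge0 (primitiveB h)//.
exact: Rintegral_ge0.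
Qed.

Lemma variation_ge0 phi t : 0 <= variation phi t.
Proof. exact: Rintegral_ge0. Qed.

Lemma primitive_le f phi s t : primitive f phi -> 0 <= s -> s <= t ->
  `|f t - f s| <= variation phi t - variation phi s.
Proof.
move=> fphi s0 st; rewrite (primitiveB fphi)// (primitiveB (primitive_variation fphi))//.
by apply: le_normr_Rintegral => //; exact: (primitive_integrable fphi).
Qed.

Lemma primitive_continuous f phi T : 0 <= T -> primitive f phi ->
  {within `[0, T], continuous f}.
Proof.
move=> T0 fphi.
pose phi0 := phi \_ `]0, T].
have iphi0 : mu.-integrable `[0, T] (EFin \o phi0).
  rewrite -restrict_EFin; apply/integrable_restrict => //=.
  rewrite setIidr; first exact: (primitive_integrable fphi).
  by apply: subset_itv; rewrite bnd_simp.
have c := parameterized_integral_continuous T0 iphi0.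
refine (@subspace_eq_continuous _ `[0, T] _ (fun x => f 0 + \int[mu]_(r in `[0, x]) phi0 r) f _ _).
  move=> x; rewrite inE/= in_itv/= => /andP[x0 xT]; have [h ->] := fphi x x0.
  congr (_ + _); rewrite -Rintegral_itv_obnd_cbnd; last first.
    by apply: integrableS iphi0 => //; apply: subset_itv; rewrite bnd_simp.
  apply: eq_Rintegral => r; rewrite inE/= in_itv/= => /andP[r0 rx].
  by rewrite /phi0 patchE ifT// inE/= in_itv/= r0 (le_trans rx).
move=> x; apply: cvgD; first exact: cvg_cst.
exact: c.
Qed.

Lemma primitive_bounded f phi T : 0 <= T -> primitive f phi ->
  forall t, 0 <= t -> t <= T -> `|f t| <= `|f 0| + variation phi T.
Proof.
move=> T0 fphi t t0 tT; rewrite (_ : f t = f 0 + (f t - f 0)); last by ring.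
apply: le_trans (ler_normD _ _) _; rewrite lerD2l.
apply: le_trans (primitive_le fphi (lexx 0) t0) _.
by rewrite lerBlDr ler_wpDr ?variation_ge0// (variation_nd fphi).
Qed.

Lemma primitive_ext f g phi psi : (forall t, 0 <= t -> f t = g t) ->
  (forall t, 0 < t -> phi t = psi t) -> primitive f phi -> primitive g psi.
Proof.
move=> fg pp h t t0; have [ih ft] := h t t0; split.
  apply: eq_integrable ih => // r; rewrite inE/= in_itv/= => /andP[r0 _].
  by rewrite /= pp.
rewrite -!fg// ft; congr (_ + _); apply: eq_Rintegral => r.
by rewrite inE/= in_itv/= => /andP[r0 _]; rewrite pp.
Qed.

Lemma primitive_cst (x : R) : primitive (fun=> x) (fun=> 0).
Proof.
move=> t t0; split; last by rewrite Rintegral_cst// mul0r addr0.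
exact: integrable0.
Qed.

Lemma fine_lebesgue_itv s t : s <= t -> fine (mu `]s, t]%classic) = t - s.
Proof.
move=> st; rewrite (lebesgue_measure_itv `]s, t]) /= lte_fin.
by case: ltP => //= ts; apply/eqP; rewrite eq_sym subr_eq0 eq_le ts st.
Qed.

Lemma integrable_cst_itv s t (x : R) : mu.-integrable `]s, t] (EFin \o (fun=> x)).
Proof.
apply: measurable_bounded_integrable => //.
  by rewrite /= lebesgue_measure_itv/=; case: ifP => _; rewrite ?ltry// -EFinB ltry.
exists `|x|; split; first exact: num_real.
by move=> y xy r _ /=; rewrite ltW.
Qed.

Lemma primitiveD f g phi psi : primitive f phi -> primitive g psi ->
  primitive (fun t => f t + g t) (fun t => phi t + psi t).
Proof.
move=> hf hg t t0; have [i1 e1] := hf t t0; have [i2 e2] := hg t t0; split.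
  exact: eq_integrable (integrableD _ i1 i2).
by rewrite RintegralD// e1 e2; ring.
Qed.

Lemma primitiveZ f phi (x : R) : primitive f phi ->
  primitive (fun t => x * f t) (fun t => x * phi t).
Proof.
move=> hf t t0; have [i1 e1] := hf t t0; split.
  exact: eq_integrable (integrableZl _ _ i1).
by rewrite RintegralZl// e1; ring.
Qed.

Lemma continuous_integrableM (h psi : R -> R) t : 0 <= t ->
  {within `[0, t], continuous h} ->
  mu.-integrable `]0, t] (EFin \o psi) ->
  mu.-integrable `]0, t] (EFin \o (fun r => h r * psi r)).
Proof.
move=> t0 ch ipsi; apply: eq_integrable (integrableMr _ _ _ ipsi) => //.
  apply: (@measurable_funS _ _ _ _ `[0, t]) => //.
    by apply: subset_itv; rewrite bnd_simp.
  exact: measurable_realfun.subspace_continuous_measurable_fun.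
have [M [Mr hM]] := compact_bounded (continuous_compact ch (@segment_compact R 0 t)).
exists M; split => // x Mx r/=; rewrite in_itv/= => /andP[r0 rt].
by apply: hM => //=; exists r => //=; rewrite in_itv/= ltW.
Qed.

Lemma primitive_integrableM f phi psi t : primitive f phi -> 0 <= t ->
  mu.-integrable `]0, t] (EFin \o psi) ->
  mu.-integrable `]0, t] (EFin \o (fun r => f r * psi r)).
Proof.
by move=> hf t0; apply: continuous_integrableM => //; exact: primitive_continuous hf.
Qed.

(* For t near s, F (f t) - F (f s) and the integral of (F' o f) phi over ]s, t]
   both differ from F' (f s) (f t - f s) by a quadratic term in the variation. *)
Lemma primitive_comp f phi (F F' : R -> R) : primitive f phi ->
  continuous F' ->
  (forall B, exists C, 0 <= C /\ forall x y, `|x| <= B -> `|y| <= B ->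
     `|F y - F x - F' x * (y - x)| <= C * (y - x) ^+ 2 /\
     `|F' y - F' x| <= C * `|y - x|) ->
  primitive (fun t => F (f t)) (fun t => F' (f t) * phi t).
Proof.
move=> hf hF' hC T T0.
have hint t : 0 <= t -> mu.-integrable `]0, t] (EFin \o (fun r => F' (f r) * phi r)).
  move=> t0; apply: continuous_integrableM => //; last exact: (primitive_integrable hf).
  move=> x; apply: continuous_comp; last exact: hF'.
  exact: (primitive_continuous t0 hf).
split; first exact: hint.
pose I t := \int[mu]_(r in `]0, t]) (F' (f r) * phi r).
have hI : primitive I (fun r => F' (f r) * phi r).
  move=> t t0; split; first exact: hint.
  by rewrite /I [X in X + _](_ : _ = 0) ?add0r// set_itvoc0 Rintegral_set0.
have I0 : I 0 = 0 by rewrite /I set_itvoc0 Rintegral_set0.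
have [C [C0 {}hC]] := hC (`|f 0| + variation phi T).
pose V := variation phi.
suff : F (f T) - I T = F (f 0) - I 0.
  by rewrite I0 subr0 => /eqP; rewrite subr_eq => /eqP.
apply: (@increment_eq _ (fun t => F (f t) - I t) (fun t => (C + C) * V t) V 0 T) => //.
- move=> s t s0 st _; rewrite ler_wpM2l ?addr_ge0//; exact: (variation_nd hf).
- by move=> s t s0 st _; exact: (variation_nd hf).
- exact: primitive_continuous (primitive_variation hf).
move=> s t s0 st tT.
have bnd r : s <= r -> r <= t -> `|f r| <= `|f 0| + V T.
  move=> sr rt; apply: (primitive_bounded T0 hf); first exact: le_trans sr.
  exact: le_trans tT.
have Vst : 0 <= V t - V s by rewrite subr_ge0 (variation_nd hf).
have -> : F (f t) - I t - (F (f s) - I s) =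
    (F (f t) - F (f s) - F' (f s) * (f t - f s)) -
    ((I t - I s) - F' (f s) * (f t - f s)) by ring.
apply: le_trans (ler_normB _ _) _; rewrite -mulrBr mulrDl mulrDl; apply: lerD.
  have [h _] := hC (f s) (f t) (bnd _ (lexx _) st) (bnd _ st (lexx _)).
  apply: le_trans h _; rewrite -mulrA ler_wpM2l// -expr2 -real_normK ?num_real//.
  by rewrite ler_sqr ?nnegrE//; exact: (primitive_le hf).
have is_ := primitive_integrable hf s0 st.
rewrite (primitiveB hI)// (primitiveB hf)// -RintegralZl// -RintegralB//; first last.
- exact: eq_integrable (integrableZl _ _ is_).
- exact: (primitive_integrable hI).
apply: (@le_trans _ _ (\int[mu]_(r in `]s, t]) (C * (V t - V s) * `|phi r|))); last first.
  rewrite RintegralZl//; last exact: integrable_norm_itv.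
  by rewrite -(primitiveB (primitive_variation hf))// -mulrA.
have i3 : mu.-integrable `]s, t] (EFin \o (fun r => F' (f r) * phi r - F' (f s) * phi r)).
  exact: eq_integrable (integrableB _ (primitive_integrable hI s0 st)
    (integrableZl _ (F' (f s)) is_)).
apply: le_trans (le_normr_Rintegral _ i3) _ => //.
apply: le_Rintegral => //.
- exact: integrable_norm_itv.
- exact: eq_integrable (integrableZl _ (C * (V t - V s)) (integrable_norm_itv is_)).
move=> r/=; rewrite in_itv/= => /andP[sr rt].
rewrite -mulrBl normrM ler_wpM2r//.
have [_ h] := hC (f s) (f r) (bnd _ (lexx _) st) (bnd _ (ltW sr) rt).
apply: le_trans h _; rewrite ler_wpM2l//.
apply: le_trans (primitive_le hf s0 (ltW sr)) _.
by rewrite lerD2r; apply: (variation_nd hf) => //; rewrite (le_trans s0)// ltW.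
Qed.

Lemma primitive_sqr f phi : primitive f phi ->
  primitive (fun t => f t ^+ 2) (fun t => 2 * f t * phi t).
Proof.
move=> hf; apply: (@primitive_comp f phi (fun x => x ^+ 2) (fun x => 2 * x)) => //.
  by move=> x; apply: cvgM; [exact: cvg_cst|exact: cvg_id].
move=> B; exists 2; split => // x y _ _; split.
  rewrite (_ : _ - _ = (y - x) ^+ 2); last by ring.
  rewrite ger0_norm ?sqr_ge0//; have := sqr_ge0 (y - x); lra.
by rewrite -mulrBr normrM ger0_norm.
Qed.

(** Polarization: f g = ((f + g)^2 - f^2 - g^2) / 2, so the chain rule for the square is enough. *)
Lemma primitiveM f g phi psi : primitive f phi -> primitive g psi ->
  primitive (fun t => f t * g t) (fun t => phi t * g t + f t * psi t).
Proof.
move=> hf hg.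
have h1 := primitive_sqr (primitiveD hf hg).
have h2 := primitive_sqr hf; have h3 := primitive_sqr hg.
have h := primitiveD (primitiveZ (2^-1) h1)
  (primitiveD (primitiveZ (- 2^-1) h2) (primitiveZ (- 2^-1) h3)).
by apply: primitive_ext h => t _; by field.
Qed.

Lemma primitiveX f phi n : primitive f phi ->
  primitive (fun t => f t ^+ n) (fun t => n%:R * f t ^+ n.-1 * phi t).
Proof.
move=> hf; elim: n => [|n IH].
  by apply: primitive_ext (primitive_cst 1) => t _; rewrite ?expr0 ?mul0r.
apply: primitive_ext (primitiveM hf IH) => t _ /=; first by rewrite exprS.
case: n {IH} => [|n] /=; first by rewrite expr0; ring.
by rewrite -natr1 [f t ^+ n.+1]exprS; ring.
Qed.

Lemma primitive_horner f phi (p : {poly R}) : primitive f phi ->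
  primitive (fun t => p.[f t]) (fun t => p^`().[f t] * phi t).
Proof.
move=> hf; elim/poly_ind: p => [|p c IH].
  by apply: primitive_ext (primitive_cst 0) => t _; rewrite ?deriv0 ?horner0 ?mul0r.
apply: primitive_ext (primitiveD (primitiveM IH hf) (primitive_cst c)) => t _ /=.
  by rewrite !hornerE.
by rewrite derivD derivM derivX derivC !hornerE; ring.
Qed.

(** Both estimates come from the tangent inequality expR u (1 + (v - u)) <= expR v, used at both
    points. *)
Lemma expR_taylor (x y : R) B : `|x| <= B -> `|y| <= B ->
  `|expR y - expR x - expR x * (y - x)| <= expR B * (y - x) ^+ 2 /\
  `|expR y - expR x| <= expR B * `|y - x|.
Proof.
move=> xB yB.
have hx : expR x <= expR B by rewrite ler_expR (le_trans (ler_norm _)).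
have hy : expR y <= expR B by rewrite ler_expR (le_trans (ler_norm _)).
have e0 := @expR_gt0 R.
have h1 (u v : R) : expR u * (1 + (v - u)) <= expR v.
  rewrite (_ : expR v = expR u * expR (v - u)); last by rewrite -expRD; congr expR; ring.
  by rewrite ler_wpM2l ?expR_ge1Dx// ltW.
have a1 := h1 x y; have a2 := h1 y x.
have ex := e0 x; have ey := e0 y.
have lip : `|expR y - expR x| <= expR B * `|y - x|.
  have [xy|yx] := leP x y.
    rewrite ger0_norm ?subr_ge0 ?ler_expR// (@ger0_norm _ (y - x)) ?subr_ge0//.
    apply: (@le_trans _ _ (expR y * (y - x))); first by nra.
    by rewrite ler_wpM2r ?subr_ge0.
  rewrite ltr0_norm ?subr_lt0 ?ltr_expR// (@ltr0_norm _ (y - x)) ?subr_lt0//.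
  apply: (@le_trans _ _ (expR x * (x - y))); first by nra.
  by rewrite opprB ler_wpM2r ?subr_ge0// ltW.
split => //.
rewrite ger0_norm; last by nra.
apply: (@le_trans _ _ ((expR y - expR x) * (y - x))); first by nra.
apply: (@le_trans _ _ (`|expR y - expR x| * `|y - x|)).
  by rewrite -normrM ler_norm.
rewrite -[in leRHS]real_normK ?num_real// expr2 mulrA ler_wpM2r//.
Qed.

Lemma primitive_expR f phi : primitive f phi ->
  primitive (fun t => expR (f t)) (fun t => expR (f t) * phi t).
Proof.
move=> hf; apply: primitive_comp => //; first exact: continuous_expR.
move=> B; exists (expR B); split; first exact: expR_ge0.
by move=> x y; exact: expR_taylor.
Qed.

End Primitives.

(** * Primitives with a monotone density *)

Section MonotonePrimitives.
Variable R : realType.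
Local Notation mu := (@lebesgue_measure R).
Implicit Types (f phi : R -> R) (s t : R).

(** Composing with the exponential gives a function monotone on the whole line, whatever happens at
    0. *)
Lemma nonincreasing_pos_measurable phi :
  (forall s t, 0 < s -> s <= t -> phi t <= phi s) -> measurable_fun (`]0, +oo[ : set R) phi.
Proof.
move=> phi_ni.
have m1 : measurable_fun setT (fun x => phi (expR x)).
  apply: nonincreasing_measurable => // x y xy.
  by apply: phi_ni; rewrite ?expR_gt0 ?ler_expR.
apply: (eq_measurable_fun ((fun x => phi (expR x)) \o (@ln R))).
  by move=> x; rewrite inE/= in_itv/= andbT => x0; rewrite /= lnK.
apply: (measurable_comp (F := setT)) => //.
exact: measurable_funTS.
Qed.

(** The density may blow up at 0, as the number of arms does when A_0 = +oo. On ]s, t] with s > 0 it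
    is bounded and increments can be compared; then s tends to 0 by monotone convergence, with a
    finite limit because f converges at 0. *)
Lemma primitive_sandwich f phi :
  (forall t, 0 < t -> 0 <= phi t) ->
  (forall s t, 0 < s -> s <= t -> phi t <= phi s) ->
  (forall s t, 0 < s -> s <= t -> phi t * (t - s) <= f t - f s <= phi s * (t - s)) ->
  f s @[s --> 0^'+] --> f 0 ->
  primitive f phi.
Proof.
move=> phi_ge0 phi_ni fphi f0.
have mphi t : measurable_fun `]0, t] phi.
  apply: measurable_funS (nonincreasing_pos_measurable phi_ni) => //.
  by apply: subset_itvl.
have iphi s t : 0 < s -> mu.-integrable `]s, t] (EFin \o phi).
  move=> s0; apply: measurable_bounded_integrable => //.
  - by rewrite /= lebesgue_measure_itv/=; case: ifP => _; rewrite ?ltry// -EFinB ltry.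
  - by apply: measurable_funS (mphi t) => //; apply: subset_itvr; rewrite bnd_simp ltW.
  exists (phi s); split; first exact: num_real.
  move=> x xs r /=; rewrite in_itv/= => /andP[sr rt].
  rewrite ger0_norm ?phi_ge0 ?(lt_trans s0)//.
  by rewrite (le_trans _ (ltW xs))// phi_ni// ltW.
have incr s t : 0 < s -> s <= t -> f t - f s = \int[mu]_(r in `]s, t]) phi r.
  move=> s0 st.
  pose J r := f r - \int[mu]_(x in `]s, r]) phi x.
  suff : J t = J s.
    rewrite /J set_itvoc0 Rintegral_set0 subr0 => /eqP.
    by rewrite subr_eq => /eqP ->; ring.
  (* The increments of f and of the integral obey the same two bounds, so J varies by at most (phi u
     - phi v) (v - u) on [u, v]. *)
  apply: (@increment_eq _ J (\- phi) id s t) => //.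
  - by move=> u v su uv _ /=; rewrite lerN2 phi_ni// (lt_le_trans s0).
  - by apply: continuous_subspaceT => x; exact: cvg_id.
  move=> u v su uv vt.
  have u0 := lt_le_trans s0 su.
  have -> : J v - J u = f v - f u - \int[mu]_(x in `]u, v]) phi x.
    rewrite /J -(@Rintegral_itvB _ phi (BRight s) (BRight v) u)//; first ring.
    exact: iphi.
  have ile : \int[mu]_(x in `]u, v]) phi x <= phi u * (v - u).
    rewrite -(fine_lebesgue_itv uv) -Rintegral_cst//.
    apply: le_Rintegral => //; [exact: iphi|exact: integrable_cst_itv|].
    by move=> x /=; rewrite in_itv/= => /andP[ux xv]; rewrite phi_ni// ltW.
  have ige : phi v * (v - u) <= \int[mu]_(x in `]u, v]) phi x.
    rewrite -(fine_lebesgue_itv uv) -Rintegral_cst//.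
    apply: le_Rintegral => //; [exact: integrable_cst_itv|exact: iphi|].
    by move=> x /=; rewrite in_itv/= => /andP[ux xv]; rewrite phi_ni// (lt_trans u0).
  have /andP[h1 h2] := fphi u v u0 uv.
  have -> : ((\- phi) v - (\- phi) u) * (id v - id u) =
    phi u * (v - u) - phi v * (v - u) by rewrite /=; ring.
  move: ile ige; move: (\int[mu]_(x in `]u, v]) phi x) => I ile ige.
  by rewrite ler_norml; apply/andP; split; lra.
move=> t; rewrite le_eqVlt => /predU1P[<-|t0].
  rewrite set_itvoc0 Rintegral_set0 addr0; split => //.
  exact: integrable_set0.
pose S (n : nat) : set R := `]t / n.+1%:R, t]%classic.
have S_nd : nondecreasing_seq S.
  move=> n m nm; apply/subsetPset; apply: subset_itvr; rewrite bnd_simp.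
  by rewrite ler_pM2l// lef_pV2 ?posrE// ler_nat ltnS.
have Sn0 n : 0 < t / n.+1%:R by rewrite divr_gt0.
have Snt n : t / n.+1%:R <= t by rewrite ler_pdivrMr// ler_peMr ?ler1n// ltW.
have SU : \bigcup_n S n = `]0, t]%classic.
  apply/seteqP; split => [r [n _]|r]; rewrite /S/= !in_itv/= => /andP[r0 rt].
    by rewrite rt (lt_trans (Sn0 n)).
  exists (Num.bound (t / r)) => //; rewrite /S /= in_itv/= rt andbT.
  rewrite ltr_pdivrMr// mulrC -ltr_pdivrMr//.
  by rewrite (lt_trans (archi_boundP (ltW (divr_gt0 t0 r0))))// ltr_nat.
have : (\int[mu]_(x in S n) (phi x)%:E @[n --> \oo] --> \int[mu]_(x in `]0%R, t]) (phi x)%:E)%E.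
  rewrite -SU.
  refine (@ge0_nondecreasing_set_cvg_integral _ (measurableTypeR R) R S (EFin \o phi) lebesgue_measure S_nd _ _ _).
  - by move=> n; apply: measurable_itv.
  - move=> n; apply/measurable_EFinP; apply: measurable_funS (mphi t) => //.
    by rewrite /S; apply: subset_itvr; rewrite bnd_simp ltW.
  - move=> n r; rewrite /S /= in_itv/= => /andP[nr _].
    by rewrite lee_fin phi_ge0// (lt_trans (Sn0 n)).
have -> : (fun n => (\int[mu]_(x in S n) (phi x)%:E)%E) = (fun n => (f t - f (t / n.+1%:R))%:E).
  apply/funext => n; rewrite incr// fineK//.
  exact: integrable_fin_num (iphi _ _ (Sn0 n)).
have cvf : (f t - f (t / n.+1%:R))%:E @[n --> \oo] --> (f t - f 0)%:E.
  apply: cvg_EFin; first exact: nearW.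
  apply: cvgB; first exact: cvg_cst.
  have tn : t / n.+1%:R @[n --> \oo] --> (0 : R).
    rewrite -[X in _ --> X](mulr0 t); apply: cvgM; first exact: cvg_cst.
    exact: cvg_harmonic.
  move: f0 => /cvg_at_rightP; apply; split => // n; exact: Sn0.
move=> /cvg_unique => /(_ (@ereal_hausdorff _) _ cvf) => int_eq.
split.
  apply/integrableP; split; first by apply/measurable_EFinP; exact: mphi.
  have -> : (\int[mu]_(x in `]0%R, t]) `|(EFin \o phi) x| = \int[mu]_(x in `]0%R, t]) (phi x)%:E)%E.
    apply: eq_integral => r; rewrite inE/= in_itv/= => /andP[r0 _].
    by rewrite ger0_norm ?phi_ge0.
  by rewrite int_eq ltry.
by rewrite /Rintegral int_eq/=; ring.
Qed.

End MonotonePrimitives.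

(** * Elementary bounds on generating functions *)

Section GeneratingFunction.
Variable R : realType.
Implicit Types (f c : nat -> nat -> R) (x y z b : R).

Lemma genfunE f x y : genfun f x y = dsum 1 (gterm y f x).
Proof. by []. Qed.

Lemma genfun_ge0 f x y : (forall a m, 0 <= f a m) -> 0 <= y -> 0 <= x ->
  (0 <= genfun f x y)%E.
Proof. by move=> f0 y0 x0; apply: dsum_ge0; apply: gterm_ge0. Qed.

Lemma genfun_nd f x z y : (forall a m, 0 <= f a m) -> 0 <= y -> 0 <= x -> x <= z ->
  (genfun f x y <= genfun f z y)%E.
Proof.
move=> f0 y0 x0 xz; apply: lee_dsum; [exact: gterm_ge0| |apply: gterm_ge0 => //; exact: le_trans xz].
move=> a m _ _; rewrite /gterm ler_wpM2r ?exprn_ge0// ler_wpM2l ?mulr_ge0//.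
by rewrite lerXn2r// nnegrE// (le_trans x0).
Qed.

Lemma genfun_ndy f x y z : (forall a m, 0 <= f a m) -> 0 <= y -> y <= z -> 0 <= x ->
  (genfun f x y <= genfun f x z)%E.
Proof.
move=> f0 y0 yz x0; apply: lee_dsum; [exact: gterm_ge0| |apply: gterm_ge0 => //; exact: le_trans yz].
move=> a m _ _; rewrite /gterm ler_wpM2l ?mulr_ge0 ?exprn_ge0//.
by rewrite lerXn2r// nnegrE// (le_trans y0).
Qed.

Lemma horner_left (P : {poly R}) x B : 0 < x ->
  (forall z, 0 <= z -> z < x -> P.[z] <= B) -> P.[x] <= B.
Proof.
move=> x0 hB; rewrite leNgt; apply/negP => Bx.
have cP : P.[z] @[z --> x^'-] --> P.[x].
  by apply: cvg_at_left_filter; exact: continuous_horner.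
have [z [[z0 zx] Bz]] : exists z, (0 <= z /\ z < x) /\ B < P.[z].
  apply: (@filter_ex _ (x^'-)); near=> z; split; [split|].
  - by near: z; exact: nbhs_left_ge.
  - by near: z; exact: nbhs_left_lt.
  - by near: z; exact: (cP [set v | B < v] (lt_nbhsr Bx)).
by have := hB z z0 zx; rewrite leNgt Bz.
Unshelve. all: by end_near. Qed.

(** Abel's theorem for non-negative terms: the partial sums are polynomials, hence left continuous,
    and the full sum bounds them. *)
Lemma dsum_left N (w : nat -> nat -> R) (d : nat -> nat) x (B : \bar R) :
  (forall a m, 0 <= w a m) -> 0 < x ->
  (forall z, 0 <= z -> z < x -> (dsum N (fun a m => (w a m * z ^+ d a)%R) <= B)%E) ->
  (dsum N (fun a m => (w a m * x ^+ d a)%R) <= B)%E.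
Proof.
move=> w0 x0 hB.
have t0 z : 0 <= z -> forall a m, 0 <= w a m * z ^+ d a.
  by move=> z0 a m; rewrite mulr_ge0 ?exprn_ge0.
apply: dsum_le => [|L]; first by apply: t0; exact: ltW.
case: B hB => [B||] hB; rewrite ?leey//; last first.
  have := hB 0 (lexx _) x0; rewrite leeNy_eq => /eqP h.
  by have := dsum_ge0 N (t0 0 (lexx _)); rewrite h.
pose P := \sum_(N <= a < L) \sum_(1 <= m < L) (w a m)%:P * 'X^(d a).
have hP z : P.[z] = psum N L (fun a m => w a m * z ^+ d a).
  rewrite horner_sum; apply: eq_bigr => a _; rewrite horner_sum; apply: eq_bigr => m _.
  by rewrite !hornerE.
rewrite lee_fin -hP; apply: horner_left => // z z0 zx.
rewrite hP -lee_fin; apply: le_trans (hB z z0 zx).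
exact/psum_le_dsum/t0.
Qed.

Lemma genfun_left f x y (B : \bar R) : (forall a m, 0 <= f a m) -> 0 <= y -> 0 < x ->
  (forall z, 0 <= z -> z < x -> (genfun f z y <= B)%E) -> (genfun f x y <= B)%E.
Proof.
move=> f0 y0 x0 hB.
have e z : genfun f z y = dsum 1 (fun a m => (a%:R * f a m * y ^+ m) * z ^+ a.-1).
  by apply: eq_dsum => a m _ _; rewrite /gterm mulrAC.
rewrite e; apply: (@dsum_left 1 (fun a m => a%:R * f a m * y ^+ m) predn) => //.
  by move=> a m; rewrite !mulr_ge0 ?exprn_ge0.
by move=> z z0 zx; rewrite -e; exact: hB.
Qed.

Lemma armsE f : (forall a m, 0 <= f a m) -> arms f = genfun f 1 1.
Proof.
move=> f0; rewrite /arms /pairing -/(dsum 0 (fun a m => a%:R * f a m)) dsum_widen1.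
- by apply: eq_dsum => a m _ _; rewrite /gterm !expr1n !mulr1.
- by move=> a m; rewrite mulr_ge0.
- by move=> m; rewrite mul0r.
Qed.

(** For x < 1, each of the a terms of the geometric sum (1 - x ^ a) / (1 - x) is at least x ^ (a -
    1). It yields k(x, 1) <= <c, 1> / (1 - x). *)
Lemma natr_expr_le a x : 0 <= x -> x <= 1 ->
  (1 - x) * (a%:R * x ^+ a.-1) <= 1 - x ^+ a.
Proof.
move=> x0 x1; elim: a => [|a IH]; first by rewrite expr0 mul0r mulr0 subrr.
rewrite /= (_ : (1 - x) * (a.+1%:R * x ^+ a) =
  (1 - x) * (a%:R * x ^+ a) + (1 - x) * x ^+ a); last by rewrite -natr1; ring.
have xa1 : x ^+ a <= 1 by rewrite exprn_ile1.
have xa0 : 0 <= x ^+ a by rewrite exprn_ge0.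
have -> : (1 - x) * (a%:R * x ^+ a) = x * ((1 - x) * (a%:R * x ^+ a.-1)).
  by case: a {IH xa1 xa0} => [|a]/=; rewrite ?mul0r ?mulr0// exprS; ring.
have := ler_wpM2l x0 IH; rewrite exprS.
have : 0 <= (1 - x) * (1 - x ^+ a) by rewrite mulr_ge0 ?subr_ge0.
lra.
Qed.

Variable c : nat -> nat -> R.
Hypothesis c_ge0 : forall a m, 0 <= c a m.
Hypothesis mass : (total_mass c < +oo)%E.

Lemma genfun_lty x : 0 <= x -> x < 1 -> (genfun c x 1 < +oo)%E.
Proof.
move=> x0 x1; have x1' : 0 < 1 - x by rewrite subr_gt0.
apply: (@le_lt_trans _ _ ((1 - x)^-1%:E * total_mass c)%E); last first.
  rewrite lte_mul_pinfty// ?lee_fin ?invr_ge0 ?ltW//.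
rewrite /total_mass /pairing -/(dsum 0 (fun a m => 1 * c a m)).
rewrite -dsumZ; last by move=> a m; rewrite mul1r.
have h0 : forall a m, 0 <= (1 - x)^-1 * (1 * c a m).
  by move=> a m; rewrite mul1r mulr_ge0// invr_ge0 ltW.
apply: (@le_trans _ _ (dsum 1 (fun a m => (1 - x)^-1 * (1 * c a m)))).
  apply: lee_dsum => //; first exact: gterm_ge0.
  move=> a m _ _; rewrite /gterm expr1n mulr1 mul1r mulrAC ler_wpM2r//.
  rewrite -(ler_pM2l x1') mulfV ?gt_eqF//.
  apply: le_trans (natr_expr_le a x0 (ltW x1)) _.
  by rewrite gerBl exprn_ge0.
rewrite /dsum [leRHS]nneseries_recl// ?leeDr//.
- by apply: nneseries_ge0 => m _ _; rewrite lee_fin.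
- by move=> a _; apply: nneseries_ge0 => m _ _; rewrite lee_fin.
Qed.

Lemma genfun1E x : 0 <= x -> x < 1 -> genfun c x 1 = (genfun1 c x)%:E.
Proof.
move=> x0 x1; rewrite /genfun1 fineK// ge0_fin_numE ?genfun_lty//.
exact: genfun_ge0.
Qed.

Lemma genfun1_ge0 x : 0 <= x -> 0 <= genfun1 c x.
Proof. by move=> x0; apply: fine_ge0; apply: genfun_ge0. Qed.

Hypothesis arms_gt0 : (0 < arms c)%E.

Lemma genfun_gt0 x : 0 < x -> (0 < genfun c x 1)%E.
Proof.
move=> x0; have [|a [m [_ m0 ac]]] := @dsum_gt0 _ 0 (fun a m => a%:R * c a m) _ arms_gt0.
  by move=> a m; rewrite mulr_ge0.
have a0 : (0 < a)%N.
  by rewrite lt0n; apply/eqP => a0; move: ac; rewrite a0 mul0r ltxx.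
apply: (@lt_le_trans _ _ (gterm 1 c x a m)%:E); last first.
  by apply: (dsum_ge1 (N := 1)) => //; apply: gterm_ge0 => //; exact: ltW.
by rewrite lte_fin /gterm expr1n mulr1 mulr_gt0// exprn_gt0.
Qed.

Lemma genfun1_gt0 x : 0 < x -> x < 1 -> 0 < genfun1 c x.
Proof. by move=> x0 x1; rewrite -lte_fin -genfun1E ?genfun_gt0// ltW. Qed.

End GeneratingFunction.

(** * The envelope of x - b k(x) *)

Section Envelope.
Variable R : realType.
Variable c : nat -> nat -> R.
Hypothesis c_ge0 : forall a m, 0 <= c a m.
Hypothesis c_0 : forall a, c a 0 = 0.
Hypothesis mass : (total_mass c < +oo)%E.
Hypothesis arms_gt0 : (0 < arms c)%E.
Implicit Types (x z b : R).
Local Notation k := (genfun1 c).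

(* The upper envelope of the functions [x - b k(x)]; along the solution it is
   [1 / alpha] as a function of [b = beta]. *)
Definition envelope b : R := sup [set x - b * k x | x in [set x | 0 <= x < 1]].
Local Notation M := envelope.

Lemma envelope_has_sup b : 0 <= b ->
  has_sup [set x - b * k x | x in [set x | 0 <= x < 1]].
Proof.
move=> b0; split; first by exists (0 - b * k 0); exists 0 => //=; rewrite lexx ltr01.
exists 1 => _ [x /andP[x0 x1] <-]; by rewrite lerBlDr ler_wpDr ?mulr_ge0 ?genfun1_ge0// ltW.
Qed.

Lemma envelope_ge b x : 0 <= b -> 0 <= x -> x < 1 -> x - b * k x <= M b.
Proof.
move=> b0 x0 x1; apply: ub_le_sup; first by have [] := envelope_has_sup b0.
by exists x => //=; rewrite x0.
Qed.

Lemma envelope_le b B : 0 <= b ->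
  (forall x, 0 <= x -> x < 1 -> x - b * k x <= B) -> M b <= B.
Proof.
move=> b0 hB; apply: sup_le_ub; first by have [] := envelope_has_sup b0.
by move=> _ [x /andP[x0 x1] <-]; exact: hB.
Qed.

Lemma envelope_approx b z : 0 <= b -> z < M b ->
  exists x, [/\ 0 <= x, x < 1 & z < x - b * k x].
Proof.
move=> b0 zM; apply: contrapT => h.
suff : M b <= z by rewrite leNgt zM.
apply: envelope_le => // x x0 x1; rewrite leNgt; apply/negP => zx.
by apply: h; exists x.
Qed.

(** The supremum defining M leaves out x = 1. When k(1) = u is finite, a point w < 1 close to 1 does
    as well up to 1 - w, because k(w) <= u. *)
Lemma envelope_ge_fin b x u : 0 <= b -> 0 <= x -> x <= 1 ->
  genfun c x 1 = u%:E -> x - b * u <= M b.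
Proof.
move=> b0 x0; rewrite le_eqVlt => /predU1P[->|x1] xu; last first.
  have := genfun1E c_ge0 mass x0 x1; rewrite xu => -[->].
  exact: envelope_ge.
rewrite leNgt; apply/negP => Mu.
have u0 : 0 <= u by rewrite -lee_fin -xu genfun_ge0.
set z := Num.max 0 (M b + b * u).
have z1 : z < 1 by rewrite gt_max ltr01/= -ltrBrDr.
have z0 : 0 <= z by rewrite le_max lexx.
set w := (z + 1) / 2.
have zw : z < w by rewrite midf_lt.
have w1 : w < 1 by rewrite midf_lt.
have w0 : 0 <= w by rewrite (le_trans z0)// ltW.
have kw : k w <= u.
  rewrite -lee_fin -(genfun1E c_ge0 mass)// -xu.
  by apply: genfun_nd => //; exact: ltW.
have := envelope_ge b0 w0 w1; apply/negP; rewrite -ltNge.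
have : M b + b * u <= z by rewrite le_max lexx orbT.
have := ler_wpM2l b0 kw; lra.
Qed.

Lemma envelope_le1 b : 0 <= b -> M b <= 1.
Proof.
move=> b0; apply: envelope_le => // x x0 x1.
by rewrite lerBlDr ler_wpDr ?mulr_ge0 ?genfun1_ge0// ltW.
Qed.

Lemma envelope0 : M 0 = 1.
Proof.
apply/eqP; rewrite eq_le envelope_le1//= leNgt; apply/negP => M1.
have M0 : 0 <= M 0 by have := envelope_ge (lexx 0) (lexx 0) ltr01; rewrite mul0r subr0.
have := @envelope_ge 0 ((M 0 + 1) / 2) (lexx 0); rewrite mul0r subr0.
have h1 : M 0 < (M 0 + 1) / 2 by rewrite midf_lt.
have h2 : (M 0 + 1) / 2 < 1 by rewrite midf_lt.
by move=> /(_ (le_trans M0 (ltW h1)) h2); rewrite leNgt h1.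
Qed.

Lemma envelope_ni b b' : 0 <= b -> b <= b' -> M b' <= M b.
Proof.
move=> b0 bb; apply: envelope_le => [|x x0 x1]; first exact: le_trans bb.
apply: le_trans (envelope_ge b0 x0 x1).
by rewrite lerD2l lerN2 ler_wpM2r// genfun1_ge0.
Qed.

(** From b' (x - b k(x)) = b (x - b' k(x)) + (b' - b) x with x <= 1. No bound on k enters, so the
    estimate survives A_0 = +oo; the price is that it degenerates at b = 0. *)
Lemma envelope_lip b b' : 0 < b -> b <= b' ->
  b * (M b - M b') <= (b' - b) * (1 - M b).
Proof.
move=> b0 bb; have b'0 : 0 <= b' by rewrite (le_trans _ bb)// ltW.
suff : b' * M b <= b * M b' + (b' - b) by lra.
rewrite -ler_pdivlMl ?(lt_le_trans b0)//; apply: envelope_le => [|x x0 x1]; first exact: ltW.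
rewrite ler_pdivlMl ?(lt_le_trans b0)//.
have := ler_wpM2l (ltW b0) (envelope_ge b'0 x0 x1).
have : (b' - b) * x <= (b' - b) by rewrite ler_piMr ?subr_ge0// ltW.
lra.
Qed.

Lemma envelope_cvg0 : M b @[b --> 0^'+] --> M 0.
Proof.
apply/cvgrPdist_le => e e0; rewrite envelope0.
(* First x is chosen close to 1, then b small compared with 1 / k(x): k need not be bounded near
   1. *)
set x := Num.max 0 (1 - e / 2).
have x0 : 0 <= x by rewrite le_max lexx.
have x1 : x < 1 by rewrite gt_max ltr01/= ltrBlDr ltrDl divr_gt0.
have kx := genfun1_ge0 c_ge0 x0.
have e2 : 0 < e / 2 / (k x + 1) by rewrite !divr_gt0// ltr_wpDl.
near=> b.
have b0 : 0 <= b by apply/ltW; near: b; exact: nbhs_right_gt.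
have be : b * (k x + 1) < e / 2.
  rewrite -ltr_pdivlMr ?ltr_wpDl//; near: b; exact: nbhs_right_lt.
rewrite ger0_norm ?subr_ge0 ?envelope_le1//.
have := envelope_ge b0 x0 x1.
have : 1 - e / 2 <= x by rewrite le_max lexx orbT.
rewrite mulrDr mulr1 in be; lra.
Unshelve. all: by end_near. Qed.

Lemma envelope_continuous T : {within `[0, T], continuous M}.
Proof.
have [T0|T0] := leP T 0.
  move: T0; rewrite le_eqVlt => /predU1P[->|T0]; first by rewrite set_itv1; exact: continuous_subspace1.
  by rewrite set_itv_ge ?bnd_simp -?ltNge//; exact: continuous_subspace0.
have contpos b : 0 < b -> {for b, continuous M}.
  move=> b0; apply/cvgrPdist_le => e e0.
  set C := (2 / b) * (1 - M (2 * b)) + 1.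
  have b2 : 0 < b / 2 by rewrite divr_gt0.
  have bb : b <= 2 * b by rewrite ler_peMl ?ler1n ?ltW.
  have M2 : 0 <= 1 - M (2 * b) by rewrite subr_ge0 envelope_le1// mulr_ge0 ?ltW.
  have C0 : 0 < C by rewrite /C ltr_wpDl// mulr_ge0// divr_ge0// ltW.
  have lip u v : b / 2 <= u -> u <= v -> v <= 2 * b -> M u - M v <= C * (v - u).
    move=> bu uv v2; have u0 := lt_le_trans b2 bu.
    have := envelope_lip u0 uv.
    rewrite -ler_pdivlMl// => h; apply: (le_trans h).
    rewrite mulrCA mulrC ler_wpM2r ?subr_ge0//.
    apply: (@le_trans _ _ (2 / b * (1 - M (2 * b)))); last by rewrite /C lerDl.
    apply: ler_pM.
    - by rewrite invr_ge0 ltW.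
    - by rewrite subr_ge0 envelope_le1// ltW.
    - by rewrite -(invf_div b) lef_pV2 ?posrE.
    - by rewrite lerD2l lerN2 envelope_ni ?(le_trans uv)// ltW.
  near=> v.
  have v1 : b / 2 <= v.
    by apply/ltW; near: v; apply: lt_nbhsr; rewrite ltr_pdivrMr// ltr_pMr// ltr1n.
  have v2 : v <= 2 * b.
    by apply/ltW; near: v; apply: lt_nbhsl; rewrite ltr_pMl// ltr1n.
  have vb : `|b - v| <= e / C.
    by near: v; apply/nbhs_ballP; exists (e / C) => /=; [rewrite divr_gt0|move=> v /ltW].
  have hb : b / 2 <= b by rewrite ler_pdivrMr// ler_peMr ?ltW// ltr1n.
  have [bv|vb'] := leP b v.
    rewrite ger0_norm; last by rewrite subr_ge0 envelope_ni// ltW.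
    apply: le_trans (lip _ _ hb bv v2) _.
    by rewrite mulrC -ler_pdivlMr// (le_trans _ vb)// distrC ler_norm.
  rewrite distrC ger0_norm; last first.
    by rewrite subr_ge0 envelope_ni// ?(le_trans _ v1)// ltW.
  apply: le_trans (lip _ _ v1 (ltW vb') bb) _.
  by rewrite mulrC -ler_pdivlMr// (le_trans _ vb)// ler_norm.
apply/continuous_within_itvP => //; split.
- by move=> b; rewrite in_itv/= => /andP[b0 _]; exact: contpos.
- exact: envelope_cvg0.
- by apply: cvg_at_left_filter; exact: contpos.
Unshelve. all: by end_near. Qed.

(* -slope b is a slope of the convex function M at b. *)
Definition slope b := fine (genfun (evol c b) (M b) 1).
Local Notation g := slope.

Lemma genfun_evol_below b z x : 0 <= b -> 0 <= z -> 0 <= x -> x < 1 ->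
  z <= x - b * k x -> (genfun (evol c b) z 1 <= (k x)%:E)%E.
Proof.
move=> b0 z0 x0 x1 zx; apply: (@genfun_evol_le _ c c_ge0 c_0 1 ler01 b x) => //.
  by rewrite genfun1E.
by rewrite -lerBrDr.
Qed.

(** Below M(b) some x satisfies z < x - b k(x), so that u(b, z, 1) <= k(x) <= (1 - z) / b; left
    continuity carries the bound to z = M(b). The point M(b) + b g(b) is then the place where x - b
    k(x) attains M(b), possibly x = 1. *)
Lemma slope_spec b : 0 < b -> 0 < M b ->
  [/\ genfun (evol c b) (M b) 1 = (g b)%:E, 0 <= g b, M b + b * g b <= 1 &
      genfun c (M b + b * g b) 1 = (g b)%:E].
Proof.
move=> b0 M0; have b0' := ltW b0.
have e0 := fun a m => @evol_ge0 _ c c_ge0 b a m b0'.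
have h z : 0 <= z -> z < M b -> (genfun (evol c b) z 1 <= ((1 - z) / b)%:E)%E.
  move=> z0 zM; have [x [x0 x1 zx]] := envelope_approx b0' zM.
  apply: le_trans (genfun_evol_below b0' z0 x0 x1 (ltW zx)) _.
  rewrite lee_fin ler_pdivlMr// mulrC; lra.
have hM : (genfun (evol c b) (M b) 1 <= ((1 - M b) / b)%:E)%E.
  apply: genfun_left => // z z0 zM.
  apply/lee_addgt0Pr => e e0'; rewrite -EFinD.
  have [w [zw wM bw]] : exists w : R, [/\ z <= w, w < M b & M b - b * e <= w].
    exists (Num.max z (M b - b * e)); rewrite !le_max !lexx orbT; split => //.
    by rewrite gt_max zM/= ltrBlDr ltrDl mulr_gt0.
  apply: (@le_trans _ _ (genfun (evol c b) w 1)); first exact: genfun_nd.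
  apply: le_trans (h w (le_trans z0 zw) wM) _.
  rewrite lee_fin ler_pdivrMr// mulrDl mulfVK ?gt_eqF// (mulrC e b).
  by rewrite -lerBlDl opprB addrC addrA subrK lerBlDl -lerBlDr.
have ge0 : (0 <= genfun (evol c b) (M b) 1)%E by apply: genfun_ge0 => //; exact: ltW.
have gE : genfun (evol c b) (M b) 1 = (g b)%:E.
  by rewrite /slope fineK// ge0_fin_numE// (le_lt_trans hM)// ltry.
have g0 : 0 <= g b by rewrite /slope fine_ge0.
split => //.
  move: hM; rewrite gE lee_fin ler_pdivlMr// mulrC; lra.
by apply: (@genfun_evol_fix _ c c_ge0 c_0 1 ler01) => //; exact: ltW.
Qed.

(** With m = M(b) + b g(b) and k(m) = g(b), the affine function b' |-> m - b' k(m) lies below M and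
    touches it at b. *)
Lemma envelope_tangent b b' : 0 < b -> 0 < M b -> 0 <= b' ->
  M b - (b' - b) * g b <= M b'.
Proof.
move=> b0 M0 b'0; have [_ g0 m1 mk] := slope_spec b0 M0.
have m0 : 0 <= M b + b * g b by rewrite addr_ge0 ?mulr_ge0// ltW.
apply: le_trans (envelope_ge_fin b'0 m0 m1 mk); lra.
Qed.

Lemma tangents_le (d p p' q q' : R) : 0 < d ->
  p - d * q <= p' -> p' - (- d) * q' <= p -> q' <= q.
Proof. by move=> d0 h1 h2; rewrite -(ler_pM2l d0); lra. Qed.

Lemma slope_ni b b' : 0 < b -> b <= b' -> 0 < M b' -> g b' <= g b.
Proof.
move=> b0; rewrite le_eqVlt => /predU1P[->//|bb] M0.
have b'0 := lt_trans b0 bb.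
have M0' : 0 < M b by apply: lt_le_trans M0 (envelope_ni (ltW b0) (ltW bb)).
have h1 := envelope_tangent b0 M0' (ltW b'0).
have h2 := envelope_tangent b'0 M0 (ltW b0).
apply: (@tangents_le (b' - b) (M b) (M b') (g b) (g b')) => //.
  by rewrite subr_gt0.
by rewrite opprB.
Qed.

Lemma slope_gt0 b : 0 < b -> 0 < M b -> 0 < g b.
Proof.
move=> b0 M0; have [_ g0 m1 mk] := slope_spec b0 M0.
by rewrite -lte_fin -mk genfun_gt0// ltr_wpDr// mulr_ge0// ltW.
Qed.

Lemma envelope_lt b b' : 0 <= b -> b < b' -> 0 < M b' -> M b' < M b.
Proof.
move=> b0 bb M0; have b'0 := le_lt_trans b0 bb.
apply: lt_le_trans (envelope_tangent b'0 M0 b0).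
by rewrite -subr_gt0 addrAC subrr add0r -mulNr opprB mulr_gt0 ?subr_gt0// slope_gt0.
Qed.

Lemma slope_lee b : 0 < b -> 0 < M b -> ((g b)%:E <= arms c)%E.
Proof.
move=> b0 M0; have [_ g0 m1 mk] := slope_spec b0 M0.
by rewrite -mk armsE// genfun_nd// addr_ge0 ?mulr_ge0// ltW.
Qed.

End Envelope.

(** * The time change *)

Section TimeChange.
Variable R : realType.
Variable c : nat -> nat -> R.
Hypothesis c_ge0 : forall a m, 0 <= c a m.
Hypothesis c_0 : forall a, c a 0 = 0.
Hypothesis mass : (total_mass c < +oo)%E.
Hypothesis arms_gt0 : (0 < arms c)%E.
Implicit Types (s t b : R).
Local Notation mu := (@lebesgue_measure R).
Local Notation M := (envelope c).
Local Notation g := (slope c).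
Local Notation envelope_ni := (envelope_ni c_ge0).

(* The time at which beta reaches the value b. *)
Definition clock b := \int[mu]_(s in `[0, b]) (M s ^+ 2)^-1.

Lemma envelope_pos b b' : 0 <= b -> b <= b' -> 0 < M b' -> 0 < M b.
Proof. by move=> b0 bb M0; apply: lt_le_trans M0 (envelope_ni b0 bb). Qed.

Lemma clock_integrable b : 0 < M b ->
  mu.-integrable `[0, b] (EFin \o (fun s => (M s ^+ 2)^-1)).
Proof.
move=> M0; apply: continuous_compact_integrable; first exact: segment_compact.
apply/subspace_continuousP => s /=; rewrite in_itv/= => /andP[s0 sb].
have Ms : 0 < M s by exact: envelope_pos sb M0.
apply: cvgV; first by rewrite gt_eqF// exprn_gt0.
have cM : M x @[x --> within `[0, b] (nbhs s)] --> M s.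
  have := (@subspace_continuousP _ `[0, b] _ M).1 (envelope_continuous c_ge0 (T:=b)) s.
  by apply; rewrite /= in_itv/= s0.
by rewrite expr2; under eq_fun do rewrite expr2; exact: cvgM.
Qed.

Lemma clockB b b' : 0 <= b -> b <= b' -> 0 < M b' ->
  clock b' - clock b = \int[mu]_(s in `]b, b']) (M s ^+ 2)^-1.
Proof.
move=> b0 bb M0.
rewrite /clock (@Rintegral_itvB _ _ (BLeft 0) (BRight b') b)//.
exact: clock_integrable.
Qed.

Lemma clock_sandwich b b' : 0 <= b -> b <= b' -> 0 < M b' ->
  M b' ^+ 2 * (clock b' - clock b) <= b' - b <= M b ^+ 2 * (clock b' - clock b).
Proof.
move=> b0 bb M0; have Mb := envelope_pos b0 bb M0.
have M20 : 0 < M b' ^+ 2 by rewrite exprn_gt0.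
have M20' : 0 < M b ^+ 2 by rewrite exprn_gt0.
have ii : mu.-integrable `]b, b'] (EFin \o (fun s => (M s ^+ 2)^-1)).
  apply: integrableS (clock_integrable M0) => //.
  by apply: subset_itv; rewrite bnd_simp.
have ic (x : R) : mu.-integrable `]b, b'] (EFin \o (fun=> x)) by exact: integrable_cst_itv.
rewrite clockB//; apply/andP; split.
  rewrite -ler_pdivlMl//.
  apply: le_trans (le_Rintegral _ ii (ic (M b' ^+ 2)^-1) _) _ => //.
    move=> s /=; rewrite in_itv/= => /andP[bs sb].
    have s0 : 0 <= s by rewrite (le_trans b0)// ltW.
    have Ms := envelope_pos s0 sb M0.
    rewrite lef_pV2 ?posrE ?exprn_gt0// lerXn2r ?nnegrE ?(ltW Ms) ?(ltW M0)//.
    exact: envelope_ni.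
  by rewrite Rintegral_cst// fine_lebesgue_itv.
rewrite -ler_pdivrMl//.
apply: le_trans _ (le_Rintegral _ (ic (M b ^+ 2)^-1) ii _) => //.
  by rewrite Rintegral_cst// fine_lebesgue_itv.
move=> s /=; rewrite in_itv/= => /andP[bs sb].
have s0 : 0 <= s by rewrite (le_trans b0)// ltW.
have Ms := envelope_pos s0 sb M0.
rewrite lef_pV2 ?posrE ?exprn_gt0// lerXn2r ?nnegrE ?(ltW Ms) ?(ltW Mb)//.
by rewrite envelope_ni// ltW.
Qed.

Lemma clock0 : clock 0 = 0.
Proof. by rewrite /clock set_itv1 Rintegral_set1. Qed.

Lemma clock_lt b b' : 0 <= b -> b < b' -> 0 < M b' -> clock b < clock b'.
Proof.
move=> b0 bb M0; have /andP[_] := clock_sandwich b0 (ltW bb) M0.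
rewrite -subr_gt0 => h; rewrite -(pmulr_rgt0 _ (_ : 0 < M b ^+ 2)).
  by apply: lt_le_trans h; rewrite subr_gt0.
by rewrite exprn_gt0// (envelope_pos b0 (ltW bb)).
Qed.

Lemma clock_inj b b' : 0 <= b -> 0 <= b' -> 0 < M b -> 0 < M b' ->
  clock b = clock b' -> b = b'.
Proof.
move=> b0 b'0 M0 M0' e; apply/eqP; rewrite eq_le !leNgt; apply/andP; split; apply/negP => h.
  by have := clock_lt b'0 h M0; rewrite e ltxx.
by have := clock_lt b0 h M0'; rewrite e ltxx.
Qed.

Lemma clock_nd b b' : 0 <= b -> b <= b' -> 0 < M b' -> clock b <= clock b'.
Proof.
by move=> b0; rewrite le_eqVlt => /predU1P[->//|bb] M0; exact/ltW/clock_lt.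
Qed.

Lemma clock_ge b : 0 <= b -> 0 < M b -> b <= clock b.
Proof.
move=> b0 M0; have /andP[_] := clock_sandwich (lexx 0) b0 M0.
by rewrite envelope0// expr1n mul1r clock0 !subr0.
Qed.

(** Arithmetic for [clock_unbounded], with m = M(b) and X, X' the clock at b and b + d / 2. The
    hypotheses give X' - X >= b^2 / (2 d) >= z^2 / (8 d), and the choice of d makes the last term
    equal to t + 1 + z / 4. *)
Lemma blowup_bound (t z b d m X X' : R) : 0 <= t -> 0 < z -> 0 < b -> 0 < d ->
  0 < m -> 0 <= X -> z <= 2 * b -> d * (8 * (t + 1) + 2 * z) = z ^+ 2 ->
  b * m <= d -> d / 2 <= m ^+ 2 * (X' - X) -> t <= X'.
Proof.
move=> t0 z0 b0 d0 m0 X0 b2 dE bM h.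
have h1 : b ^+ 2 * (d / 2) <= d ^+ 2 * (X' - X).
  apply: le_trans (ler_wpM2l (sqr_ge0 b) h) _.
  rewrite mulrA ler_wpM2r//; last first.
    by rewrite -exprMn lerXn2r ?nnegrE ?mulr_ge0 ?(ltW b0) ?(ltW m0) ?(ltW d0).
  have m2 : 0 < m ^+ 2 by rewrite exprn_gt0.
  by rewrite -(pmulr_rge0 _ m2); apply: le_trans h; rewrite divr_ge0// ltW.
have h2 : b ^+ 2 / 2 <= d * (X' - X).
  by rewrite -(ler_pM2l d0); move: h1; rewrite (expr2 d); lra.
have h3 : z ^+ 2 <= 4 * b ^+ 2 by nra.
have h4 : 0 <= d * X by rewrite mulr_ge0// ltW.
have h5 : 0 < d * z by rewrite mulr_gt0.
rewrite -(ler_pM2l d0); lra.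
Qed.

(** If M stays positive, M <= 1 gives clock b >= b. Otherwise let z be the end of the interval where
    M is positive: by [envelope_lip], M(b) <= (z - b) / b near z, and the integral of 1 / M^2
    diverges there. *)
Lemma clock_unbounded t : 0 <= t -> exists b, [/\ 0 <= b, 0 < M b & t <= clock b].
Proof.
move=> t0.
have [Mall|] := pselect (forall b, 0 <= b -> 0 < M b).
  by exists t; rewrite Mall// clock_ge// Mall.
move=> /existsNP[b1 /not_implyP[b10 /negP]]; rewrite -leNgt => Mb1.
pose Z := [set b | 0 <= b /\ 0 < M b].
have Zub : ubound Z b1.
  move=> b [b0 Mb]; rewrite leNgt; apply/negP => bb.
  by have := envelope_ni b10 (ltW bb); rewrite leNgt (le_lt_trans Mb1).
have Z0 : Z 0 by split; rewrite ?envelope0.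
have sZ : has_sup Z by split; [exists 0|exists b1].
set z := sup Z.
have z0 : 0 <= z by apply: ub_le_sup => //; exists b1.
have below b : 0 <= b -> b < z -> 0 < M b.
  move=> b0 bz; have zb0 : 0 < z - b by rewrite subr_gt0.
  have [b' [b'0 Mb'] bb'] := sup_adherent zb0 sZ.
  apply: (envelope_pos b0 _ Mb').
  by move: bb'; rewrite opprB addrC subrK => /ltW.
have z_gt0 : 0 < z.
  have k2 : 0 <= genfun1 c (1 / 2) by apply: genfun1_ge0 => //; rewrite divr_ge0.
  (* Small enough for 1 / 2 - b k(1 / 2) to be positive, which makes M(b) positive. *)
  pose b := (4 * (genfun1 c (1 / 2) + 1))^-1.
  have k4 : 0 < 4 * (genfun1 c (1 / 2) + 1) by rewrite mulr_gt0// ltr_wpDl.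
  have b0 : 0 < b by rewrite invr_gt0.
  apply: (lt_le_trans b0); apply: ub_le_sup; first by exists b1.
  split; first exact: ltW.
  have h2 : (1 / 2 : R) < 1 by rewrite ltr_pdivrMr// mul1r ltr1n.
  apply: lt_le_trans (envelope_ge c_ge0 (ltW b0) _ h2); last by rewrite divr_ge0.
  have : b * (4 * (genfun1 c (1 / 2) + 1)) = 1 by rewrite mulVf// gt_eqF.
  move: b0 k2; clear; move: (genfun1 c (1 / 2)) b => k b b0 k2 e.
  rewrite subr_gt0; nra.
have Mz : M z <= 0.
  rewrite leNgt; apply/negP => Mz.
  (* If M(z) were positive, [envelope_lip] would keep M positive up to z + z M(z) / 2, beyond the
     supremum z. *)
  have d0 : 0 < z * M z / 2 by rewrite divr_gt0// mulr_gt0.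
  have zd : z <= z + z * M z / 2 by rewrite lerDl ltW.
  have := envelope_lip c_ge0 z_gt0 zd; rewrite addrAC subrr add0r => h.
  have : z + z * M z / 2 <= z.
    apply: ub_le_sup; first by exists b1.
    split; first by rewrite addr_ge0// ltW.
    rewrite -(pmulr_rgt0 _ z_gt0).
    move: h d0 Mz z_gt0; clear; move: (M (z + z * M z / 2)) (M z) => m' m h d0 Mz z0.
    have : 0 < z * m * m by rewrite !mulr_gt0.
    lra.
  by rewrite leNgt ltrDl d0.
have den : 0 < 8 * (t + 1) + 2 * z.
  by rewrite ltr_wpDl ?mulr_gt0// mulr_ge0// addr_ge0.
(* The term 8 (t + 1) makes z^2 / (8 d) exceed t; the term 2 z ensures d <= z / 2, so that b = z - d
   stays at least z / 2. *)
pose d := z ^+ 2 / (8 * (t + 1) + 2 * z).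
have d0 : 0 < d by rewrite divr_gt0// exprn_gt0.
have dE : d * (8 * (t + 1) + 2 * z) = z ^+ 2 by rewrite mulfVK// gt_eqF.
have dz : 2 * d <= z.
  rewrite -(ler_pM2r z_gt0) -expr2 -dE.
  have : 0 <= d * (8 * (t + 1)) by rewrite mulr_ge0 ?(ltW d0)// mulr_ge0// addr_ge0.
  move: (d) => e; lra.
pose b := z - d.
have b0 : 0 < b by rewrite /b; move: dz d0 z_gt0; move: (d) => e; lra.
have bz : b <= z by rewrite gerBl ltW.
have bM : b * M b <= d.
  have := envelope_lip c_ge0 b0 bz.
  have -> : z - b = d by rewrite /b opprB addrC subrK.
  have : 0 < M b by apply: below; [exact: ltW|rewrite gtrBl].
  have : 0 <= b * - M z by rewrite mulr_ge0 ?oppr_ge0// ltW.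
  move: d0; move: (M b) (M z) (b) (d) => m mz e f f0 h1 h2 h3.
  clear - f0 h1 h2 h3; nra.
pose b' := b + d / 2.
have bb' : b <= b' by rewrite lerDl divr_ge0// ltW.
have b'z : b' < z.
  rewrite /b' /b; move: d0; move: (d) => e; lra.
have b'0 : 0 <= b' by rewrite (le_trans (ltW b0)).
have Mb' := below b' b'0 b'z.
exists b'; split => //.
have /andP[_] := clock_sandwich (ltW b0) bb' Mb'.
have -> : b' - b = d / 2 by rewrite /b' addrC addKr.
have cb : 0 <= clock b by apply: le_trans (clock_ge _ _) => //; [exact: ltW|exact: ltW|exact: (envelope_pos (ltW b0) bb')].
have Mb : 0 < M b by exact: (envelope_pos (ltW b0) bb').
have b2 : z <= 2 * b by rewrite /b; move: dz; move: (d) => e; lra.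
move=> h; exact: (blowup_bound t0 z_gt0 b0 d0 Mb cb b2 dE bM h).
Qed.

Lemma clock_surj t : 0 <= t -> exists b, [/\ 0 <= b, 0 < M b & clock b = t].
Proof.
move=> t0; have [B [B0 MB tB]] := clock_unbounded t0.
have [] := @IVT _ clock 0 B t B0.
- exact: parameterized_integral_continuous (clock_integrable MB).
- by rewrite clock0 min_l ?max_r ?t0// (le_trans t0).
move=> b; rewrite in_itv/= => /andP[b0 bB] <-; exists b; split => //.
exact: envelope_pos MB.
Qed.

Definition btime t := xget 0 [set b | [/\ 0 <= b, 0 < M b & clock b = t]].

Lemma btimeP t : 0 <= t -> [/\ 0 <= btime t, 0 < M (btime t) & clock (btime t) = t].
Proof. by move=> t0; rewrite /btime; case: xgetP => //; have [b hb] := clock_surj t0 => /(_ b). Qed.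

Lemma btime0 : btime 0 = 0.
Proof.
have [b0 Mb cb] := btimeP (lexx 0); apply: clock_inj => //; first by rewrite envelope0.
by rewrite cb clock0.
Qed.

Lemma btime_sandwich s t : 0 <= s -> s <= t ->
  M (btime t) ^+ 2 * (t - s) <= btime t - btime s <= M (btime s) ^+ 2 * (t - s).
Proof.
move=> s0 st; have [b0 Mb cb] := btimeP s0; have [b0' Mb' cb'] := btimeP (le_trans s0 st).
have bb : btime s <= btime t.
  rewrite leNgt; apply/negP => h.
  by have := clock_lt b0' h Mb; rewrite cb cb' ltNge st.
by have := clock_sandwich b0 bb Mb'; rewrite cb cb'.
Qed.

Lemma btime_le s t : 0 <= s -> s <= t -> btime s <= btime t.
Proof.
move=> s0 st; have /andP[h _] := btime_sandwich s0 st; rewrite -subr_ge0 (le_trans _ h)//.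
by rewrite mulr_ge0 ?subr_ge0// sqr_ge0.
Qed.

Lemma btime_lt s t : 0 <= s -> s < t -> btime s < btime t.
Proof.
move=> s0 st; have [b0' Mb' cb'] := btimeP (le_trans s0 (ltW st)).
have /andP[h _] := btime_sandwich s0 (ltW st); rewrite -subr_gt0 (lt_le_trans _ h)//.
by rewrite mulr_gt0 ?subr_gt0// exprn_gt0.
Qed.

Lemma btime_gt0 t : 0 < t -> 0 < btime t.
Proof. by move=> t0; rewrite -btime0 btime_lt. Qed.

End TimeChange.

(** * Triangular partial sums of the gain *)

Section TriangularSums.
Variable R : realType.
Implicit Types (f c : nat -> nat -> R) (N a m : nat).

(* The index set is stable under a' + a'' = a + 2, m' + m'' = m, so that the
   partial sums of the gain only involve partial sums of the arms. *)
Definition tri N f := psum 0 N.+1 (fun a m => if (a + m <= N)%N then f a m else 0).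

Lemma triZ N f (x : R) : tri N (fun a m => x * f a m) = x * tri N f.
Proof.
rewrite /tri /psum mulr_sumr; apply: eq_bigr => a _; rewrite mulr_sumr.
by apply: eq_bigr => m _; case: ifP; rewrite ?mulr0.
Qed.

Lemma tri_ge0 N f : (forall a m, 0 <= f a m) -> 0 <= tri N f.
Proof. by move=> f0; apply: psum_ge0 => a m; case: ifP. Qed.

Lemma tri_le_psum N f : (forall a m, 0 <= f a m) -> tri N f <= psum 0 N.+1 f.
Proof. by move=> f0; apply: ler_psum => a m _ _; case: ifP. Qed.

Lemma tri_nd N N' f : (forall a m, 0 <= f a m) -> (N <= N')%N -> tri N f <= tri N' f.
Proof.
move=> f0 NN; apply: (@le_trans _ _ (psum 0 N.+1 (fun a m => if (a + m <= N')%N then f a m else 0))).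
  by apply: ler_psum => a m _ _; case: ifP => [aN|_]; rewrite ?(leq_trans aN)//; case: ifP.
by apply: psum_nd; rewrite ?ltnS// => a m; case: ifP.
Qed.

Lemma psum_le_tri L f : (forall a m, 0 <= f a m) -> psum 0 L f <= tri (L + L) f.
Proof.
move=> f0; apply: (@le_trans _ _ (psum 0 L (fun a m => if (a + m <= L + L)%N then f a m else 0))).
  rewrite /psum; apply: ler_sum_nat => a /andP[_ aL]; apply: ler_sum_nat => m /andP[_ mL].
  by rewrite leq_add// ltnW.
by apply: psum_nd => [a m|]; [case: ifP|lia].
Qed.

Lemma sum_ord_from1 (F : nat -> R) n : F 0 = 0 ->
  \sum_(k < n) F k = \sum_(1 <= k < n) F k.
Proof.
move=> F0; rewrite -(big_mkord xpredT F); case: n => [|n]; first by rewrite !big_geq.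
by rewrite big_nat_recl// F0 add0r big_add1.
Qed.

Lemma sum_coef_le_horner1 (p : {poly {poly R}}) n n' :
  (forall a m, 0 <= p`_a`_m) ->
  \sum_(a < n) \sum_(m < n') p`_a`_m <= (p.[1]).[1].
Proof.
move=> p0.
have h1 (q : {poly R}) : (forall m, 0 <= q`_m) -> \sum_(m < n') q`_m <= q.[1].
  move=> q0; rewrite (@horner_coef_wide _ (maxn (size q) n')) ?leq_maxl//.
  rewrite (big_ord_widen (maxn (size q) n') (fun i => q`_i)) ?leq_maxr// big_mkcond/=.
  by apply: ler_sum => i _; rewrite expr1n mulr1; case: ifP.
rewrite (@horner_coef_wide _ (maxn (size p) n) p) ?leq_maxl// horner_sum.
rewrite (big_ord_widen (maxn (size p) n) (fun i => \sum_(m < n') p`_i`_m)) ?leq_maxr// big_mkcond/=.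
apply: ler_sum => i _; rewrite expr1n mulr1; case: ifP => _; first exact: h1.
rewrite horner_coef sumr_ge0// => j _; by rewrite expr1n mulr1.
Qed.

(** In U the arm number is lowered by one, since each partner spends one arm; the gain is then half
    a coefficient of U^2, and a partial sum of the non-negative coefficients of U^2 is at most
    U(1)^2. *)
Lemma tri_gain_le N c : (forall a m, 0 <= c a m) ->
  tri N (gain c) <= 2^-1 * tri N (fun a m => a%:R * c a m) ^+ 2.
Proof.
move=> c0.
pose f a m : R := if (0 < m)%N && (a + m <= N)%N then a%:R * c a m else 0.
have f0 a m : 0 <= f a m by rewrite /f; case: ifP => // _; rewrite mulr_ge0.
pose U : {poly {poly R}} := \poly_(l < N.+1) \poly_(k < N.+1) f l.+1 k.
have U1 : (U.[1]).[1] = tri N (fun a m => a%:R * c a m).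
  have -> : tri N (fun a m => a%:R * c a m) = psum 0 N.+1 f.
    by apply: eq_psum => a m _ m0; rewrite /f m0.
  rewrite /psum big_mkord.
  (* The row a = N + 1 is outside the triangle because m >= 1; adding it makes room for the shift by
     one. *)
  have -> : \sum_(a < N.+1) \sum_(1 <= m < N.+1) f a m = \sum_(a < N.+2) \sum_(1 <= m < N.+1) f a m.
    rewrite [RHS]big_ord_recr/= [X in _ = _ + X]big1 ?addr0// => m _.
    by rewrite /f ifF//; lia.
  rewrite big_ord_recl/= [X in _ = X + _]big1 ?add0r; last first.
    by move=> m _; rewrite /f mul0r if_same.
  rewrite horner_poly horner_sum; apply: eq_bigr => l _.
  rewrite expr1n mulr1 horner_poly -(@sum_ord_from1 (fun m => f l.+1 m))//.
  by apply: eq_bigr => k _; rewrite expr1n mulr1.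
have Uc l k : U`_l`_k = if (l < N.+1)%N && (k < N.+1)%N then f l.+1 k else 0.
  by rewrite coef_poly; case: ifP => _; rewrite ?coef0// coef_poly.
have Uc0 l k : 0 <= U`_l`_k by rewrite Uc; case: ifP.
have UU a m : (U * U)`_a`_m = \sum_(l < a.+1) \sum_(k < m.+1) U`_l`_k * U`_(a - l)`_(m - k).
  by rewrite coefM coef_sum; apply: eq_bigr => l _; rewrite coefM.
have UU0 a m : 0 <= (U * U)`_a`_m.
  by rewrite UU sumr_ge0// => l _; rewrite sumr_ge0// => k _; rewrite mulr_ge0.
rewrite -U1 expr2 -!hornerM.
apply: (@le_trans _ _ (2^-1 * \sum_(a < N.+1) \sum_(m < N.+1) (U * U)`_a`_m)); last first.
  by rewrite ler_wpM2l ?invr_ge0//; exact: sum_coef_le_horner1.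
have U00 l k : (k == 0)%N -> U`_l`_k = 0.
  by move=> /eqP ->; rewrite Uc /f if_same.
rewrite mulr_sumr /tri /psum big_mkord; apply: ler_sum => a _.
rewrite mulr_sumr (@sum_ord_from1 (fun m => 2^-1 * (U * U)`_a`_m)); last first.
  by rewrite UU big1 ?mulr0// => l _; rewrite big1// => k _; rewrite U00 ?mul0r//; have := ltn_ord k; lia.
apply: ler_sum_nat => m /andP[m0 mN]; case: ifPn => am; last by rewrite mulr_ge0 ?invr_ge0.
rewrite /gain ler_wpM2l ?invr_ge0// UU big_add1/= big_mkord.
apply: ler_sum => l _.
have -> : (a + 2 - l.+1 = (a - l).+1)%N by have := ltn_ord l; lia.
rewrite (@sum_ord_from1 (fun k => U`_l`_k * U`_(a - l)`_(m - k))); last by rewrite U00 ?mul0r.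
rewrite big_nat_recr//= ler_wpDr ?mulr_ge0//.
apply: ler_sum_nat => k /andP[k1 km]; have la := ltn_ord l.
rewrite !Uc !ifT /f ?ifT; try lia.
by rewrite mulrACA mulrA.
Qed.

End TriangularSums.

(** * Rescaling, and tools for primitives *)

Section Scaling.
Variable R : realType.
Implicit Types (s t x y : R) (a m : nat).

Lemma genfun_scale (f : nat -> nat -> R) (p x y : R) : (forall a m, 0 <= f a m) -> 0 <= p -> 0 <= x -> 0 <= y ->
  genfun (fun a m => p ^+ a * f a m) x y = (p%:E * genfun f (x * p) y)%E.
Proof.
move=> f0 p0 x0 y0; rewrite !genfunE -dsumZ; last first.
  by apply: gterm_ge0 => //; rewrite mulr_ge0.
apply: eq_dsum => -[//|a] m _ _; rewrite /gterm /= exprMn exprS; ring.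
Qed.

(** The two arms spent by a coagulation produce the extra factor p ^ 2, which is the speed of the
    time change. *)
Lemma gain_scale (f : nat -> nat -> R) (p : R) a m :
  gain (fun a m => p ^+ a * f a m) a m = p ^+ (a + 2) * gain f a m.
Proof.
rewrite /gain [RHS]mulrCA; congr (_ * _).
rewrite mulr_sumr; apply: eq_big_nat => a' /andP[_ a'a].
rewrite mulr_sumr; apply: eq_bigr => m' _.
have -> : p ^+ (a + 2) = p ^+ a' * p ^+ (a + 2 - a') by rewrite -exprD; congr (_ ^+ _); lia.
ring.
Qed.

Lemma primitive_sum (I : Type) (r : seq I) (Q : pred I) (F Phi : I -> R -> R) :
  (forall i, Q i -> primitive (F i) (Phi i)) ->
  primitive (fun t => \sum_(i <- r | Q i) F i t) (fun t => \sum_(i <- r | Q i) Phi i t).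
Proof.
move=> h; elim: r => [|i r IH].
  by apply: primitive_ext (primitive_cst 0) => t _; rewrite big_nil.
case: (boolP (Q i)) => Qi.
  by apply: primitive_ext (primitiveD (h i Qi) IH) => t _; rewrite big_cons Qi.
by apply: primitive_ext IH => t _; rewrite big_cons (negbTE Qi).
Qed.

Lemma primitive_tri N (F Phi : nat -> nat -> R -> R) :
  (forall a m, primitive (F a m) (Phi a m)) ->
  primitive (fun t => tri N (fun a m => F a m t)) (fun t => tri N (fun a m => Phi a m t)).
Proof.
move=> h; apply: primitive_sum => a _; apply: primitive_sum => m _.
by case: (a + m <= N)%N => //; exact: primitive_cst.
Qed.

Lemma half_bound (x y z : R) : x <= 2^-1 * y -> y <= z -> x - z <= - 2^-1 * z.
Proof. by lra. Qed.

Lemma half_bound_double (x y m i : R) : x <= m -> 0 <= y -> y - x <= - 2^-1 * i -> i <= 2 * m.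
Proof. by lra. Qed.

Lemma lossE (f : nat -> nat -> R) a m : (forall a m, 0 <= f a m) ->
  loss f a m = ((a%:R * f a m)%:E * arms f)%E.
Proof.
move=> f0; rewrite armsE// genfunE -dsumZ; last exact: gterm_ge0.
by apply: eq_dsum => a' m' _ _; rewrite /gterm !expr1n !mulr1; ring.
Qed.

Lemma primitive_right_measurable (f phi : R -> R) : primitive f phi ->
  measurable_fun (`[0, +oo[ : set R) f.
Proof.
move=> hf; apply: measurable_realfun.subspace_continuous_measurable_fun => //.
apply/subspace_continuousP => x /=; rewrite in_itv/= andbT => x0.
have x1 : 0 <= x + 1 by rewrite addr_ge0.
have := (@subspace_continuousP _ `[0, x + 1] _ f).1 (primitive_continuous x1 hf) x.
rewrite /= in_itv/= x0 lerDl ler01 => /(_ isT) h.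
move=> S /h; rewrite /within/= => hS.
have Wx : nbhs x [set y | y < x + 1] by apply: lt_nbhsl; rewrite ltrDl.
apply: filterS2 Wx hS => y yx hy; rewrite in_itv/= andbT => y0.
by apply: hy; rewrite in_itv/= y0 ltW.
Qed.

Lemma primitive_bounds (f phi : R -> R) (u v : R) s t : primitive f phi -> 0 <= s -> s <= t ->
  (forall r, s < r -> r <= t -> u <= phi r <= v) ->
  u * (t - s) <= f t - f s <= v * (t - s).
Proof.
move=> h s0 st huv; rewrite (primitiveB h s0 st).
have ic (x : R) := integrable_cst_itv s t x.
have ip := primitive_integrable h s0 st.
have mi := measurable_itv `]s, t].
have e (x : R) : x * (t - s) = \int[@lebesgue_measure R]_(r in `]s, t]) x.
  by rewrite Rintegral_cst// fine_lebesgue_itv.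
rewrite (e u) (e v); apply/andP; split.
  apply: le_Rintegral; [exact: mi|exact: ic|exact: ip|] => r /=; rewrite in_itv/= => /andP[sr rt].
  by have /andP[] := huv r sr rt.
apply: le_Rintegral; [exact: mi|exact: ip|exact: ic|] => r /=; rewrite in_itv/= => /andP[sr rt].
by have /andP[] := huv r sr rt.
Qed.

Lemma ler_sqr2 x y : 0 <= x -> x <= y -> x ^+ 2 <= y ^+ 2.
Proof. by move=> x0 xy; rewrite lerXn2r// nnegrE// (le_trans x0). Qed.

End Scaling.

(** * Existence *)

Section Existence.
Variable R : realType.
Variable c : nat -> nat -> R.
Hypothesis c_ge0 : forall a m, 0 <= c a m.
Hypothesis c_0 : forall a, c a 0 = 0.
Hypothesis mass : (total_mass c < +oo)%E.
Hypothesis arms_gt0 : (0 < arms c)%E.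
Implicit Types (s t b x y : R) (a m : nat).
Local Notation mu := (@lebesgue_measure R).
Local Notation M := (envelope c).
Local Notation g := (slope c).
Local Notation B := (btime c).

Definition invalpha t := M (B t).
Local Notation P := invalpha.

Let BP t (t0 : 0 <= t) := btimeP c_ge0 t0.

Lemma btime_ge0 t : 0 <= t -> 0 <= B t. Proof. by move=> /BP[]. Qed.
Lemma invalpha_gt0 t : 0 <= t -> 0 < P t. Proof. by move=> /BP[]. Qed.
Lemma invalpha_ge0 t : 0 <= t -> 0 <= P t. Proof. by move=> /invalpha_gt0/ltW. Qed.
Lemma invalpha0 : P 0 = 1. Proof. by rewrite /P btime0// envelope0. Qed.

Lemma invalpha_ni s t : 0 <= s -> s <= t -> P t <= P s.
Proof. by move=> s0 st; apply: envelope_ni => //; [exact: btime_ge0|exact: btime_le]. Qed.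

Lemma invalpha_lt s t : 0 <= s -> s < t -> P t < P s.
Proof.
move=> s0 st; apply: envelope_lt => //; [exact: btime_ge0|exact: btime_lt|].
by apply: invalpha_gt0; rewrite (le_trans s0)// ltW.
Qed.

Lemma invalpha_le1 t : 0 <= t -> P t <= 1.
Proof. by move=> t0; rewrite -invalpha0 invalpha_ni. Qed.

Lemma btime_cvg0 : B s @[s --> 0^'+] --> (0 : R).
Proof.
apply/cvgrPdist_le => e e0; near=> s.
have s0 : 0 <= s by apply/ltW; near: s; exact: nbhs_right_gt.
have se : s <= e by near: s; exact: nbhs_right_le.
rewrite sub0r normrN ger0_norm ?btime_ge0//.
have := btime_sandwich c_ge0 (lexx 0) s0.
rewrite btime0// !subr0 envelope0// expr1n mul1r => /andP[_ h].
exact: le_trans h se.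
Unshelve. all: by end_near. Qed.

Lemma invalpha_cvg0 : P s @[s --> 0^'+] --> P 0.
Proof.
rewrite invalpha0 -(envelope0 c_ge0).
apply: (@cvg_comp _ _ _ B M (0^'+) (0^'+) _ _ (@envelope_cvg0 _ c c_ge0)).
move=> A /= [e e0 he]; near=> s; apply: he.
  rewrite /ball/= sub0r normrN; near: s.
  have /cvgrPdist_lt/(_ e e0) := btime_cvg0.
  by apply: filterS => s; rewrite sub0r normrN.
by rewrite (btime_gt0 c_ge0)//; near: s; exact: nbhs_right_gt.
Unshelve. all: by end_near. Qed.

Lemma primitive_btime : primitive B (fun t => P t ^+ 2).
Proof.
apply: primitive_sandwich.
- by move=> t _; exact: sqr_ge0.
- move=> s t s0 st; rewrite lerXn2r ?nnegrE ?invalpha_ge0 ?invalpha_ni ?(ltW s0)//.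
  by rewrite (le_trans _ st)// ltW.
- by move=> s t s0 st; apply: btime_sandwich => //; exact: ltW.
- by rewrite btime0//; exact: btime_cvg0.
Qed.

Lemma slope_btime_ni s t : 0 < s -> s <= t -> g (B t) <= g (B s).
Proof.
move=> s0 st; apply: slope_ni => //; [exact: (btime_gt0 c_ge0)|apply: btime_le => //; exact: ltW|].
by apply: invalpha_gt0; rewrite (le_trans _ st)// ltW.
Qed.

Lemma slope_btime_gt0 t : 0 < t -> 0 < g (B t).
Proof. by move=> t0; apply: slope_gt0 => //; [exact: (btime_gt0 c_ge0)|apply: invalpha_gt0; exact: ltW]. Qed.

(** A chain rule for M composed with [btime] that does not differentiate M: the tangents at the two
    ends enclose the increment of M, and [btime_sandwich] that of the inner function. *)
Lemma primitive_invalpha : primitive P (fun t => - (g (B t) * P t ^+ 2)).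
Proof.
have h : primitive (fun t => - P t) (fun t => g (B t) * P t ^+ 2).
  apply: primitive_sandwich.
  - by move=> t t0; rewrite mulr_ge0 ?sqr_ge0// ltW// slope_btime_gt0.
  - move=> s t s0 st; have t0 := lt_le_trans s0 st.
    apply: ler_pM; rewrite ?sqr_ge0 ?slope_btime_ni ?(ltW (slope_btime_gt0 _))//.
    by rewrite lerXn2r ?nnegrE ?invalpha_ge0 ?invalpha_ni ?(ltW s0) ?(ltW t0).
  - move=> s t s0 st; have t0 := lt_le_trans s0 st.
    rewrite (_ : - P t - - P s = P s - P t); last by ring.
    have /andP[h1 h2] := btime_sandwich c_ge0 (ltW s0) st.
    have t1 := envelope_tangent c_ge0 c_0 mass (btime_gt0 c_ge0 s0) (invalpha_gt0 (ltW s0)) (ltW (btime_gt0 c_ge0 t0)).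
    have t2 := envelope_tangent c_ge0 c_0 mass (btime_gt0 c_ge0 t0) (invalpha_gt0 (ltW t0)) (ltW (btime_gt0 c_ge0 s0)).
    have k1 : g (B t) * (B t - B s) <= P s - P t.
      move: t2; rewrite -!/(P _); move: (P s) (P t) (B s) (B t) (g (B t)) => p q u v w; clear; lra.
    have k2 : P s - P t <= g (B s) * (B t - B s).
      move: t1; rewrite -!/(P _); move: (P s) (P t) (B s) (B t) (g (B s)) => p q u v w; clear; lra.
    rewrite -!(mulrA (g _)); apply/andP; split.
      exact: le_trans (ler_wpM2l (ltW (slope_btime_gt0 t0)) h1) k1.
    exact: le_trans k2 (ler_wpM2l (ltW (slope_btime_gt0 s0)) h2).
  - by apply: cvgN; exact: invalpha_cvg0.
by apply: primitive_ext (primitiveZ (-1) h) => t _; ring.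
Qed.

Definition armsR t := g (B t) * P t.
Local Notation A := armsR.

Lemma armsR_gt0 t : 0 < t -> 0 < A t.
Proof. by move=> t0; rewrite mulr_gt0 ?slope_btime_gt0// invalpha_gt0// ltW. Qed.

Lemma armsR_integrable t : 0 <= t -> mu.-integrable `]0, t] (EFin \o A).
Proof.
move=> t0.
have cP : {within `[0, t], continuous (fun s => (P s)^-1)}.
  apply/subspace_continuousP => s /=; rewrite in_itv/= => /andP[s0 st].
  apply: cvgV; first by rewrite gt_eqF// invalpha_gt0.
  have := (@subspace_continuousP _ `[0, t] _ P).1 (primitive_continuous t0 primitive_invalpha) s.
  by apply; rewrite /= in_itv/= s0.
have ih := continuous_integrableM t0 cP (primitive_integrable primitive_invalpha (lexx 0) t0).
apply: eq_integrable (integrableZl _ (-1) ih) => // s; rewrite inE/= in_itv/= => /andP[s0 st].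
have Ps : P s != 0 by rewrite gt_eqF// invalpha_gt0// ltW.
by rewrite -EFinM /A; congr (_%:E); field.
Qed.

Definition logalpha t := \int[mu]_(s in `]0, t]) A s.

Lemma primitive_logalpha : primitive logalpha A.
Proof.
move=> t t0; split; first exact: armsR_integrable.
by rewrite /logalpha [X in X + _](_ : _ = 0) ?add0r// set_itvoc0 Rintegral_set0.
Qed.

(** The consistency condition of the construction: P times the exponential of the integral of A = g
    P has derivative 0, because P' = - g P^2. *)
Lemma expR_logalpha t : 0 <= t -> expR (logalpha t) = (P t)^-1.
Proof.
move=> t0.
have h := primitiveM primitive_invalpha (primitive_expR primitive_logalpha).
have h0 : primitive (fun t => P t * expR (logalpha t)) (fun=> 0).
  by apply: primitive_ext h => s s0 //; rewrite /A; ring.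
have [_] := h0 t t0.
rewrite Rintegral_cst// mul0r addr0 invalpha0 mul1r {2}/logalpha set_itvoc0 Rintegral_set0 expR0 => e.
by rewrite -[RHS]mulr1 -e mulKf// gt_eqF// invalpha_gt0.
Qed.

Lemma primitive_invalphaV : primitive (fun t => (P t)^-1) (fun t => g (B t)).
Proof.
apply: primitive_ext (primitive_expR primitive_logalpha) => t t0.
  exact: expR_logalpha.
by rewrite expR_logalpha ?ltW// /A mulrC mulfK// gt_eqF// invalpha_gt0// ltW.
Qed.

Definition sol t a m := P t ^+ a * evol c (B t) a m.

Lemma sol_ge0 t a m : 0 <= t -> 0 <= sol t a m.
Proof. by move=> t0; rewrite mulr_ge0 ?exprn_ge0 ?invalpha_ge0 ?evol_ge0 ?btime_ge0. Qed.

Lemma sol_init a m : sol 0 a m = c a m.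
Proof. by rewrite /sol invalpha0 expr1n mul1r btime0// evol_0. Qed.

Lemma genfun_sol t x y : 0 <= t -> 0 <= x -> 0 <= y ->
  genfun (sol t) x y = ((P t)%:E * genfun (evol c (B t)) (x * P t) y)%E.
Proof.
by move=> t0 x0 y0; apply: genfun_scale => //; [move=> a m; apply: evol_ge0 => //; exact: btime_ge0|exact: invalpha_ge0].
Qed.

Lemma arms_sol t : 0 < t -> arms (sol t) = (A t)%:E.
Proof.
move=> t0; rewrite armsE; last by move=> a m; apply: sol_ge0; exact: ltW.
rewrite genfun_sol ?ltW// mul1r.
have [-> _ _ _] := slope_spec c_ge0 c_0 mass (btime_gt0 c_ge0 t0) (invalpha_gt0 (ltW t0)).
by rewrite -EFinM mulrC.
Qed.

Lemma arms_sol0 : arms (sol 0) = arms c.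
Proof. by apply: eq_dsum => a m _ _; rewrite sol_init. Qed.

(** In the derivative of P ^ a times a polynomial in B, the first factor yields the loss, as P' = -
    A P, and the second the gain, as B' = P^2. *)
Lemma primitive_sol a m : primitive (fun t => sol t a m)
  (fun t => gain (sol t) a m - a%:R * sol t a m * A t).
Proof.
have h := primitiveM (primitiveX a primitive_invalpha) (primitive_horner (evolution c a m) primitive_btime).
apply: primitive_ext h => t t0 //.
rewrite gain_scale evolution_gain// /sol /A exprD -/(evol c (B t) a m).
by case: a => [|a]/=; rewrite ?mul0r ?expr0 ?exprS; ring.
Qed.

Let AN N t := tri N (fun a m => a%:R * sol t a m).

Lemma tri_arms_le N t : 0 < t -> AN N t <= A t.
Proof.
move=> t0; have s0 a m : 0 <= a%:R * sol t a m by rewrite mulr_ge0// sol_ge0// ltW.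
rewrite -lee_fin -arms_sol//; apply: le_trans (psum_le_dsum 0 N.+1 s0).
by rewrite lee_fin tri_le_psum.
Qed.

Lemma tri_arms_cvg t : 0 < t -> (A t * AN N t)%:E @[N --> \oo] --> (A t ^+ 2)%:E.
Proof.
move=> t0; apply: cvg_EFin; first exact: nearW.
rewrite expr2; apply: cvgM; first exact: cvg_cst.
have s0 a m : 0 <= a%:R * sol t a m by rewrite mulr_ge0// sol_ge0// ltW.
apply/cvgrPdist_le => e e0.
have [L hL] := gee0_dsum_approx s0 (arms_sol t0) e0.
near=> N.
have LN : (L + L <= N)%N by near: N; exact: nbhs_infty_ge.
rewrite ger0_norm ?subr_ge0 ?tri_arms_le// lerBlDr -lerBlDl.
apply: le_trans (ltW hL) (le_trans (psum_le_tri _ s0) _).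
exact: tri_nd.
Unshelve. all: by end_near. Qed.

Lemma primitive_tri_arms N : exists phi, primitive (AN N) phi.
Proof.
eexists; apply: primitive_tri => a m; apply: primitiveZ; exact: primitive_sol.
Qed.

Lemma total_mass_fin : exists m0 : R, total_mass c = m0%:E.
Proof.
exists (fine (total_mass c)); rewrite fineK// ge0_fin_numE//.
by apply: dsum_ge0 => a m; rewrite mul1r.
Qed.

(** Particle balance on a triangle: the gain is at most half the square of the truncated arms,
    itself at most half of their product with A, whereas the loss is the full product. Integrating
    leaves at most the initial number of particles. *)
Lemma integral_tri_arms_le N t : 0 <= t ->
  mu.-integrable `]0, t] (EFin \o (fun s => A s * AN N s)) /\
  \int[mu]_(s in `]0, t]) (A s * AN N s) <= 2 * fine (total_mass c).
Proof.
move=> t0; have [phi hphi] := primitive_tri_arms N.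
have iA : mu.-integrable `]0, t] (EFin \o (fun s => A s * AN N s)).
  apply: eq_integrable (primitive_integrableM hphi t0 (armsR_integrable t0)) => //.
  by move=> s _ /=; rewrite mulrC.
split => //.
have h := primitive_tri N primitive_sol.
have eD := primitiveB h (lexx 0) t0.
have D0 : tri N (sol 0) <= fine (total_mass c).
  have [m0 em] := total_mass_fin; rewrite em /= -lee_fin -em.
  have c0' a m : 0 <= 1 * c a m by rewrite mul1r.
  apply: le_trans (psum_le_dsum 0 N.+1 c0'); rewrite lee_fin.
  apply: le_trans (tri_le_psum _ _) _; first by move=> a m; exact: sol_ge0.
  by apply: ler_psum => a m _ _; rewrite mul1r sol_init.
have Dt : 0 <= tri N (sol t) by apply: tri_ge0 => a m; exact: sol_ge0.
have : tri N (sol t) - tri N (sol 0) <= \int[mu]_(s in `]0, t]) (- 2^-1 * (A s * AN N s)).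
  rewrite eD; apply: le_Rintegral => //.
  - exact: (primitive_integrable h).
  - exact: eq_integrable (integrableZl _ (- 2^-1) iA).
  move=> s /=; rewrite in_itv/= => /andP[s0 _].
  have -> : tri N (fun a m => gain (sol s) a m - a%:R * sol s a m * A s) =
    tri N (gain (sol s)) - A s * AN N s.
    rewrite -mulNr /AN -triZ /tri /psum -big_split/=; apply: eq_bigr => a _.
    rewrite -big_split/=; apply: eq_bigr => m _; case: ifP => _; ring.
  have g1 := @tri_gain_le R N (sol s) (fun a m => sol_ge0 a m (ltW s0)).
  have : AN N s ^+ 2 <= A s * AN N s.
    rewrite expr2 ler_wpM2r ?tri_arms_le//; apply: tri_ge0 => a m.
    by rewrite mulr_ge0// sol_ge0// ltW.
  exact: half_bound.
rewrite RintegralZl//; exact: half_bound_double.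
Qed.

(** The bound on the truncated integrals is uniform in N, and monotone convergence removes the
    truncation. *)
Lemma arms_sqr_integral t : 0 <= t ->
  (\int[mu]_(s in `]0%R, t]) (arms (sol s) ^+ 2) <= (2 * fine (total_mass c))%:E)%E.
Proof.
move=> t0.
have -> : (\int[mu]_(s in `]0%R, t]) (arms (sol s) ^+ 2) =
    \int[mu]_(s in `]0%R, t]) limn (fun N => (A s * AN N s)%:E))%E.
  apply: eq_integral => s; rewrite inE/= in_itv/= => /andP[s0 _].
  rewrite arms_sol//; apply/esym/cvg_lim => //; exact: tri_arms_cvg.
rewrite monotone_convergence//.
- apply: lime_le.
    apply: ereal_nondecreasing_is_cvgn => n n' nn; apply: ge0_le_integral => //.
    + move=> s /=; rewrite in_itv/= => /andP[s0 _].
      by rewrite lee_fin mulr_ge0 ?(ltW (armsR_gt0 _))// tri_ge0// => a m; rewrite mulr_ge0// sol_ge0// ltW.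
    + by have [/integrableP[]] := integral_tri_arms_le n t0.
    + by have [/integrableP[]] := integral_tri_arms_le n' t0.
    move=> s /=; rewrite in_itv/= => /andP[s0 _].
    rewrite lee_fin ler_wpM2l ?(ltW (armsR_gt0 _))// tri_nd// => a m.
    by rewrite mulr_ge0// sol_ge0// ltW.
  apply: nearW => N; have [iA hA] := integral_tri_arms_le N t0.
  rewrite -[leLHS]fineK; first by rewrite lee_fin.
  exact: (integrable_fin_num _ iA).
- by move=> n; have [/integrableP[]] := integral_tri_arms_le n t0.
- move=> n s /=; rewrite in_itv/= => /andP[s0 _].
  by rewrite lee_fin mulr_ge0 ?(ltW (armsR_gt0 _))// tri_ge0// => a m; rewrite mulr_ge0// sol_ge0// ltW.
move=> s /=; rewrite in_itv/= => /andP[s0 _] n n' nn.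
rewrite lee_fin ler_wpM2l ?(ltW (armsR_gt0 _))// tri_nd// => a m.
by rewrite mulr_ge0// sol_ge0// ltW.
Qed.

Lemma primitive_gain a m : exists phi, primitive (fun t => gain (sol t) a m) phi.
Proof.
eexists; apply: primitive_ext (primitiveM (primitiveX (a + 2) primitive_invalpha)
  (primitive_horner (evolution c a m)^`() primitive_btime)) => // t t0.
by rewrite gain_scale evolution_gain.
Qed.

Lemma sol_eq t a m : 0 <= t -> (0 < m)%N ->
  ((sol t a m)%:E = (c a m)%:E
     + \int[mu]_(s in `[0%R, t]) (gain (sol s) a m)%:E
     - \int[mu]_(s in `[0%R, t]) loss (sol s) a m)%E.
Proof.
move=> t0 m0; have [phi hphi] := primitive_gain a m.
have ig : mu.-integrable `]0, t] (EFin \o (fun s => gain (sol s) a m)).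
  apply: eq_integrable (primitive_integrableM hphi t0 (integrable_cst_itv 0 t 1)) => //.
  by move=> s _ /=; rewrite mulr1.
have il : mu.-integrable `]0, t] (EFin \o (fun s => a%:R * sol s a m * A s)).
  exact: (primitive_integrableM (primitiveZ a%:R (primitive_sol a m)) t0 (armsR_integrable t0)).
have lE s : s \in (`]0, t]%classic : set R) -> loss (sol s) a m = (a%:R * sol s a m * A s)%:E.
  rewrite inE/= in_itv/= => /andP[s0 _].
  by rewrite lossE ?arms_sol// => a' m'; apply: sol_ge0; exact: ltW.
(* Time 0 is removed from the integrals, since the number of arms may be infinite there. *)
rewrite -(@integral_itv_obnd_cbnd _ 0 (BRight t) (fun s => (gain (sol s) a m)%:E)); last first.
  by case/integrableP : ig.
rewrite -(@integral_itv_obnd_cbnd _ 0 (BRight t) (fun s => loss (sol s) a m)); last first.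
  by case/integrableP : il => + _; apply: eq_measurable_fun => s /lE ->.
have -> : (\int[mu]_(s in `]0%R, t]) loss (sol s) a m =
  \int[mu]_(s in `]0%R, t]) (a%:R * sol s a m * A s)%:E)%E by exact: eq_integral.
have fg := integrable_fin_num _ ig; have fl := integrable_fin_num _ il.
have [_ ->] := primitive_sol a m t0.
rewrite sol_init RintegralB// EFinD EFinB /Rintegral !fineK//; first by rewrite addeA.
- exact: (integrable_fin_num _ il).
- exact: (integrable_fin_num _ ig).
Qed.

Lemma sol_integrable t : 0 < t ->
  (\int[mu]_(s in `[0%R, t]) (arms (sol s) ^+ 2) < +oo)%E.
Proof.
move=> t0; rewrite -(@integral_itv_obnd_cbnd _ 0 (BRight t) (fun s => (arms (sol s) ^+ 2)%E)).
  by apply: le_lt_trans (arms_sqr_integral (ltW t0)) (ltry _).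
have /integrableP[mA _] := armsR_integrable (ltW t0).
apply: (eq_measurable_fun (fun s => (A s ^+ 2)%:E)).
  by move=> s; rewrite inE/= in_itv/= => /andP[s0 _]; rewrite arms_sol.
by apply/measurable_EFinP; apply: measurable_funX; apply/measurable_EFinP.
Qed.

Lemma alpha_sol t : 0 <= t -> alpha sol t = (P t)^-1.
Proof.
move=> t0; rewrite -expR_logalpha// /alpha; congr expR.
have /integrableP[mA _] := armsR_integrable t0.
have aE s : s \in (`]0, t]%classic : set R) -> arms (sol s) = (A s)%:E.
  by rewrite inE/= in_itv/= => /andP[s0 _]; rewrite arms_sol.
rewrite -(@integral_itv_obnd_cbnd _ 0 (BRight t) (fun s => arms (sol s))); last first.
  by apply: eq_measurable_fun mA => s /aE ->.
by congr fine; exact: eq_integral.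
Qed.

Lemma beta_sol t : 0 <= t -> beta sol t = B t.
Proof.
move=> t0; have [ip ->] := primitive_btime t0.
rewrite btime0// add0r /beta -Rintegral_itv_obnd_cbnd.
  apply: eq_Rintegral => s; rewrite inE/= in_itv/= => /andP[s0 _].
  by rewrite alpha_sol ?ltW// div1r exprVn invrK.
apply: eq_integrable ip => // s; rewrite inE/= in_itv/= => /andP[s0 _].
by rewrite /= alpha_sol ?ltW// div1r exprVn invrK.
Qed.

End Existence.

(** * Uniqueness *)

Section Clip.
Variable R : realType.
Implicit Types (f c : nat -> nat -> R).

(* Replaces the irrelevant values at m = 0 by 0. *)
Definition clip f a m : R := if (0 < m)%N then f a m else 0.

Lemma clipE f a m : (0 < m)%N -> clip f a m = f a m.
Proof. by rewrite /clip => ->. Qed.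

Lemma clip_ge0 f : (forall a m, (0 < m)%N -> 0 <= f a m) -> forall a m, 0 <= clip f a m.
Proof. by move=> f0 a m; rewrite /clip; case: ifP => // /f0. Qed.

Lemma pairing_clip f (w : nat -> nat -> R) : pairing (clip f) w = pairing f w.
Proof. by apply: eq_dsum => a m _ m0; rewrite clipE. Qed.

Lemma genfun_clip f x y : genfun (clip f) x y = genfun f x y.
Proof. by apply: eq_dsum => a m _ m0; rewrite clipE. Qed.

Lemma genfun1_clip f : genfun1 (clip f) = genfun1 f.
Proof. by apply/funext => x; rewrite /genfun1 genfun_clip. Qed.

Lemma eq_gain f f' a m : (forall a' m', (0 < m')%N -> (m' < m)%N -> f a' m' = f' a' m') ->
  gain f a m = gain f' a m.
Proof.
move=> ff; rewrite /gain; congr (_ * _); apply: eq_bigr => a' _.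
by apply: eq_big_nat => m' /andP[m0 m'm]; rewrite !ff//; lia.
Qed.

Lemma gain_clip f a m : gain (clip f) a m = gain f a m.
Proof. by apply: eq_gain => a' m' m0 _; rewrite clipE. Qed.

Lemma loss_clip f a m : (0 < m)%N -> loss (clip f) a m = loss f a m.
Proof. by move=> m0; apply: eq_dsum => a' m' _ m'0; rewrite !clipE. Qed.

Lemma solution_clip c (d : R -> nat -> nat -> R) : smoluchowski_solution c d ->
  smoluchowski_solution (clip c) (fun t => clip (d t)).
Proof.
move=> [h0 hi hm hint heq hmom]; split.
- by move=> t a m t0 m0; rewrite clipE// h0.
- by move=> a m m0; rewrite !clipE// hi.
- move=> a m m0; rewrite (_ : (fun s => _) = (fun s => d s a m)); first exact: hm.
  by apply/funext => s; rewrite clipE.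
- by move=> t t0; under eq_integral do rewrite /arms pairing_clip; exact: hint.
- move=> t a m t0 m0; rewrite (clipE (d t) a m0) (clipE c a m0) (heq t a m t0 m0); congr (_ + _ - _)%E.
  + by apply: eq_integral => s _; rewrite gain_clip.
  + by apply: eq_integral => s _; rewrite loss_clip.
- rewrite /moment2 pairing_clip => /hmom[K hK]; exists K.
  by apply: filterS hK => t; rewrite /moment2 pairing_clip.
Qed.

End Clip.

(** * Measurability and comparison of increments *)

Section MeasurableSums.
Variable R : realType.

Lemma measurable_nneseries (D : set R) N (h : nat -> R -> \bar R) :
  (forall k x, D x -> (0 <= h k x)%E) ->
  (forall k, (N <= k)%N -> measurable_fun D (h k)) ->
  measurable_fun D (fun x => (\sum_(N <= k <oo) h k x)%E).
Proof.
move=> h0 mh.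
apply: (eq_measurable_fun (fun x => (\sum_(0 <= i <oo | i \in [pred i | (N <= i)%N]) h i x)%E)).
  by move=> x _; rewrite [RHS]eseries_cond; apply: eq_eseriesl => i; rewrite inE.
apply: ge0_emeasurable_sum => //; first by move=> k x Dx _; exact: h0.
Qed.

Lemma measurable_dsum (D : set R) N (f : R -> nat -> nat -> R) :
  (forall s a m, D s -> 0 <= f s a m) ->
  (forall a m, (0 < m)%N -> measurable_fun D (fun s => f s a m)) ->
  measurable_fun D (fun s => dsum N (f s)).
Proof.
move=> f0 mf; apply: measurable_nneseries.
  by move=> a s Ds; apply: nneseries_ge0 => m _ _; rewrite lee_fin f0.
move=> a _; apply: measurable_nneseries; first by move=> m s Ds; rewrite lee_fin f0.
by move=> m m0; apply/measurable_EFinP; exact: mf.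
Qed.

(** Both x and y lie between z / p and z / q, with p >= q >= w. *)
Lemma clock_ratio (x y z p q w : R) : q * x <= z -> z <= p * x -> q * y <= z -> z <= p * y ->
  w <= q -> q <= p -> 0 <= y -> 0 < w -> w * `|x - y| <= (p - q) * y.
Proof.
move=> h1 h2 h3 h4 wq qp y0 w0.
have q0 : 0 < q by exact: lt_le_trans wq.
have p0 : 0 < p by exact: lt_le_trans qp.
apply: (@le_trans _ _ (q * `|x - y|)); first by rewrite ler_wpM2r.
have [xy|yx] := leP y x.
  rewrite ger0_norm ?subr_ge0//; lra.
rewrite ler0_norm ?subr_le0 ?(ltW yx)//.
have h5 : q * (y - x) <= p * (y - x) by rewrite ler_wpM2r// subr_ge0 ltW.
lra.
Qed.

Lemma subr_le_swap (p q u v : R) : p - q <= u - v -> v - q <= u - p.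
Proof. by lra. Qed.

Lemma increment_bound (p q x y z w b b' : R) : x - y <= z * (b' - b) ->
  q - (b - b') * w <= p -> q - y - (p - x) <= (- w - - z) * (b' - b).
Proof. by lra. Qed.

(** A failure F s < F t persists at times slightly later than s, by continuity. So the decrease has
    to be checked only from positive times, with F positive at both ends. *)
Lemma barrier_closed (F : R -> R) b : 0 <= b -> {within `[0, b], continuous F} -> F 0 <= 0 ->
  (forall s t, 0 < s -> s <= t -> t <= b ->
    (forall r, s <= r -> r <= t -> 0 < F r) -> F t <= F s) ->
  F b <= 0.
Proof.
move=> b0 cF F0 hF; apply: (@barrier _ F b) => // s t s0 st tb Fpos.
rewrite leNgt; apply/negP => Fst.
have st' : s < t by rewrite lt_neqAle st andbT; apply/eqP => e; rewrite e ltxx in Fst.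
have := (@subspace_continuousP _ `[0, b] _ F).1 cF s.
rewrite /= in_itv/= s0 (le_trans st)// => /(_ isT) /(_ [set v | v < F t] (lt_nbhsl Fst)).
rewrite /within/= => /nbhs_ballP[e /= e0 he].
set u := Num.min (s + e / 2) t.
have su : s < u by rewrite lt_min st' andbT ltrDl divr_gt0.
have ut : u <= t by rewrite ge_min lexx orbT.
have : F u < F t.
  apply: he; last by rewrite in_itv/= (le_trans s0 (ltW su)) (le_trans ut).
  rewrite /ball/= distrC ger0_norm ?subr_ge0 ?(ltW su)// ltrBlDl gt_min ltrD2l.
  by rewrite ltr_pdivrMr// ltr_pMr// ltr1n.
rewrite ltNge hF//; first exact: le_lt_trans su.
by move=> r ur rt; apply: Fpos => //; exact: lt_le_trans ur.
Qed.

End MeasurableSums.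

(** * Every solution is a rescaling of the Burgers evolution *)

Section Uniqueness.
Variable R : realType.
Variable c : nat -> nat -> R.
Hypothesis c_ge0 : forall a m, 0 <= c a m.
Hypothesis c_0 : forall a, c a 0 = 0.
Hypothesis mass : (total_mass c < +oo)%E.
Hypothesis arms_gt0 : (0 < arms c)%E.
Variable d : R -> nat -> nat -> R.
Hypothesis d_sol : smoluchowski_solution c d.
Hypothesis d_0 : forall t a, d t a 0 = 0.
Implicit Types (r s t b x y : R) (a m : nat).
Local Notation mu := (@lebesgue_measure R).
Local Notation M := (envelope c).
Local Notation g := (slope c).

Lemma d_ge0 t a m : 0 <= t -> 0 <= d t a m.
Proof. by move=> t0; case: m => [|m]; [rewrite d_0|apply: (solution_ge0 d_sol)]. Qed.

Let ad_ge0 t a m : 0 <= t -> 0 <= a%:R * d t a m.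
Proof. by move=> t0; rewrite mulr_ge0// d_ge0. Qed.

Lemma arms_d_ge0 t : 0 <= t -> (0 <= arms (d t))%E.
Proof. by move=> t0; apply: dsum_ge0 => a m; exact: ad_ge0. Qed.

Lemma measurable_arms_d : measurable_fun (`[0, +oo[ : set R) (fun s => arms (d s)).
Proof.
apply: measurable_dsum.
  by move=> s a m /=; rewrite in_itv/= andbT => s0; exact: ad_ge0.
by move=> a m m0; apply: measurable_funM => //; exact: (solution_measurable d_sol).
Qed.

Lemma measurable_armsq : measurable_fun (`[0, +oo[ : set R) (fun s => (arms (d s) ^+ 2)%E).
Proof.
apply: (eq_measurable_fun (fun s => arms (d s) * arms (d s))%E) => //.
by apply: emeasurable_funM; exact: measurable_arms_d.
Qed.

Lemma subset_oc_cy s t : 0 <= s -> `]s, t]%classic `<=` (`[0, +oo[%classic : set R).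
Proof.
by move=> s0 r /=; rewrite !in_itv/= andbT => /andP[sr _]; rewrite (le_trans s0)// ltW.
Qed.

Let armsq s := (arms (d s) ^+ 2)%E.

Lemma integrable_armsq t : 0 <= t -> mu.-integrable `]0, t] armsq.
Proof.
move=> t0; have mD : measurable_fun (`]0, t] : set R) armsq.
  by apply: measurable_funS measurable_armsq => //; exact: subset_oc_cy.
apply/integrableP; split => //.
have [->|t0'] := eqVneq t 0; first by rewrite set_itvoc0 integral_set0.
have tpos : 0 < t by rewrite lt_neqAle eq_sym t0'.
have -> : (\int[mu]_(x in `]0%R, t]) `|armsq x| = \int[mu]_(x in `]0%R, t]) armsq x)%E.
  apply: eq_integral => s; rewrite inE/= in_itv/= => /andP[/ltW s0 _].
  by rewrite gee0_abs// /armsq expe_ge0// arms_d_ge0.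
rewrite integral_itv_obnd_cbnd//.
exact: (solution_integrable d_sol tpos).
Qed.

Definition armsfin s := fine (arms (d s)).
Local Notation A := armsfin.

Lemma armsfin_ge0 s : 0 <= s -> 0 <= A s.
Proof. by move=> s0; rewrite fine_ge0// arms_d_ge0. Qed.

Lemma armsfin_le s : 0 <= s -> ((A s)%:E <= arms (d s))%E.
Proof.
move=> s0; rewrite /A; have := arms_d_ge0 s0.
by case: (arms (d s)) => [r||] //=; rewrite leey.
Qed.

Lemma measurable_armsfin : measurable_fun (`[0, +oo[ : set R) A.
Proof. by apply: measurableT_comp => //; exact: measurable_arms_d. Qed.

Lemma arms_le_armsq s : 0 <= s -> (arms (d s) <= 1 + armsq s)%E.
Proof.
move=> s0; rewrite /armsq; have := arms_d_ge0 s0.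
case: (arms (d s)) => [r||] // r0.
  rewrite -EFin_expe -EFinD lee_fin; have := sqr_ge0 (r - 1); rewrite lee_fin in r0; nra.
Qed.

Lemma integrable_arms t : 0 <= t -> mu.-integrable `]0, t] (fun s => arms (d s)).
Proof.
move=> t0; apply: (le_integrable _ _ _ (integrableD _ (integrable_cst_itv 0 t 1) (integrable_armsq t0))) => //.
  by apply: measurable_funS measurable_arms_d => //; exact: subset_oc_cy.
move=> s /=; rewrite in_itv/= => /andP[/ltW s0 _].
rewrite gee0_abs ?arms_d_ge0// gee0_abs ?arms_le_armsq//.
by rewrite adde_ge0// expe_ge0// arms_d_ge0.
Qed.

Lemma integrable_armsfin t : 0 <= t -> mu.-integrable `]0, t] (EFin \o A).
Proof.
move=> t0; apply: (le_integrable _ _ _ (integrable_arms t0)) => //.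
  apply/measurable_EFinP; apply: measurable_funS measurable_armsfin => //; exact: subset_oc_cy.
move=> s /=; rewrite in_itv/= => /andP[/ltW s0 _].
by rewrite (gee0_abs (arms_d_ge0 s0)) ger0_norm ?armsfin_le// armsfin_ge0.
Qed.

Lemma ae_arms s t : 0 <= s -> s <= t ->
  ae_eq mu (`]s, t]%classic : set R) (fun r => arms (d r)) (EFin \o A).
Proof.
move=> s0 st.
have i : mu.-integrable `]s, t] (fun r => arms (d r)).
  apply: integrableS (integrable_arms (le_trans s0 st)) => //.
  by apply: subset_itv; rewrite bnd_simp.
have := integrable_ae _ i; move=> /(_ (measurable_itv _)).
by apply: filterS => r h Dr /=; rewrite /A fineK// h.
Qed.

(* For a solution d: [dlogalpha] = log alpha, [dalphaV] = 1 / alpha and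
   [dbeta] = beta. *)
Definition dlogalpha t := \int[mu]_(s in `]0, t]) A s.

Lemma primitive_dlogalpha : primitive dlogalpha A.
Proof.
move=> t t0; split; first exact: integrable_armsfin.
by rewrite /dlogalpha [X in X + _](_ : _ = 0) ?add0r// set_itvoc0 Rintegral_set0.
Qed.

Definition dalphaV t := expR (- dlogalpha t).

Lemma primitive_dalphaV : primitive dalphaV (fun t => - (dalphaV t * A t)).
Proof.
have h := primitive_expR (primitiveZ (-1) primitive_dlogalpha).
by apply: primitive_ext h => t _; rewrite /dalphaV mulN1r//; ring.
Qed.

Lemma dalphaV_gt0 t : 0 < dalphaV t. Proof. exact: expR_gt0. Qed.

Lemma dalphaV_ge0 t : 0 <= dalphaV t. Proof. exact: expR_ge0. Qed.

Lemma dalphaV0 : dalphaV 0 = 1.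
Proof. by rewrite /dalphaV /dlogalpha set_itvoc0 Rintegral_set0 oppr0 expR0. Qed.

Lemma dalphaV_ni s t : 0 <= s -> s <= t -> dalphaV t <= dalphaV s.
Proof.
move=> s0 st; rewrite ler_expR lerN2 -subr_ge0 (primitiveB primitive_dlogalpha)//.
apply: Rintegral_ge0 => r /=; rewrite in_itv/= => /andP[sr _].
by rewrite armsfin_ge0// (le_trans s0)// ltW.
Qed.

Definition dbeta t := \int[mu]_(s in `]0, t]) (dalphaV s ^+ 2).

Lemma primitive_dbeta : primitive dbeta (fun t => dalphaV t ^+ 2).
Proof.
move=> t t0; split; last by rewrite /dbeta [X in X + _](_ : _ = 0) ?add0r// set_itvoc0 Rintegral_set0.
apply: eq_integrable (primitive_integrableM (primitive_sqr primitive_dalphaV) t0 (integrable_cst_itv 0 t 1)) => //.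
by move=> s _ /=; rewrite mulr1.
Qed.

Lemma dbeta0 : dbeta 0 = 0. Proof. by rewrite /dbeta set_itvoc0 Rintegral_set0. Qed.

Lemma dbeta_le s t : 0 <= s -> s <= t -> dbeta s <= dbeta t.
Proof.
move=> s0 st; rewrite -subr_ge0 (primitiveB primitive_dbeta)//.
by apply: Rintegral_ge0 => r _; exact: sqr_ge0.
Qed.

Lemma dbeta_ge0 t : 0 <= t -> 0 <= dbeta t.
Proof. by move=> t0; rewrite -dbeta0 dbeta_le. Qed.

Lemma dbeta_sandwich s t : 0 <= s -> s <= t ->
  dalphaV t ^+ 2 * (t - s) <= dbeta t - dbeta s <= dalphaV s ^+ 2 * (t - s).
Proof.
move=> s0 st; apply: (primitive_bounds primitive_dbeta s0 st) => r sr rt.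
apply/andP; split; apply: ler_sqr2.
- exact: dalphaV_ge0.
- by apply: dalphaV_ni rt; rewrite (le_trans s0)// ltW.
- exact: dalphaV_ge0.
- exact: dalphaV_ni s0 (ltW sr).
Qed.

Lemma dbeta_gt0 t : 0 < t -> 0 < dbeta t.
Proof.
move=> t0; have /andP[h _] := dbeta_sandwich (lexx 0) (ltW t0).
rewrite dbeta0 !subr0 in h; apply: lt_le_trans h.
by rewrite mulr_gt0// exprn_gt0// dalphaV_gt0.
Qed.

Lemma measurable_gain a m : measurable_fun (`[0, +oo[ : set R) (fun s => gain (d s) a m).
Proof.
rewrite /gain; apply: measurable_funM => //; apply: measurable_sum => a'.
pose D := (`[0, +oo[%classic : set R).
have md a0 m0 : measurable_fun D (fun s => d s a0 m0).
  case: m0 => [|m0]; last exact: (solution_measurable d_sol).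
  rewrite (_ : (fun s => d s a0 0) = cst 0); first exact: measurable_cst.
  by apply/funext => s; rewrite d_0.
by apply: measurable_sum => m'; do 2 (apply: measurable_funM => //).
Qed.

Lemma gain_ge0 s a m : 0 <= s -> 0 <= gain (d s) a m.
Proof.
move=> s0; rewrite /gain mulr_ge0 ?invr_ge0// sumr_ge0// => a' _; rewrite sumr_ge0// => m' _.
by rewrite !mulr_ge0 ?d_ge0.
Qed.

(** A single gain is one term of a triangular sum, to which [tri_gain_le] applies. *)
Lemma gain_le_armsq s a m : 0 <= s -> (0 < m)%N -> ((gain (d s) a m)%:E <= armsq s)%E.
Proof.
move=> s0 m0; rewrite /armsq; have := arms_d_ge0 s0; case E : (arms (d s)) => [r||] // r0; last first.
  by rewrite [leRHS](_ : _ = +oo%E) ?leey//; exact: mulyy.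
have ad := fun a m => ad_ge0 a m s0.
have h1 : tri (a + m) (fun a m => a%:R * d s a m) <= r.
  rewrite -lee_fin -E; apply: le_trans (psum_le_dsum 0 (a + m).+1 ad).
  by rewrite lee_fin tri_le_psum.
rewrite -EFin_expe lee_fin.
have h2 := @tri_gain_le R (a + m) (d s) (fun a m => d_ge0 a m s0).
have h3 : gain (d s) a m <= tri (a + m) (gain (d s)).
  have g0 a' m' : 0 <= (if (a' + m' <= a + m)%N then gain (d s) a' m' else 0).
    by case: ifP => // _; exact: gain_ge0.
  apply: le_trans (@psum_ge1 R 0 (a + m).+1 _ a m g0 _ _); first by rewrite leqnn.
  - by rewrite /= ltnS leq_addr.
  - by rewrite m0 ltnS leq_addl.
have t0 : 0 <= tri (a + m) (fun a m => a%:R * d s a m) by exact: tri_ge0.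
apply: le_trans h3 (le_trans h2 _).
have : tri (a + m) (fun a m => a%:R * d s a m) ^+ 2 <= r ^+ 2 by rewrite lerXn2r ?nnegrE// (le_trans t0).
have := sqr_ge0 r; lra.
Qed.

Lemma integrable_gain t a m : 0 <= t -> (0 < m)%N ->
  mu.-integrable `]0, t] (EFin \o (fun s => gain (d s) a m)).
Proof.
move=> t0 m0; apply: (le_integrable _ _ _ (integrable_armsq t0)) => //.
  apply/measurable_EFinP; apply: measurable_funS (measurable_gain a m) => //; exact: subset_oc_cy.
move=> s /=; rewrite in_itv/= => /andP[/ltW s0 _].
rewrite ger0_norm ?gain_ge0// gee0_abs ?gain_le_armsq//.
by rewrite expe_ge0// arms_d_ge0.
Qed.

Lemma term_le_arms s a m : 0 <= s -> (0 < m)%N -> ((a%:R * d s a m)%:E <= arms (d s))%E.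
Proof. by move=> s0 m0; apply: (@dsum_ge1 R 0 (fun a m => a%:R * d s a m)) => // a' m'; exact: ad_ge0. Qed.

Lemma loss_le_armsq s a m : 0 <= s -> (0 < m)%N -> (loss (d s) a m <= armsq s)%E.
Proof.
move=> s0 m0; rewrite lossE; last by move=> *; exact: d_ge0.
by apply: lee_wpmul2r; [exact: arms_d_ge0|exact: term_le_arms].
Qed.

Lemma measurable_loss a m : (0 < m)%N ->
  measurable_fun (`[0, +oo[ : set R) (fun s => loss (d s) a m).
Proof.
move=> m0; apply: (eq_measurable_fun (fun s => (a%:R * d s a m)%:E * arms (d s))%E).
  move=> s; rewrite inE/= in_itv/= andbT => s0; rewrite lossE// => a' m'; exact: d_ge0.
apply: emeasurable_funM; last exact: measurable_arms_d.
by apply/measurable_EFinP; apply: measurable_funM => //; exact: (solution_measurable d_sol).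
Qed.

Lemma integrable_loss t a m : 0 <= t -> (0 < m)%N ->
  mu.-integrable `]0, t] (fun s => loss (d s) a m).
Proof.
move=> t0 m0; apply: (le_integrable _ _ _ (integrable_armsq t0)) => //.
  by apply: measurable_funS (measurable_loss a m0) => //; exact: subset_oc_cy.
move=> s /=; rewrite in_itv/= => /andP[/ltW s0 _].
rewrite gee0_abs; last first.
  rewrite lossE; last by move=> *; exact: d_ge0.
  by rewrite mule_ge0 ?arms_d_ge0// lee_fin ad_ge0.
rewrite gee0_abs ?loss_le_armsq//.
by rewrite expe_ge0// arms_d_ge0.
Qed.

Lemma primitive_d a m : (0 < m)%N -> primitive (fun t => d t a m)
  (fun t => gain (d t) a m - a%:R * d t a m * A t).
Proof.
move=> m0 t t0.
have ig := integrable_gain a t0 m0; have il := integrable_loss a t0 m0.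
have aeq : ae_eq mu (`]0, t]%classic : set R) (fun s => loss (d s) a m)
    (EFin \o (fun s => a%:R * d s a m * A s)).
  have := ae_arms (lexx 0) t0; apply: filterS => s h Ds.
  have s0 : 0 <= s by move: Ds; rewrite /= in_itv/= => /andP[/ltW].
  by rewrite lossE ?h// => a' m'; exact: d_ge0.
have mA : measurable_fun (`]0, t] : set R) (fun s => a%:R * d s a m * A s).
  apply: measurable_funS (subset_oc_cy (lexx 0)) _ => //.
  apply: measurable_funM; last exact: measurable_armsfin.
  by apply: measurable_funM => //; exact: (solution_measurable d_sol).
have iA : mu.-integrable `]0, t] (EFin \o (fun s => a%:R * d s a m * A s)).
  apply: (le_integrable _ _ _ il) => //; first exact/measurable_EFinP.
  move=> s /=; rewrite in_itv/= => /andP[/ltW s0 _].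
  rewrite lossE; last by move=> *; exact: d_ge0.
  rewrite normrM EFinM abseM; apply: lee_pmul => //.
  by rewrite ger0_norm ?armsfin_ge0// gee0_abs ?arms_d_ge0// armsfin_le.
split; first exact: eq_integrable (integrableB _ ig iA).
have [->|t0'] := eqVneq t 0; first by rewrite set_itvoc0 Rintegral_set0 addr0.
have tpos : 0 < t by rewrite lt_neqAle eq_sym t0'.
have := solution_eq d_sol a tpos m0.
rewrite -(@integral_itv_obnd_cbnd _ 0 (BRight t) (fun s => (gain (d s) a m)%:E)); last first.
  by case/integrableP : ig.
rewrite -(@integral_itv_obnd_cbnd _ 0 (BRight t) (fun s => loss (d s) a m)); last first.
  by case/integrableP : il.
have ml : measurable_fun (`]0, t] : set R) (fun s => loss (d s) a m) by case/integrableP : il.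
have -> : (\int[mu]_(s in `]0%R, t]) loss (d s) a m =
    \int[mu]_(s in `]0%R, t]) (a%:R * d s a m * A s)%:E)%E.
  by apply: ae_eq_integral => //; exact/measurable_EFinP.
have fg := integrable_fin_num _ ig; have fl := integrable_fin_num _ iA.
rewrite (solution_init d_sol)// RintegralB// /Rintegral => e; apply: EFin_inj; rewrite e.
rewrite EFinD EFinB !fineK; first by rewrite addeA.
- exact: fl.
- exact: fg.
Qed.

(** Multiplying by alpha ^ a absorbs the loss, and the gain at mass m involves smaller masses only.
    By induction on the mass, both sides then have the same derivative and the same initial value,
    whatever alpha is. *)
Lemma d_evol a m t : 0 <= t -> d t a m = dalphaV t ^+ a * evol c (dbeta t) a m.
Proof.
elim/ltn_ind: m a t => -[_ a t t0|m IH a t t0].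
  by rewrite d_0 evol_m0 mulr0.
have h1 := primitiveM (primitive_expR (primitiveZ a%:R primitive_dlogalpha)) (primitive_d a (ltn0Sn m)).
have h2 := primitive_horner (evolution c a m.+1) primitive_dbeta.
have gE s : 0 <= s -> gain (d s) a m.+1 = dalphaV s ^+ (a + 2) * gain (evol c (dbeta s)) a m.+1.
  move=> s0; rewrite -gain_scale; apply: eq_gain => a' m' m'0 m'm.
  exact: IH.
have eE s : expR (a%:R * dlogalpha s) * dalphaV s ^+ a = 1.
  by rewrite /dalphaV -expRM_natl -expRD mulrN subrr expR0.
have h1' : primitive (fun s => expR (a%:R * dlogalpha s) * d s a m.+1)
    (fun s => (evolution c a m.+1)^`().[dbeta s] * dalphaV s ^+ 2).
  apply: primitive_ext h1 => // s s0; rewrite gE ?ltW// evolution_gain//.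
  transitivity ((expR (a%:R * dlogalpha s) * dalphaV s ^+ a) *
    (gain (evol c (dbeta s)) a m.+1 * dalphaV s ^+ 2)); last by rewrite eE mul1r.
  rewrite exprD; move: (expR _) (dalphaV s ^+ a) (dalphaV s ^+ 2) (gain _ _ _) (A s) (d _ _ _).
  by move=> e p q h y z; ring.
have [_ e1] := h1' t t0; have [_ e2] := h2 t t0.
have : expR (a%:R * dlogalpha t) * d t a m.+1 = (evolution c a m.+1).[dbeta t].
  rewrite e1 e2 dbeta0 (solution_init d_sol)// -[(_).[0]]/(evol c 0 a m.+1) evol_0//.
  by rewrite /dlogalpha set_itvoc0 Rintegral_set0 mulr0 expR0 mul1r.
rewrite /evol => <-; rewrite mulrA (mulrC (dalphaV t ^+ a)) eE mul1r.
by [].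
Qed.

Lemma arms_dE t : 0 <= t ->
  arms (d t) = ((dalphaV t)%:E * genfun (evol c (dbeta t)) (dalphaV t) 1)%E.
Proof.
move=> t0; rewrite armsE; last by move=> *; exact: d_ge0.
rewrite -{2}(mul1r (dalphaV t)) -genfun_scale//; last 2 first.
- by move=> a m; apply: evol_ge0 => //; exact: dbeta_ge0.
- exact: dalphaV_ge0.
by apply: eq_dsum => a m _ _; rewrite /gterm d_evol.
Qed.

Lemma dalphaV_drop s t : 0 <= s -> s <= t ->
  (dalphaV s - dalphaV t)%:E = (\int[mu]_(r in `]s, t]) ((dalphaV r)%:E * arms (d r)))%E.
Proof.
move=> s0 st.
have e : dalphaV s - dalphaV t = \int[mu]_(r in `]s, t]) (dalphaV r * A r).
  rewrite -opprB (primitiveB primitive_dalphaV s0 st).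
  have h := primitive_integrable primitive_dalphaV s0 st.
  rewrite -mulN1r -(RintegralZl (-1) _ h)//.
  by apply: eq_Rintegral => r _; rewrite mulN1r opprK.
have ip : mu.-integrable `]s, t] (EFin \o (fun r => dalphaV r * A r)).
  have h := primitive_integrableM primitive_dalphaV (le_trans s0 st) (integrable_armsfin (le_trans s0 st)).
  by apply: integrableS h => //; apply: subset_itv; rewrite bnd_simp.
rewrite e /Rintegral fineK; last exact: (integrable_fin_num _ ip).
have mi : measurable_fun (`]s, t] : set R) (EFin \o (fun r => dalphaV r * A r)) by case/integrableP : ip.
have mp : measurable_fun (`]s, t] : set R) (fun r => (dalphaV r)%:E * arms (d r))%E.
  apply: emeasurable_funM; last first.
    by apply: measurable_funS measurable_arms_d => //; exact: subset_oc_cy.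
  apply/measurable_EFinP; apply: measurable_funS (primitive_right_measurable primitive_dalphaV) => //.
  exact: subset_oc_cy.
apply: ae_eq_integral => //.
by have := ae_arms s0 st; apply: filterS => r h Dr; rewrite h.
Qed.

Lemma integral_dalphaV_sqr s t (x : R) : 0 <= s -> s <= t ->
  (\int[mu]_(r in `]s, t]) ((dalphaV r)%:E * (dalphaV r * x)%:E) = (x * (dbeta t - dbeta s))%:E)%E.
Proof.
move=> s0 st; have ib := primitive_integrable primitive_dbeta s0 st.
have ix : mu.-integrable `]s, t] (EFin \o (fun r => x * dalphaV r ^+ 2)).
  exact: eq_integrable (integrableZl _ x ib).
rewrite (primitiveB primitive_dbeta s0 st) -RintegralZl// /Rintegral fineK.
  by apply: eq_integral => r _; rewrite -EFinM; congr (_%:E); ring.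
exact: (integrable_fin_num _ ix).
Qed.

Let mpa s t : 0 <= s -> measurable_fun (`]s, t] : set R) (fun r => (dalphaV r)%:E * arms (d r))%E.
Proof.
move=> s0; apply: emeasurable_funM; last first.
  by apply: measurable_funS measurable_arms_d => //; exact: subset_oc_cy.
apply/measurable_EFinP; apply: measurable_funS (primitive_right_measurable primitive_dalphaV) => //.
exact: subset_oc_cy.
Qed.

Let mpx s t (x : R) : 0 <= s -> measurable_fun (`]s, t] : set R) (fun r => (dalphaV r)%:E * (dalphaV r * x)%:E)%E.
Proof.
move=> s0; have mp : measurable_fun (`]s, t] : set R) dalphaV.
  apply: measurable_funS (primitive_right_measurable primitive_dalphaV) => //.
  exact: subset_oc_cy.
by apply: emeasurable_funM; apply/measurable_EFinP => //; apply: measurable_funM.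
Qed.

Lemma dalphaV_drop_ge s t (x : R) : 0 <= s -> s <= t -> 0 <= x ->
  (forall r, s < r -> r <= t -> ((dalphaV r * x)%:E <= arms (d r))%E) ->
  x * (dbeta t - dbeta s) <= dalphaV s - dalphaV t.
Proof.
move=> s0 st x0 h; rewrite -lee_fin (dalphaV_drop s0 st) -(integral_dalphaV_sqr x s0 st).
apply: ge0_le_integral; [exact: measurable_itv| |exact: mpx|exact: mpa|].
- by move=> r _; rewrite -EFinM lee_fin !mulr_ge0 ?dalphaV_ge0.
move=> r /=; rewrite in_itv/= => /andP[sr rt].
by apply: lee_wpmul2l; [rewrite lee_fin dalphaV_ge0|exact: h].
Qed.

Lemma dalphaV_drop_le s t (x : R) : 0 <= s -> s <= t ->
  (forall r, s < r -> r <= t -> (arms (d r) <= (dalphaV r * x)%:E)%E) ->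
  dalphaV s - dalphaV t <= x * (dbeta t - dbeta s).
Proof.
move=> s0 st h; rewrite -lee_fin (dalphaV_drop s0 st) -(integral_dalphaV_sqr x s0 st).
have r0 r : `]s, t]%classic r -> 0 <= r.
  by rewrite /= in_itv/= => /andP[sr _]; rewrite (le_trans s0)// ltW.
apply: ge0_le_integral; [exact: measurable_itv| |exact: mpa|exact: mpx|].
- by move=> r Dr; rewrite mule_ge0 ?lee_fin ?dalphaV_ge0 ?arms_d_ge0 ?r0.
move=> r /=; rewrite in_itv/= => /andP[sr rt].
by apply: lee_wpmul2l; [rewrite lee_fin dalphaV_ge0|exact: h].
Qed.

Lemma envelope_lip_arms (x : R) b b' : arms c = x%:E -> 0 <= b -> b <= b' ->
  M b - M b' <= x * (b' - b).
Proof.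
move=> cx b0 bb; rewrite lerBlDr; apply: envelope_le => // y y0 y1.
have yx : genfun1 c y <= x.
  rewrite -lee_fin -(genfun1E c_ge0 mass y0 y1) -cx armsE//.
  by apply: genfun_nd => //; exact: ltW.
have h1 := envelope_ge c_ge0 (le_trans b0 bb) y0 y1.
have h2 : (b' - b) * genfun1 c y <= (b' - b) * x by rewrite ler_wpM2l// subr_ge0.
move: h1 h2; move: (M b') (genfun1 c y) => m k h1 h2; lra.
Qed.

(** If u(b, p, 1) is finite for p = 1 / alpha, then x = p + b u satisfies x - b k(x) = p > M(b).
    This is impossible for x < 1, so x >= 1 and u = k(x) >= k(1) = A_0. *)
Lemma arms_above t : 0 <= t -> M (dbeta t) < dalphaV t ->
  ((dalphaV t)%:E * arms c <= arms (d t))%E.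
Proof.
move=> t0 Mp; rewrite arms_dE//; apply: lee_wpmul2l; first by rewrite lee_fin dalphaV_ge0.
have g0 : (0 <= genfun (evol c (dbeta t)) (dalphaV t) 1)%E.
  by apply: genfun_ge0 => //; [move=> a m; apply: evol_ge0 => //; exact: dbeta_ge0|exact: dalphaV_ge0].
case E : (genfun (evol c (dbeta t)) (dalphaV t) 1) g0 => [u||] // u0; last by rewrite leey.
have hfix := genfun_evol_fix c_ge0 c_0 ler01 (dbeta_ge0 t0) (dalphaV_ge0 t) E.
have h0 : 0 <= dalphaV t + dbeta t * u by rewrite addr_ge0 ?dalphaV_ge0// mulr_ge0 ?dbeta_ge0.
rewrite -hfix armsE//; apply: genfun_nd => //.
rewrite leNgt; apply/negP => h1.
have := envelope_ge c_ge0 (dbeta_ge0 t0) h0 h1.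
have -> : genfun1 c (dalphaV t + dbeta t * u) = u by rewrite /genfun1 hfix.
by rewrite addrK leNgt Mp.
Qed.

(** Were A_0 infinite, [arms_above] would make the number of arms infinite on a whole time interval,
    against its integrability. *)
Lemma arms_fin_above s t : 0 <= s -> s < t ->
  (forall r, s < r -> r <= t -> M (dbeta r) < dalphaV r) -> (arms c < +oo)%E.
Proof.
move=> s0 st h; rewrite ltNge leye_eq; apply/negP => /eqP cy.
have ia := integrable_arms (le_trans s0 (ltW st)).
have : (\int[mu]_(r in `]s, t]) arms (d r) < +oo)%E.
  have i : mu.-integrable `]s, t] (fun r => arms (d r)).
    by apply: integrableS ia => //; apply: subset_itv; rewrite bnd_simp.
  have /(_ (measurable_itv _)) := integrable_fin_num _ i.
  by rewrite ge0_fin_numE// integral_ge0// => r /=; rewrite in_itv/= => /andP[sr _];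
    rewrite arms_d_ge0// (le_trans s0)// ltW.
have -> : (\int[mu]_(r in `]s, t]) arms (d r) = \int[mu]_(r in `]s, t]) (cst +oo%E r))%E.
  apply: eq_integral => r; rewrite inE/= in_itv/= => /andP[sr rt].
  have := arms_above (le_trans s0 (ltW sr)) (h r sr rt).
  by rewrite cy gt0_muley ?lte_fin ?dalphaV_gt0// leye_eq => /eqP.
rewrite integral_cst//= (lebesgue_measure_itv `]s, t])/= lte_fin st -EFinB gt0_mulye ?ltxx//.
by rewrite lte_fin subr_gt0.
Qed.

Let D_cont T : 0 <= T -> {within `[0, T], continuous (fun t => M (dbeta t))}.
Proof.
move=> T0; have cb := primitive_continuous T0 primitive_dbeta.
have bT : 0 <= dbeta T by exact: dbeta_ge0.
apply/subspace_continuousP => t /=; rewrite in_itv/= => /andP[t0 tT].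
have cM := (@subspace_continuousP _ `[0, dbeta T] _ M).1 (envelope_continuous c_ge0 (T:=dbeta T)) (dbeta t).
have h1 : dbeta t' @[t' --> within `[0, T] (nbhs t)] --> dbeta t.
  by have := (@subspace_continuousP _ `[0, T] _ dbeta).1 cb t; apply; rewrite /= in_itv/= t0.
move: cM; rewrite /= in_itv/= dbeta_ge0// dbeta_le// => /(_ isT) cM S /cM hS.
have h2 : nbhs t [set r | r \in `[0, T] -> dbeta r \in `[0, dbeta T] -> S (M (dbeta r))].
  exact: h1 _ hS.
suff : nbhs t [set r | r \in `[0, T] -> S (M (dbeta r))] by [].
apply: filterS h2 => r /= hr rT; apply: (hr rT).
by move: rT; rewrite !in_itv/= => /andP[r0 rT]; rewrite dbeta_ge0// dbeta_le.
Qed.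

Lemma dalphaV_le_envelope T : 0 <= T -> dalphaV T <= M (dbeta T).
Proof.
move=> T0; rewrite -subr_le0.
apply: (@barrier_closed R (fun t => dalphaV t - M (dbeta t)) T T0).
- move=> x; apply: cvgB; first exact: (primitive_continuous T0 primitive_dalphaV).
  exact: (D_cont T0).
- by rewrite dalphaV0 dbeta0 envelope0// subrr.
move=> s t s0 st tT hpos.
have [->//|nst] := eqVneq s t.
have st' : s < t by rewrite lt_neqAle nst.
have above r : s < r -> r <= t -> M (dbeta r) < dalphaV r.
  by move=> sr rt; rewrite -subr_gt0; apply: hpos => //; exact: ltW.
have cfin := arms_fin_above (ltW s0) st' above.
have [x cx] : exists x, arms c = x%:E.
  by exists (fine (arms c)); rewrite fineK// ge0_fin_numE// ltW.
have x0 : 0 <= x by rewrite -lee_fin -cx ltW.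
have h1 : x * (dbeta t - dbeta s) <= dalphaV s - dalphaV t.
  apply: dalphaV_drop_ge => //; first exact: ltW.
  move=> r sr rt; rewrite EFinM -cx; apply: arms_above; last exact: above.
  by rewrite (le_trans (ltW s0))// ltW.
have h2 := envelope_lip_arms cx (dbeta_ge0 (ltW s0)) (dbeta_le (ltW s0) st).
exact: subr_le_swap (le_trans h2 h1).
Qed.

Lemma envelope_le_dalphaV T : 0 <= T -> M (dbeta T) <= dalphaV T.
Proof.
move=> T0; rewrite -subr_le0.
apply: (@barrier_closed R (fun t => M (dbeta t) - dalphaV t) T T0).
- move=> x; apply: cvgB; first exact: (D_cont T0).
  exact: (primitive_continuous T0 primitive_dalphaV).
- by rewrite dalphaV0 dbeta0 envelope0// subrr.
move=> s t s0 st tT hpos.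
have Mpos r : s <= r -> r <= t -> 0 < M (dbeta r).
  by move=> sr rt; have := hpos r sr rt; rewrite subr_gt0; apply: lt_trans; exact: dalphaV_gt0.
have r0 r : s <= r -> 0 < r by exact: lt_le_trans.
have below r : s <= r -> r <= t -> (arms (d r) <= (dalphaV r * g (dbeta r))%:E)%E.
  move=> sr rt; have rp := r0 r sr.
  rewrite (arms_dE (ltW rp)) EFinM; apply: lee_wpmul2l; first by rewrite lee_fin dalphaV_ge0.
  have [<- _ _ _] := slope_spec c_ge0 c_0 mass (dbeta_gt0 rp) (Mpos r sr rt).
  apply: genfun_nd => //; [|exact: dalphaV_ge0|].
    by move=> a m; apply: evol_ge0 => //; exact/dbeta_ge0/ltW.
  by have := hpos r sr rt; rewrite subr_gt0 => /ltW.
have g_ni u v : s <= u -> u <= v -> v <= t -> g (dbeta v) <= g (dbeta u).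
  move=> su uv vt; have u0 := r0 u su; apply: slope_ni => //; [exact: dbeta_gt0|exact: dbeta_le (ltW u0) uv|].
  by apply: Mpos => //; exact: le_trans uv.
have cbd : {within `[s, t], continuous dbeta}.
  apply: continuous_subitv (primitive_continuous T0 primitive_dbeta) _ tT; exact: ltW.
(* On [u, v] the decrease of 1 / alpha is bounded with the slope at u, that of M with the slope at
   v; the discrepancy is (g(beta_u) - g(beta_v)) times the increment of beta. *)
apply: (@increment_le0 R (fun t => M (dbeta t) - dalphaV t) (fun r => - g (dbeta r)) dbeta s t st).
- by move=> u v su uv vt; rewrite lerN2; exact: g_ni.
- by move=> u v su uv vt; apply: dbeta_le uv; exact/ltW/r0.
- exact: cbd.
move=> u v su uv vt; have u0 := r0 u su; have v0 := r0 v (le_trans su uv).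
have h1 : dalphaV u - dalphaV v <= g (dbeta u) * (dbeta v - dbeta u).
  apply: dalphaV_drop_le => //; first exact: ltW.
  move=> r ur rv; apply: le_trans (below r _ (le_trans rv vt)) _; first exact: le_trans (ltW ur).
  by rewrite lee_fin; apply: ler_wpM2l; [exact: dalphaV_ge0|exact: (g_ni u r su (ltW ur) (le_trans rv vt))].
have h2 := envelope_tangent c_ge0 c_0 mass (dbeta_gt0 v0) (Mpos v (le_trans su uv) vt) (dbeta_ge0 (ltW u0)).
exact: increment_bound h1 h2.
Qed.

Lemma dalphaV_envelope t : 0 <= t -> dalphaV t = M (dbeta t).
Proof. by move=> t0; apply/eqP; rewrite eq_le dalphaV_le_envelope// envelope_le_dalphaV. Qed.

Lemma clock_increment (x x' z p q w s t : R) :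
  q * (x' - x) <= z -> z <= p * (x' - x) -> q * (t - s) <= z -> z <= p * (t - s) ->
  w <= q -> q <= p -> s <= t -> 0 < w ->
  `|(x' - t) - (x - s)| <= (- (q / w) - - (p / w)) * (t - s).
Proof.
move=> h1 h2 h3 h4 h5 h6 st w0; have ts : 0 <= t - s by rewrite subr_ge0.
have -> : (x' - t) - (x - s) = (x' - x) - (t - s) by ring.
have -> : (- (q / w) - - (p / w)) * (t - s) = (p - q) * (t - s) / w by ring.
by rewrite ler_pdivlMr// mulrC; exact: clock_ratio h1 h2 h3 h4 h5 h6 ts w0.
Qed.

(** Formally beta' = M(beta)^2, while the clock has derivative 1 / M^2. The increments of t and of
    the clock along beta are both enclosed by the same two multiples of the increment of beta. *)
Lemma clock_dbeta T : 0 <= T -> clock c (dbeta T) = T.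
Proof.
move=> T0.
have M0 r : 0 <= r -> 0 < M (dbeta r) by move=> r0; rewrite -dalphaV_envelope ?dalphaV_gt0.
have pT : 0 < dalphaV T ^+ 2 by rewrite exprn_gt0// dalphaV_gt0.
suff : clock c (dbeta T) - T = clock c (dbeta 0) - 0.
  by rewrite dbeta0 clock0 subrr => /eqP; rewrite subr_eq0 => /eqP.
apply: (@increment_eq R (fun t => clock c (dbeta t) - t)
  (fun t => - (dalphaV t ^+ 2 / dalphaV T ^+ 2)) id 0 T T0).
- move=> s t s0 st tT; have h := ler_sqr2 (dalphaV_ge0 t) (dalphaV_ni s0 st).
  by rewrite lerN2; apply: ler_wpM2r h; rewrite invr_ge0; exact: ltW pT.
- by move=> s t _ st _.
- by apply: continuous_subspaceT => x; exact: cvg_id.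
move=> s t s0 st tT; have t0 := le_trans s0 st.
have := clock_sandwich c_ge0 (dbeta_ge0 s0) (dbeta_le s0 st) (M0 t t0).
rewrite -!dalphaV_envelope// => /andP[h1 h2]; have /andP[h3 h4] := dbeta_sandwich s0 st.
have h5 := ler_sqr2 (dalphaV_ge0 T) (dalphaV_ni t0 tT).
have h6 := ler_sqr2 (dalphaV_ge0 t) (dalphaV_ni s0 st).
exact: clock_increment h1 h2 h3 h4 h5 h6 st pT.
Qed.

Lemma solution_unique t a m : 0 <= t -> d t a m = sol c t a m.
Proof.
move=> t0; have [b0 Mb cb] := btimeP c_ge0 t0.
have e : dbeta t = btime c t.
  apply: (clock_inj c_ge0) => //; [exact: dbeta_ge0|by rewrite -dalphaV_envelope// dalphaV_gt0|].
  by rewrite clock_dbeta.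
by rewrite d_evol// dalphaV_envelope// e.
Qed.

End Uniqueness.

(** * The generating function as a convex power series *)

Section PowerSeries.
Variable R : realType.
Implicit Types (w : nat -> nat -> R) (x z : R).

Definition pser w x : \bar R := dsum 0 (fun a m => w a m * x ^+ a).
Definition dcoef w a m : R := a.+1%:R * w a.+1 m.

Lemma dcoef_ge0 w : (forall a m, 0 <= w a m) -> forall a m, 0 <= dcoef w a m.
Proof. by move=> w0 a m; rewrite mulr_ge0. Qed.

Lemma pser_term_ge0 w x : (forall a m, 0 <= w a m) -> 0 <= x -> forall a m, 0 <= w a m * x ^+ a.
Proof. by move=> w0 x0 a m; rewrite mulr_ge0 ?exprn_ge0. Qed.

Lemma pser_ge0 w x : (forall a m, 0 <= w a m) -> 0 <= x -> (0 <= pser w x)%E.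
Proof. by move=> w0 x0; apply: dsum_ge0; exact: pser_term_ge0. Qed.

Lemma dsum_shift (f : nat -> nat -> R) : (forall a m, 0 <= f a m) ->
  dsum 0 (fun a m => f a.+1 m) = dsum 1 f.
Proof.
move=> f0; rewrite /dsum -(@nneseries_addn _ (fun a => (\sum_(1 <= m <oo) (f a m)%:E)%E) 1).
  by congr (lim (_ @ \oo)); apply/funext => n; apply: eq_bigr => a _; rewrite addn1.
by move=> a; apply: nneseries_ge0 => m _ _; rewrite lee_fin.
Qed.

Lemma pser_dcoefE w x : (forall a m, 0 <= w a m) -> 0 <= x ->
  pser (dcoef w) x = dsum 0 (fun a m => a%:R * w a m * x ^+ a.-1).
Proof.
move=> w0 x0; have f0 a m : 0 <= a%:R * w a m * x ^+ a.-1 by rewrite !mulr_ge0 ?exprn_ge0.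
by rewrite dsum_widen1// -?dsum_shift// => m; rewrite !mul0r.
Qed.

Lemma pser_left w x (C : \bar R) : (forall a m, 0 <= w a m) -> 0 < x ->
  (forall z, 0 <= z -> z < x -> (pser w z <= C)%E) -> (pser w x <= C)%E.
Proof. by move=> w0 x0 h; exact: (@dsum_left _ 0 w id). Qed.

Lemma pser_nd w x z : (forall a m, 0 <= w a m) -> 0 <= x -> x <= z -> (pser w x <= pser w z)%E.
Proof.
move=> w0 x0 xz; apply: lee_dsum; try by apply: pser_term_ge0 => //; exact: le_trans xz.
by move=> a m _ _; rewrite ler_wpM2l// lerXn2r// nnegrE (le_trans x0).
Qed.

Lemma expr_tangent x z n : 0 <= x -> 0 <= z ->
  x ^+ n + n%:R * x ^+ n.-1 * (z - x) <= z ^+ n.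
Proof.
move=> x0 z0; elim: n => [|n IH]; first by rewrite !mul0r addr0 !expr0.
have h : 0 <= n%:R * x ^+ n.-1 * (z - x) ^+ 2.
  by rewrite mulr_ge0 ?sqr_ge0// mulr_ge0 ?exprn_ge0.
have h1 := ler_wpM2l z0 IH.
rewrite [leRHS]exprS; apply: le_trans h1; rewrite -subr_ge0; apply: le_trans h _.
rewrite le_eqVlt; apply/orP; left; apply/eqP.
rewrite -natr1 /= expr2; case: n {IH} => [|n]/=; first by rewrite !mul0r expr0; ring.
by rewrite !exprS; ring.
Qed.

(** Written without subtracting series, like its companion on the left, so that it holds for
    infinite values and at the end point 1. *)
Lemma pser_tangent_right w x z : (forall a m, 0 <= w a m) -> 0 <= x -> x <= z ->
  (pser w x + (z - x)%:E * pser (dcoef w) x <= pser w z)%E.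
Proof.
move=> w0 x0 xz; have z0 := le_trans x0 xz; have zx : 0 <= z - x by rewrite subr_ge0.
have d0 a m : 0 <= a%:R * w a m * x ^+ a.-1 by rewrite !mulr_ge0 ?exprn_ge0.
have d1 a m : 0 <= (z - x) * (a%:R * w a m * x ^+ a.-1) by rewrite mulr_ge0.
have t0 := pser_term_ge0 w0 x0.
rewrite pser_dcoefE// -(dsumZ 0 (z - x) d0) /pser -(dsumD 0 t0 d1).
apply: lee_dsum; [by move=> a m; rewrite addr_ge0| |exact: pser_term_ge0].
move=> a m _ _; have := ler_wpM2l (w0 a m) (expr_tangent a x0 z0).
by apply: le_trans; rewrite le_eqVlt; apply/orP; left; apply/eqP; ring.
Qed.

Lemma pser_tangent_left w x z : (forall a m, 0 <= w a m) -> 0 <= z -> z <= x ->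
  (pser w x <= pser w z + (x - z)%:E * pser (dcoef w) x)%E.
Proof.
move=> w0 z0 zx; have x0 := le_trans z0 zx; have xz : 0 <= x - z by rewrite subr_ge0.
have d0 a m : 0 <= a%:R * w a m * x ^+ a.-1 by rewrite !mulr_ge0 ?exprn_ge0.
have d1 a m : 0 <= (x - z) * (a%:R * w a m * x ^+ a.-1) by rewrite mulr_ge0.
have t0 := pser_term_ge0 w0 z0.
rewrite pser_dcoefE// -(dsumZ 0 (x - z) d0) /pser -(dsumD 0 t0 d1).
apply: lee_dsum; [exact: pser_term_ge0| |by move=> a m; rewrite addr_ge0].
move=> a m _ _; have := ler_wpM2l (w0 a m) (expr_tangent a x0 z0).
rewrite -subr_ge0 => h; rewrite -subr_ge0; apply: le_trans h _.
by rewrite le_eqVlt; apply/orP; left; apply/eqP; ring.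
Qed.

Definition pserR w x : R := fine (pser w x).

Section Finite.
Variable w : nat -> nat -> R.
Hypothesis w_ge0 : forall a m, 0 <= w a m.
Hypothesis pser_lty : forall x, 0 <= x -> x < 1 -> (pser w x < +oo)%E.

Lemma pserRE x : 0 <= x -> x < 1 -> pser w x = (pserR w x)%:E.
Proof. by move=> x0 x1; rewrite /pserR fineK// ge0_fin_numE ?pser_lty// pser_ge0. Qed.

(** The tangent at x, evaluated at a point z between x and 1, bounds the derivative by a finite
    difference quotient. *)
Lemma pser_dcoef_lty x : 0 <= x -> x < 1 -> (pser (dcoef w) x < +oo)%E.
Proof.
move=> x0 x1; set z := (x + 1) / 2.
have xz : x < z by rewrite midf_lt.
have z1 : z < 1 by rewrite midf_lt.
have h := pser_tangent_right w_ge0 x0 (ltW xz).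
rewrite ltNge leye_eq; apply/negP => /eqP e; move: h.
rewrite e gt0_muley ?lte_fin ?subr_gt0// addey ?leye_eq; last first.
  by rewrite pserRE.
by rewrite pserRE// (le_trans x0)// ltW.
Qed.

Lemma pserR_ge0 x : 0 <= x -> 0 <= pserR w x.
Proof. by move=> x0; rewrite fine_ge0// pser_ge0. Qed.

Lemma pserR_nd x z : 0 <= x -> x <= z -> z < 1 -> pserR w x <= pserR w z.
Proof.
move=> x0 xz z1; rewrite -lee_fin -!pserRE ?pser_nd//; first exact: le_trans xz.
exact: le_lt_trans z1.
Qed.

Lemma pserR_lt x z a m : 0 <= x -> x < z -> z < 1 -> (0 < a)%N -> (0 < m)%N -> 0 < w a m ->
  pserR w x < pserR w z.
Proof.
move=> x0 xz z1 a0 m0 wam; have z0 : 0 < z by exact: le_lt_trans xz.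
pose del b n : R := if (b == a) && (n == m) then w a m * (z ^+ a - x ^+ a) else 0.
have xza : 0 < w a m * (z ^+ a - x ^+ a).
  by rewrite mulr_gt0// subr_gt0 ltrXn2r// -lt0n.
have del0 b n : 0 <= del b n by rewrite /del; case: ifP => // _; exact: ltW.
have t0 := pser_term_ge0 w_ge0 x0.
have h : (pser w x + dsum 0 del <= pser w z)%E.
  rewrite /pser -(dsumD 0 t0 del0); apply: lee_dsum.
  - by move=> b n; rewrite addr_ge0.
  - move=> b n _ _; rewrite /del; case: ifPn => [/andP[/eqP -> /eqP ->]|_].
      by rewrite mulrBr addrC subrK.
    by rewrite addr0 ler_wpM2l// lerXn2r ?nnegrE ?(ltW xz) ?(ltW z0).
  - exact: pser_term_ge0 (ltW z0).
have hd : ((w a m * (z ^+ a - x ^+ a))%:E <= dsum 0 del)%E.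
  have := @dsum_ge1 R 0 del a m del0 (leq0n _) m0.
  by rewrite /del !eqxx.
rewrite -lte_fin -!pserRE ?(ltW z0)//; last exact: lt_trans z1.
apply: lt_le_trans h; rewrite pserRE//; last exact: lt_trans z1.
by rewrite lteDl// (lt_le_trans _ hd)// lte_fin.
Qed.

Lemma pserR_tangent x z : 0 <= x -> x < 1 -> 0 <= z -> z < 1 ->
  pserR w x + (z - x) * pserR (dcoef w) x <= pserR w z.
Proof.
move=> x0 x1 z0 z1.
have dE : pser (dcoef w) x = (pserR (dcoef w) x)%:E.
  by rewrite /pserR fineK// ge0_fin_numE ?pser_dcoef_lty// pser_ge0//; exact: dcoef_ge0.
have [xz|zx] := leP x z.
  have := pser_tangent_right w_ge0 x0 xz.
  by rewrite dE !pserRE// -EFinM -EFinD lee_fin.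
have := pser_tangent_left w_ge0 z0 (ltW zx).
rewrite dE !pserRE// -EFinM -EFinD lee_fin.
by rewrite -(opprB z x) mulNr lerBrDr.
Qed.

End Finite.

Lemma pserR_continuous w x : (forall a m, 0 <= w a m) ->
  (forall x, 0 <= x -> x < 1 -> (pser w x < +oo)%E) -> 0 < x -> x < 1 ->
  {for x, continuous (pserR w)}.
Proof.
move=> w0 wf x0 x1; apply/cvgrPdist_le => e e0.
set r := (x + 1) / 2.
have xr : x < r by rewrite midf_lt.
have r1 : r < 1 by rewrite midf_lt.
have r0 : 0 <= r by rewrite (le_trans (ltW x0))// ltW.
have D0 := dcoef_ge0 w0; have Df := pser_dcoef_lty w0 wf.
set C := pserR (dcoef w) r + 1.
have C0 : 0 < C by rewrite /C ltr_wpDl// pserR_ge0.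
have lip y z : 0 <= y -> y <= z -> z <= r -> pserR w z - pserR w y <= C * (z - y).
  move=> y0 yz zr; have z0 := le_trans y0 yz; have z1 := le_lt_trans zr r1.
  have := pserR_tangent w0 wf z0 z1 y0 (le_lt_trans yz z1).
  have : (z - y) * pserR (dcoef w) z <= (z - y) * C.
    rewrite ler_wpM2l ?subr_ge0// (le_trans (pserR_nd D0 Df z0 zr r1))// /C lerDl//.
  by rewrite (mulrC C); move: (pserR w z) (pserR w y) ((z - y) * C) => p q s; lra.
near=> y.
have y0 : 0 <= y by apply/ltW; near: y; exact: lt_nbhsr.
have yr : y <= r by apply/ltW; near: y; exact: lt_nbhsl.
have ye : `|x - y| <= e / C.
  by near: y; apply/nbhs_ballP; exists (e / C) => /=; [rewrite divr_gt0|move=> v /ltW].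
have [xy|yx] := leP x y.
  rewrite distrC ger0_norm ?subr_ge0 ?pserR_nd ?(ltW x0) ?(le_lt_trans yr)//.
  apply: le_trans (lip _ _ (ltW x0) xy yr) _.
  by rewrite mulrC -ler_pdivlMr// (le_trans _ ye)// distrC ler_norm.
rewrite ger0_norm ?subr_ge0 ?pserR_nd ?(ltW yx)//.
apply: le_trans (lip _ _ y0 (ltW yx) (ltW xr)) _.
by rewrite mulrC -ler_pdivlMr// (le_trans _ ye)// ler_norm.
Unshelve. all: by end_near. Qed.

(** By convexity the difference quotient lies between the derivatives at the two points, and the
    derivative is continuous. *)
Lemma pserR_derive w x : (forall a m, 0 <= w a m) ->
  (forall x, 0 <= x -> x < 1 -> (pser w x < +oo)%E) -> 0 < x -> x < 1 ->
  is_derive x (1 : R) (pserR w) (pserR (dcoef w) x).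
Proof.
move=> w0 wf x0 x1.
have D0 := dcoef_ge0 w0; have Df := pser_dcoef_lty w0 wf.
suff h : (fun h => h^-1 *: ((pserR w \o shift x) h%:A - pserR w x)) @ 0^' --> pserR (dcoef w) x.
  by apply: DeriveDef; [apply/cvg_ex; exists (pserR (dcoef w) x)|exact: cvg_lim].
apply/cvgrPdist_le => e e0.
have /cvgrPdist_le/(_ e e0) := pserR_continuous D0 Df x0 x1.
move=> /nbhs_ballP[del /= del0 hdel].
near=> h.
have h0 : h != 0 by near: h; exact: nbhs_dnbhs_neq.
have hd : `|pserR (dcoef w) x - pserR (dcoef w) (h + x)| <= e.
  apply: hdel; rewrite /ball /= opprD addrCA subrr addr0 normrN.
  by near: h; exact: dnbhs0_lt.
have hx : `|h| < x by near: h; exact: dnbhs0_lt.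
have hx1 : `|h| < 1 - x by near: h; apply: dnbhs0_lt; rewrite subr_gt0.
have y0 : 0 <= h + x.
  by rewrite -lerBlDr sub0r lerNl (le_trans _ (ltW hx))// ler_normr lexx orbT.
have y1 : h + x < 1.
  by rewrite -ltrBrDr (le_lt_trans _ hx1)// ler_norm.
have t1 := pserR_tangent w0 wf (ltW x0) x1 y0 y1.
have t2 := pserR_tangent w0 wf y0 y1 (ltW x0) x1.
rewrite addrK in t1; rewrite opprD addrCA subrr addr0 in t2.
rewrite /= /shift /= /GRing.scale /= mulr1.
apply: le_trans hd; set F := pserR w x in t1 t2 *; set G := pserR w (h + x) in t1 t2 *.
set a := pserR (dcoef w) x in t1 *; set b := pserR (dcoef w) (h + x) in t2 *.
have -> : h^-1 * (G - F) = (G - F) / h by rewrite mulrC.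
have [hp|hn] := ltP 0 h.
  have q1 : a <= (G - F) / h by rewrite ler_pdivlMr// mulrC lerBrDl.
  have q2 : (G - F) / h <= b.
    by rewrite ler_pdivrMr// mulrC lerBlDr -lerBlDl -mulNr.
  by rewrite distrC (distrC a) !ger0_norm ?subr_ge0 ?(le_trans q1)// lerB.
have {}hn : h < 0 by rewrite lt_neqAle h0.
have q1 : (G - F) / h <= a by rewrite ler_ndivrMr// mulrC lerBrDl.
have q2 : b <= (G - F) / h.
  by rewrite ler_ndivlMr// mulrC lerBlDr -lerBlDl -mulNr.
by rewrite !ger0_norm ?subr_ge0 ?(le_trans q2)// lerB.
Unshelve. all: by end_near. Qed.

End PowerSeries.

(** * The gelation transition *)

Section Gelation.
Variable R : realType.
Variable c : nat -> nat -> R.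
Hypothesis c_ge0 : forall a m, 0 <= c a m.
Hypothesis c_0 : forall a, c a 0 = 0.
Hypothesis mass : (total_mass c < +oo)%E.
Hypothesis arms_gt0 : (0 < arms c)%E.
Local Notation M := (envelope c).
Local Notation g := (slope c).
Local Notation k := (genfun1 c).
Local Notation K := (factorial_moment2 c).
Implicit Types (a m : nat) (b x z t s : R).

Definition dgenfun1 x : R := pserR (dcoef (dcoef c)) x.
Local Notation k' := dgenfun1.

Let w0 := dcoef_ge0 c_ge0.
Let v0 := dcoef_ge0 w0.

Lemma genfun_pser x : 0 <= x -> genfun c x 1 = pser (dcoef c) x.
Proof.
move=> x0; rewrite genfunE -dsum_shift.
  by apply: eq_dsum => a m _ _; rewrite /gterm /dcoef expr1n mulr1.
by move=> a m; rewrite /gterm !mulr_ge0 ?exprn_ge0.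
Qed.

Lemma factorial_pser : K = pser (dcoef (dcoef c)) 1.
Proof.
rewrite pser_dcoefE// /factorial_moment2 /pairing -/(dsum 0 _) dsum_widen1.
- rewrite -dsum_shift; last first.
    by case=> [|a] m; rewrite ?mul0r// -natr1 addrK !mulr_ge0.
  apply: eq_dsum => a m _ _; rewrite /dcoef -natr1 addrK expr1n; ring.
- by case=> [|a] m; rewrite ?mul0r// -natr1 addrK !mulr_ge0.
- by move=> m; rewrite !mul0r.
Qed.

Lemma pser_lty x : 0 <= x -> x < 1 -> (pser (dcoef c) x < +oo)%E.
Proof. by move=> x0 x1; rewrite -genfun_pser// genfun_lty. Qed.

Lemma genfun1_pserR x : 0 <= x -> k x = pserR (dcoef c) x.
Proof. by move=> x0; rewrite /genfun1 genfun_pser. Qed.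

Lemma dgenfun1E x : 0 <= x -> x < 1 -> pser (dcoef (dcoef c)) x = (k' x)%:E.
Proof. by move=> x0 x1; apply: pserRE => // z z0 z1; apply: pser_dcoef_lty => //; exact: pser_lty. Qed.

Lemma dgenfun1_ge0 x : 0 <= x -> 0 <= k' x.
Proof. exact: pserR_ge0. Qed.

Lemma genfun1_tangent x z : 0 <= x -> x < 1 -> 0 <= z -> z < 1 ->
  k x + (z - x) * k' x <= k z.
Proof. by move=> x0 x1 z0 z1; rewrite !genfun1_pserR//; apply: pserR_tangent => //; exact: pser_lty. Qed.

Lemma dgenfun1_le x : 0 <= x -> x < 1 -> ((k' x)%:E <= K)%E.
Proof. by move=> x0 x1; rewrite -dgenfun1E// factorial_pser; apply: pser_nd => //; exact: ltW. Qed.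

Lemma factorial_le (C : \bar R) :
  (forall x, 0 <= x -> x < 1 -> ((k' x)%:E <= C)%E) -> (K <= C)%E.
Proof.
by move=> h; rewrite factorial_pser; apply: pser_left => // z z0 z1; rewrite dgenfun1E// h.
Qed.

Lemma genfun1_derive x : 0 < x -> x < 1 -> is_derive x (1 : R) k (k' x).
Proof.
move=> x0 x1; have := pserR_derive w0 pser_lty x0 x1.
apply: near_eq_is_derive.
near=> z; rewrite genfun1_pserR//; apply/ltW; near: z; exact: lt_nbhsr.
Unshelve. all: by end_near. Qed.

Lemma genfun1_continuous x : 0 < x -> x < 1 -> {for x, continuous k}.
Proof.
move=> x0 x1; have h := genfun1_derive x0 x1.
by apply: differentiable_continuous; apply/derivable1_diffP.
Qed.

Lemma dgenfun1_continuous x : 0 < x -> x < 1 -> {for x, continuous k'}.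
Proof. move=> x0 x1; apply: pserR_continuous => //; exact: pser_dcoef_lty pser_lty. Qed.

(** From a <= a (a - 1) + 1, that is (a - 1)^2 >= 0. With finite total mass, A_0 = +oo then forces K
    = +oo. *)
Lemma arms_le_factorial : (arms c <= K + total_mass c)%E.
Proof.
have ca a m : 0 <= a%:R * (a%:R - 1) * c a m.
  by case: a => [|a]; rewrite ?mul0r// -natr1 addrK !mulr_ge0.
have c1 a m : 0 <= 1 * c a m by rewrite mul1r.
rewrite /factorial_moment2 /total_mass /pairing -!/(dsum 0 _) -(dsumD 0 ca c1).
apply: lee_dsum => [a m|a m _ _|a m]; [by rewrite mulr_ge0| |by rewrite addr_ge0].
rewrite -mulrDl ler_wpM2r//; have := sqr_ge0 (a%:R - 1 : R); rewrite expr2.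
by move: (a%:R : R) => u; lra.
Qed.

Lemma arms_infinite_factorial : arms c = +oo%E -> K = +oo%E.
Proof.
move=> Aoo; have := arms_le_factorial; rewrite Aoo leye_eq.
have : (0 <= total_mass c)%E.
  by apply: (@dsum_ge0 _ 0 (fun a m => 1 * c a m)) => a m; rewrite mul1r.
by case: (total_mass c) mass => [r| |]//= _ _; case: K.
Qed.

(* Makes k' strictly increasing. *)
Lemma gel_witness : (Tgel c < +oo)%E -> exists a m, (0 < m)%N /\ 0 < c a.+3 m.
Proof.
apply: contraPP => /forallNP h.
have c3 a m : (0 < m)%N -> c a.+3 m = 0.
  move=> m0; have /forallNP/(_ m)/not_andP[//|/negP] := h a.
  by rewrite -leNgt => /(conj (c_ge0 a.+3 m))/andP; rewrite -eq_le => /eqP.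
have ca a m : 0 <= a%:R * (a%:R - 1) * c a m.
  by case: a => [|a]; rewrite ?mul0r// -natr1 addrK !mulr_ge0.
have c1 a m : 0 <= 1 * c a m by rewrite mul1r.
(* With at most two arms per particle, a (a - 1) <= a. *)
have KA : (K <= arms c)%E.
  apply: lee_dsum => // [a m _ m0|a m]; last by rewrite mulr_ge0.
  case: a => [|[|[|a]]]; rewrite ?mul0r// ?subrr ?mulr0 ?mul0r ?mulr_ge0//.
    by rewrite ler_wpM2r//; lra.
  by rewrite c3// !mulr0.
have Afin : (arms c < +oo)%E.
  apply: (@le_lt_trans _ _ (2%:E * total_mass c)%E); last first.
    by rewrite lte_mul_pinfty ?lee_fin.
  rewrite /total_mass /pairing -/(dsum 0 _) -(dsumZ 0 2 c1).
  apply: lee_dsum => [a m|a m _ m0|a m]; rewrite ?mulr_ge0//.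
  case: a => [|[|[|a]]]; rewrite ?mul0r ?mulr_ge0//; last by rewrite c3// !mulr0.
    by rewrite mulrA ler_wpM2r//; lra.
  by rewrite mulrA ler_wpM2r//; lra.
rewrite /Tgel ifF; last by apply/negbTE; rewrite -ltey (le_lt_trans KA).
by rewrite [(arms c < K)%E]ltNge KA/= ltxx.
Qed.

Hypothesis gel : (Tgel c < +oo)%E.

Lemma dgenfun1_lt x z : 0 <= x -> x < z -> z < 1 -> k' x < k' z.
Proof.
move=> x0 xz z1; have [a [m [m0 cam]]] := gel_witness gel.
apply: (@pserR_lt _ _ v0 (pser_dcoef_lty w0 pser_lty) x z a.+1 m) => //.
by rewrite /dcoef !mulr_gt0.
Qed.

Lemma dgenfun1_gt0 x : 0 < x -> x < 1 -> 0 < k' x.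
Proof. by move=> x0 x1; rewrite (le_lt_trans (dgenfun1_ge0 (lexx 0)))// dgenfun1_lt. Qed.

Lemma dgenfun1_lt_factorial x : 0 <= x -> x < 1 -> ((k' x)%:E < K)%E.
Proof.
move=> x0 x1; have xz : x < (x + 1) / 2 by rewrite midf_lt.
have z1 : (x + 1) / 2 < 1 by rewrite midf_lt.
apply: lt_le_trans (dgenfun1_le (le_trans x0 (ltW xz)) z1).
by rewrite lte_fin dgenfun1_lt.
Qed.

(** The starting point z + b u of the characteristic that passes through z = M(b). *)
Definition argmax b := M b + b * g b.
Local Notation ell := argmax.

Section Argmax.
Variable b : R.
Hypotheses (b_gt0 : 0 < b) (Mb_gt0 : 0 < M b).

Lemma argmax_le1 : ell b <= 1.
Proof. by have [] := slope_spec c_ge0 c_0 mass b_gt0 Mb_gt0. Qed.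

Lemma genfun_argmax : genfun c (ell b) 1 = (g b)%:E.
Proof. by have [] := slope_spec c_ge0 c_0 mass b_gt0 Mb_gt0. Qed.

Lemma argmax_gt0 : 0 < ell b.
Proof.
by have [_ g0 _ _] := slope_spec c_ge0 c_0 mass b_gt0 Mb_gt0; rewrite ltr_wpDr// mulr_ge0// ltW.
Qed.

Lemma genfun1_argmax : k (ell b) = g b.
Proof. by rewrite /genfun1 genfun_argmax. Qed.

Lemma argmax_stationary : ell b < 1 -> b * k' (ell b) = 1.
Proof.
move=> l1; have l0 := argmax_gt0.
have hd x : 0 < x -> x < 1 -> is_derive x (1 : R) (fun z => z - b * k z) (1 - b * k' x).
  move=> x0 x1; have h := genfun1_derive x0 x1.
  by apply: is_deriveB; rewrite mulrC -[k' x * b]/(k' x *: b); exact: is_deriveZ.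
have h0 : is_derive (ell b) (1 : R) (fun z => z - b * k z) 0.
  apply: (@derive1_at_max _ _ 0 1).
  - exact: ler01.
  - by move=> t; rewrite in_itv/= => /andP[t0 t1]; have [] := hd t t0 t1.
  - by rewrite in_itv/= l0.
  - move=> t; rewrite in_itv/= => /andP[t0 t1].
    rewrite genfun1_argmax addrK.
    exact: envelope_ge (ltW b_gt0) (ltW t0) t1.
have [_ e0] := h0; have [_ e1] := hd _ l0 l1.
by have := e1; rewrite e0 => /esym/eqP; rewrite subr_eq0 => /eqP.
Qed.

Lemma argmax_max x : 0 <= x -> x < 1 -> x - b * k x <= ell b - b * g b.
Proof. by move=> x0 x1; rewrite addrK; exact: envelope_ge (ltW b_gt0) x0 x1. Qed.

Lemma argmax_eq1 : ell b = 1 -> arms c = (g b)%:E /\ M b = 1 - b * g b.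
Proof.
move=> l1; split; last by rewrite -l1 addrK.
by rewrite armsE// -genfun_argmax l1.
Qed.

(** If the maximum is at 1, convexity gives (1 - x) k'(x) <= k(1) - k(x) <= (1 - x) / b for all x <
    1, and k' increases to K. If it is inside, b k' = 1 there, while k' < K by strict
    monotonicity. *)
Lemma argmax_eq1P : (ell b == 1) = (b%:E * K <= 1)%E.
Proof.
apply/idP/idP => [/eqP l1|].
  have [AE ME] := argmax_eq1 l1.
  have -> : (1 = b%:E * (b^-1)%:E :> \bar R)%E by rewrite -EFinM divff// gt_eqF.
  rewrite lee_pmul2l ?lte_fin//; apply: factorial_le => x x0 x1; rewrite lee_fin.
  have h1 := argmax_max x0 x1.
  have h2 : (1 - x) * k' x <= g b - k x.
    have := pser_tangent_right w0 x0 (ltW x1); rewrite -!genfun_pser// dgenfun1E// genfun1E//.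
    by rewrite -armsE// AE -EFinM -EFinD lee_fin lerBrDl.
  have h3 : b * (g b - k x) <= 1 - x.
    by move: h1; rewrite l1; move: (g b) (k x) => p q; rewrite mulrBr; move: (b * p) (b * q) => u v; lra.
  have x1' : 0 < 1 - x by rewrite subr_gt0.
  rewrite -(ler_pM2l x1') -(ler_pM2l b_gt0) (le_trans (ler_wpM2l (ltW b_gt0) h2))//.
  by rewrite mulrCA divff ?mulr1// gt_eqF.
apply: contraLR => l1.
have {}l1 : ell b < 1 by rewrite lt_neqAle l1 argmax_le1.
rewrite -ltNge -(argmax_stationary l1) EFinM lte_pmul2l ?lte_fin//.
by apply: dgenfun1_lt_factorial => //; exact/ltW/argmax_gt0.
Qed.

Lemma lt_argmaxP x : 0 < x -> x < 1 -> (x < ell b) = (b * k' x < 1).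
Proof.
move=> x0 x1; have l0 := argmax_gt0.
have [l1|l1] := eqVneq (ell b) 1.
  rewrite l1 x1; apply/esym; have := l1 => /eqP; rewrite argmax_eq1P => h.
  rewrite -lte_fin EFinM; apply: lt_le_trans h.
  by rewrite lte_pmul2l ?lte_fin// dgenfun1_lt_factorial// ltW.
have {}l1 : ell b < 1 by rewrite lt_neqAle l1 argmax_le1.
rewrite -(argmax_stationary l1) ltr_pM2l//.
have [xl|lx|->] := ltgtP x (ell b); last by rewrite ltxx.
- by rewrite dgenfun1_lt// ltW.
- by apply/esym/negbTE; rewrite -leNgt ltW// dgenfun1_lt// ltW.
Qed.

Lemma argmax_ltP x : 0 < x -> x < 1 -> (ell b < x) = (1 < b * k' x).
Proof.
move=> x0 x1; have l0 := argmax_gt0.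
have [l1|l1] := eqVneq (ell b) 1.
  rewrite l1 [RHS]ltNge [LHS]ltNge (ltW x1)/=; apply/esym/negbTE; rewrite negbK ltW//.
  by rewrite -lt_argmaxP// l1.
have {}l1 : ell b < 1 by rewrite lt_neqAle l1 argmax_le1.
rewrite -(argmax_stationary l1) ltr_pM2l//.
have [xl|lx|->] := ltgtP x (ell b); last by rewrite ltxx.
- by apply/esym/negbTE; rewrite -leNgt ltW// dgenfun1_lt// ltW.
- by rewrite dgenfun1_lt// ltW.
Qed.

End Argmax.

Lemma cvge_sup_at_left (f : R -> \bar R) u v l : u < v ->
  (forall x z, u < x -> x <= z -> z < v -> (f x <= f z)%E) ->
  (forall x, u < x -> x < v -> (f x <= l)%E) ->
  (forall C, (forall x, u < x -> x < v -> (f x <= C)%E) -> (l <= C)%E) ->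
  f x @[x --> v^'-] --> l.
Proof.
move=> uv fnd ub lub; apply/cvg_at_leftNP.
have -> : l = ereal_sup ((f \o -%R) @` [set` `]- v, - u[]).
  apply/eqP; rewrite eq_le; apply/andP; split.
    apply: lub => x ux xv; apply: ereal_sup_ubound; exists (- x) => /=; last by rewrite opprK.
    by rewrite in_itv/= !ltrN2 xv.
  apply: ge_ereal_sup => ? [x /= ]; rewrite in_itv/= => /andP[vx xu] <-.
  by apply: ub; rewrite 1?ltrNr// ltrNl.
apply: nonincreasing_at_right_cvge; first by rewrite bnd_simp ltrN2.
move=> x z; rewrite !in_itv/= => /andP[vx xu] /andP[vz zu] xz.
by apply: fnd; rewrite ?lerN2// 1?ltrNr// ltrNl.
Qed.

Lemma cvge_sup_at_right (f : R -> \bar R) u v l : u < v ->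
  (forall x z, u < x -> x <= z -> z < v -> (f z <= f x)%E) ->
  (forall x, u < x -> x < v -> (f x <= l)%E) ->
  (forall C, (forall x, u < x -> x < v -> (f x <= C)%E) -> (l <= C)%E) ->
  f x @[x --> u^'+] --> l.
Proof.
move=> uv fnd ub lub.
have -> : l = ereal_sup (f @` [set` `]u, v[]).
  apply/eqP; rewrite eq_le; apply/andP; split.
    apply: lub => x ux xv; apply: ereal_sup_ubound; exists x => //=.
    by rewrite in_itv/= ux.
  by apply: ge_ereal_sup => ? [x /= ]; rewrite in_itv/= => /andP[vx xu] <-; exact: ub.
apply: nonincreasing_at_right_cvge; first by rewrite bnd_simp.
move=> x z; rewrite !in_itv/= => /andP[vx xu] /andP[vz zu] xz; exact: fnd.
Qed.

Lemma nondecreasing_at_right_inf (f : R -> \bar R) u v : u < v ->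
  (forall x z, u < x -> x <= z -> z < v -> (f x <= f z)%E) ->
  exists l, [/\ f x @[x --> u^'+] --> l, forall x, u < x -> x < v -> (l <= f x)%E &
    forall C, (forall x, u < x -> x < v -> (C <= f x)%E) -> (C <= l)%E].
Proof.
move=> uv fnd; exists (ereal_inf (f @` [set` `]u, v[])); split.
- apply: nondecreasing_at_right_cvge; first by rewrite bnd_simp.
  move=> x z; rewrite !in_itv/= => /andP[vx xu] /andP[vz zu] xz; exact: fnd.
- move=> x ux xv; apply: ereal_inf_lbound; exists x => //=; by rewrite in_itv/= ux.
- move=> C h; apply: le_ereal_inf_tmp => ? [x /=]; rewrite in_itv/= => /andP[ux xv] <-; exact: h.
Qed.

(** By convexity of k, a stationary point of x - b k(x) is a global maximum. *)
Lemma argmax_unique b x : 0 < b -> 0 <= x -> x < 1 -> b * k' x = 1 ->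
  M b = x - b * k x.
Proof.
move=> b0 x0 x1 bk; apply/le_anti/andP; split; last exact: envelope_ge (ltW b0) x0 x1.
apply: (envelope_le c_ge0 (ltW b0)) => z z0 z1.
have := ler_wpM2l (ltW b0) (genfun1_tangent x0 x1 z0 z1).
rewrite mulrDr mulrCA bk mulr1.
by move: (b * k x) (b * k z) => p q; lra.
Qed.

(** * The function G and its inverse *)

Definition GfunR x : R := x - k x / k' x.

Lemma GfunR_envelope x : 0 < x -> x < 1 -> GfunR x = M (k' x)^-1.
Proof.
move=> x0 x1; have k0 := dgenfun1_gt0 x0 x1.
rewrite (argmax_unique _ (ltW x0))// ?invr_gt0// ?mulVf ?gt_eqF//.
by rewrite /GfunR mulrC.
Qed.

(** The value M(1 / k'(z)) is at least that of the competitor x, and k(x) / k'(z) < k(x) / k'(x). *)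
Lemma GfunR_lt x z : 0 < x -> x < z -> z < 1 -> GfunR x < GfunR z.
Proof.
move=> x0 xz z1; have z0 := lt_trans x0 xz; have x1 := lt_trans xz z1.
rewrite [GfunR z]GfunR_envelope//.
apply: lt_le_trans (envelope_ge c_ge0 _ (ltW x0) x1); last first.
  by rewrite invr_ge0 dgenfun1_ge0// ltW.
rewrite /GfunR ltrD2l ltrN2 mulrC ltr_pM2l ?genfun1_gt0//.
by rewrite ltf_pV2 ?posrE ?dgenfun1_gt0// dgenfun1_lt// ltW.
Qed.

Lemma GfunR_le x z : 0 < x -> x <= z -> z < 1 -> GfunR x <= GfunR z.
Proof. by move=> x0; rewrite le_eqVlt => /predU1P[->//|xz] z1; rewrite ltW// GfunR_lt. Qed.

Lemma GfunR_lt_id x : 0 < x -> x < 1 -> GfunR x < x.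
Proof.
by move=> x0 x1; rewrite /GfunR ltrBlDr ltrDl divr_gt0 ?genfun1_gt0 ?dgenfun1_gt0.
Qed.

Lemma GfunR_continuous x : 0 < x -> x < 1 -> {for x, continuous GfunR}.
Proof.
move=> x0 x1; apply: cvgB; first exact: cvg_id.
apply: cvgM; first exact: genfun1_continuous.
by apply: cvgV; [rewrite gt_eqF ?dgenfun1_gt0|exact: dgenfun1_continuous].
Qed.

Lemma derive1_genfun1 x : 0 < x -> x < 1 -> derive1 (genfun1 c) x = k' x.
Proof. by move=> x0 x1; have [_ <-] := genfun1_derive x0 x1; rewrite derive1E. Qed.

Lemma GfunE x : 0 < x -> x < 1 -> Gfun c x = (GfunR x)%:E.
Proof. by move=> x0 x1; rewrite /Gfun gt_eqF// derive1_genfun1. Qed.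

Lemma Gfun_right : Gfun c x @[x --> 0^'+] --> Gfun c 0 /\
  (forall x, 0 < x -> x < 1 -> (Gfun c 0 <= (GfunR x)%:E)%E) /\
  (forall C, (forall x, 0 < x -> x < 1 -> (C <= (GfunR x)%:E)%E) -> (C <= Gfun c 0)%E).
Proof.
have [|l [cl lb glb]] := @nondecreasing_at_right_inf (fun x => (GfunR x)%:E) 0 1 ltr01.
  by move=> x z x0 xz z1; rewrite lee_fin GfunR_le.
have e1 : \forall x \near (0 : R)^'+, 0 < x /\ x < 1.
  near=> x; split; near: x; [exact: nbhs_right_gt|exact: nbhs_right_lt].
have l0 : Gfun c 0 = l.
  rewrite /Gfun eqxx; apply: cvg_lim => //.
  apply: cvg_trans cl; apply: near_eq_cvg; apply: filterS e1 => x [x0 x1].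
  by rewrite derive1_genfun1.
split; last by rewrite l0.
rewrite l0; apply: cvg_trans cl; apply: near_eq_cvg; apply: filterS e1 => x [x0 x1].
by rewrite GfunE.
Unshelve. all: by end_near. Qed.

Lemma Gfun0_le0 : (Gfun c 0 <= 0)%E.
Proof.
have [_ [h _]] := Gfun_right; apply/lee_addgt0Pr => e e0; rewrite add0e.
have x1 : Num.min e 2^-1 < 1 by rewrite gt_min; apply/orP; right; lra.
have x0 : 0 < Num.min e 2^-1 by rewrite lt_min e0; lra.
by apply: le_trans (h _ x0 x1) _; rewrite lee_fin ltW// (lt_le_trans (GfunR_lt_id _ _))// ge_min lexx.
Qed.

Lemma Gfun_ge x : 0 <= x -> x < 1 -> (Gfun c 0 <= Gfun c x)%E.
Proof.
rewrite le_eqVlt => /predU1P[<-//|x0] x1; rewrite (GfunE x0 x1).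
by have [_ [h _]] := Gfun_right; exact: h.
Qed.

Lemma Gfun_lt x z : 0 <= x -> x < z -> z < 1 -> (Gfun c x < Gfun c z)%E.
Proof.
rewrite le_eqVlt => /predU1P[<-|x0] xz z1; last first.
  by rewrite !GfunE ?lte_fin ?GfunR_lt// ?(lt_trans x0)// (lt_trans xz).
have y0 : 0 < z / 2 by rewrite divr_gt0.
have yz : z / 2 < z by lra.
apply: (@le_lt_trans _ _ (Gfun c (z / 2))); first by rewrite Gfun_ge ?ltW// (lt_trans yz).
by rewrite !GfunE ?lte_fin ?GfunR_lt// (lt_trans yz).
Qed.

Lemma Gfun_inj : {in (`[0%R, 1%R[%classic : set R) &, injective (Gfun c)}.
Proof.
move=> x z; rewrite !inE /= !in_itv/= => /andP[x0 x1] /andP[z0 z1] e.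
have [xz|zx|//] := ltgtP x z.
- by have := Gfun_lt x0 xz z1; rewrite e ltxx.
- by have := Gfun_lt z0 zx x1; rewrite e ltxx.
Qed.

Lemma HfunK x : 0 <= x -> x < 1 -> Hfun c (Gfun c x) = x.
Proof.
move=> x0 x1; apply: (pinvKV _ Gfun_inj).
by rewrite inE /= in_itv/= x0.
Qed.

(** The expected left limit of G = M(1 / k') at 1: there 1 / k' decreases to 1 / K, and M(0) = 1. *)
Definition Gsup : \bar R := if K == +oo%E then 1%E else (M (fine K)^-1)%:E.

Lemma dgenfun1_gt_exists z : (z%:E < K)%E -> exists x, [/\ 0 < x, x < 1 & z < k' x].
Proof.
move=> zK; apply: contrapT => /forallNP h; have := zK; rewrite ltNge => /negP; apply.
apply: factorial_le => x x0 x1; rewrite lee_fin.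
have xz : x < (x + 1) / 2 by rewrite midf_lt.
have z1 : (x + 1) / 2 < 1 by rewrite midf_lt.
rewrite (le_trans (ltW (dgenfun1_lt x0 xz z1)))//.
rewrite leNgt; apply/negP => hh; apply: (h ((x + 1) / 2)); split => //.
exact: le_lt_trans xz.
Qed.

Lemma arms_lt_factorial : K != +oo%E -> (arms c < K)%E.
Proof. by move=> Koo; move: gel; rewrite /Tgel (negbTE Koo); case: ifP. Qed.

Lemma factorial_gt0 : (0 < K)%E.
Proof.
have h2 : (2^-1 : R) < 1 by lra.
apply: lt_le_trans (dgenfun1_le _ h2) => //; rewrite lte_fin dgenfun1_gt0//.
Qed.

Lemma Gsup_ub x : 0 < x -> x < 1 -> ((GfunR x)%:E <= Gsup)%E.
Proof.
move=> x0 x1; rewrite /Gsup; case: ifPn => [_|Koo].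
  by rewrite lee_fin (le_trans (ltW (GfunR_lt_id x0 x1)))// ltW.
rewrite lee_fin GfunR_envelope//; apply: envelope_ni => //.
  by rewrite invr_ge0 fine_ge0// ltW// factorial_gt0.
have kK := dgenfun1_le (ltW x0) x1.
have Kfin : K \is a fin_num by rewrite ge0_fin_numE ?ltey// ltW// factorial_gt0.
have K0 : 0 < fine K by apply: fine_gt0; rewrite factorial_gt0 ltey.
have k0 := dgenfun1_gt0 x0 x1.
by rewrite (lef_pV2 K0 k0) -lee_fin (fineK Kfin).
Qed.

(** This amounts to right continuity of M at 1 / K, or at 0 when K is infinite. *)
Lemma Gsup_lub C : (forall x, 0 < x -> x < 1 -> ((GfunR x)%:E <= C)%E) -> (Gsup <= C)%E.
Proof.
move=> h.
have h2 : (2^-1 : R) < 1 by lra.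
have h20 : 0 < (2^-1 : R) by lra.
case: C h => [C| |] h; [|by rewrite leey|by have := h _ h20 h2].
have {}h x : 0 < x -> x < 1 -> M (k' x)^-1 <= C.
  by move=> x0 x1; rewrite -GfunR_envelope// -lee_fin h.
rewrite /Gsup; case: ifPn => [/eqP Koo|Koo]; rewrite lee_fin leNgt; apply/negP => hC.
  have /cvgrPdist_lt/(_ (1 - C)) := envelope_cvg0 c_ge0.
  rewrite subr_gt0 envelope0// => /(_ hC) [d /= d0 hd].
  have [|x [x0 x1 kx]] := @dgenfun1_gt_exists d^-1; first by rewrite Koo ltry.
  have kx0 := dgenfun1_gt0 x0 x1.
  have := hd (k' x)^-1; rewrite /= sub0r normrN gtr0_norm ?invr_gt0//.
  have ki0 : 0 < (k' x)^-1 by rewrite invr_gt0.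
  have kd : (k' x)^-1 < d by rewrite -(invrK d) ltf_pV2 ?posrE ?invr_gt0.
  move=> /(_ kd kx0).
  by rewrite ltNge ler_normr lerD2l lerN2 h.
have AK := arms_lt_factorial Koo; have K0 := factorial_gt0.
have Kfin : K \is a fin_num by rewrite ge0_fin_numE ?ltey// ltW.
set q := fine K in hC; have KE : K = q%:E by rewrite fineK.
have q0 : 0 < q by rewrite -lte_fin -KE.
have M1 : M q^-1 <= 1 by rewrite envelope_le1// invr_ge0 ltW.
(* e bounds the relative distance from 1 / K to 1 / k'(x). By [envelope_lip], M then drops by at
   most (1 - M(1 / K)) e, which is less than its excess over C. *)
have [e [e0 he]] : exists e, 0 < e /\ (1 - M q^-1) * e < M q^-1 - C.
  exists ((M q^-1 - C) / (2 - M q^-1)); split; first by rewrite divr_gt0 ?subr_gt0//; lra.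
  rewrite mulrA ltr_pdivrMr; last by lra.
  by rewrite mulrC ltr_pM2l ?subr_gt0//; lra.
have qe : q / (1 + e) < q by rewrite ltr_pdivrMr ?addr_gt0// ltr_pMr// ltrDl.
have [|x [x0 x1 kx]] := @dgenfun1_gt_exists (q / (1 + e)); first by rewrite KE lte_fin.
have kx0 := dgenfun1_gt0 x0 x1.
have kq : k' x <= q by rewrite -lee_fin -KE dgenfun1_le// ltW.
have qi : q^-1 <= (k' x)^-1 by rewrite lef_pV2.
have qi0 : 0 < q^-1 by rewrite invr_gt0.
have := envelope_lip c_ge0 qi0 qi.
rewrite -(ler_pM2l q0) mulrA divff ?gt_eqF// mul1r mulrA (mulrBr q) divff ?gt_eqF//.
have := h x x0 x1.
have : q / k' x - 1 <= e.
  by move: kx; rewrite ltr_pdivrMr ?addr_gt0// => kx; rewrite lerBlDl ler_pdivrMr// mulrC ltW.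
have : 0 <= 1 - M q^-1 by rewrite subr_ge0.
move: he hC; move: (M q^-1) (M (k' x)^-1) (q / k' x - 1) => p r s he hC p1 se hr hp.
have := ler_wpM2l p1 se; rewrite (mulrC (1 - p) s).
move: hp he; move: (s * (1 - p)) ((1 - p) * e) => X Y; lra.
Qed.

Lemma Gfun_left : Gfun c x @[x --> 1^'-] --> G1 c /\ G1 c = Gsup.
Proof.
have cl : Gfun c x @[x --> 1^'-] --> Gsup.
  apply: (@cvge_sup_at_left _ 0 1 Gsup ltr01).
  - by move=> x z x0 xz z1; rewrite !GfunE ?lee_fin ?GfunR_le// ?(le_lt_trans xz)// (lt_le_trans x0).
  - by move=> x x0 x1; rewrite GfunE// Gsup_ub.
  - by move=> C h; apply: Gsup_lub => x x0 x1; rewrite -GfunE// h.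
have e : G1 c = Gsup := cvg_lim (@ereal_hausdorff R) cl.
by rewrite e; split.
Qed.

(** At b = 1 / K the maximum is still attained at 1, so that M = 1 - b A_0; its positivity is A_0 <
    K. *)
Lemma envelope_critical : K != +oo%E ->
  M (fine K)^-1 = 1 - fine (arms c) / fine K /\ 0 < M (fine K)^-1.
Proof.
move=> Koo; have AK := arms_lt_factorial Koo; have K0 := factorial_gt0.
have Kfin : K \is a fin_num by rewrite ge0_fin_numE ?ltey// ltW.
have Afin : arms c \is a fin_num by rewrite ge0_fin_numE ?(lt_trans AK) ?ltey// ltW.
set q := fine K; have KE : K = q%:E by rewrite fineK.
have q0 : 0 < q by rewrite -lte_fin -KE.
have AE : arms c = (fine (arms c))%:E by rewrite fineK.
have qi0 : 0 < q^-1 by rewrite invr_gt0.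
have M0 : 0 < M q^-1.
  have g1 : genfun c 1 1 = (fine (arms c))%:E by rewrite -armsE.
  have := envelope_ge_fin c_ge0 mass (ltW qi0) ler01 (lexx 1) g1.
  apply: lt_le_trans; rewrite subr_gt0 mulrC ltr_pdivrMr// mul1r.
  by rewrite -lte_fin -AE -KE.
split => //.
have /eqP l1 : argmax q^-1 == 1.
  by rewrite argmax_eq1P// KE -EFinM mulVf// gt_eqF.
have [h1 ->] := argmax_eq1 qi0 M0 l1.
by rewrite h1 mulrC.
Qed.

Lemma G1_fin : (arms c < +oo)%E -> G1 c = (1 - arms c / K)%E.
Proof.
move=> Afin; have [_ ->] := Gfun_left; rewrite /Gsup.
have AE : arms c = (fine (arms c))%:E by rewrite fineK// ge0_fin_numE// ltW.
case: ifPn => [/eqP ->|Koo]; first by rewrite invey mule0 sube0.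
have [-> _] := envelope_critical Koo; have K0 := factorial_gt0.
have KE : K = (fine K)%:E by rewrite fineK// ge0_fin_numE ?ltey// ltW.
rewrite [in RHS]AE [in RHS]KE inver ifF -?EFinM// gt_eqF//.
by rewrite -lte_fin -KE.
Qed.

Lemma G1_inf : arms c = +oo%E -> G1 c = 1%E.
Proof.
by move=> /(arms_infinite_factorial) Koo; have [_ ->] := Gfun_left; rewrite /Gsup Koo.
Qed.

Lemma G1_gt0 : (0 < G1 c)%E.
Proof.
have [_ ->] := Gfun_left; rewrite /Gsup; case: ifPn => // Koo.
by rewrite lte_fin; have [] := envelope_critical Koo.
Qed.

Lemma Gfun_lt_G1 x : 0 <= x -> x < 1 -> (Gfun c x < G1 c)%E.
Proof.
move=> x0 x1; have xz : x < (x + 1) / 2 by rewrite midf_lt.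
have z1 : (x + 1) / 2 < 1 by rewrite midf_lt.
apply: lt_le_trans (Gfun_lt x0 xz z1) _.
have z0 := le_lt_trans x0 xz.
by rewrite GfunE//; have [_ ->] := Gfun_left; exact: Gsup_ub.
Qed.

Lemma Gfun_surj v : (Gfun c 0 <= v < G1 c)%E -> exists x, [/\ 0 <= x, x < 1 & Gfun c x = v].
Proof.
move=> /andP[]; rewrite le_eqVlt => /predU1P[<- _|Gv0 v1]; first by exists 0.
have [_ [_ glb]] := Gfun_right.
have v1' : (v < +oo)%E by exact: lt_le_trans v1 (leey _).
case: v Gv0 v1 v1' => [v| |] Gv0 v1 // _; last by rewrite ltNge leNye in Gv0.
have [x1 [x10 x11 G1v]] : exists x, [/\ 0 < x, x < 1 & GfunR x < v].
  apply: contrapT => /forallNP h; move: Gv0; rewrite ltNge => /negP; apply.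
  apply: glb => x x0 x1; rewrite lee_fin leNgt; apply/negP => hx; exact: (h x).
have [x2 [x20 x21 G2v]] : exists x, [/\ 0 < x, x < 1 & v < GfunR x].
  apply: contrapT => /forallNP h; move: v1; rewrite ltNge => /negP; apply.
  have [_ ->] := Gfun_left.
  apply: Gsup_lub => x x0 x1'; rewrite lee_fin leNgt; apply/negP => hx; exact: (h x).
have x12 : x1 < x2.
  by rewrite ltNge; apply/negP => /(GfunR_le x20)/(_ x11); rewrite leNgt (lt_trans G1v).
have cG : {within `[x1, x2], continuous GfunR}.
  apply: continuous_in_subspaceT => x; rewrite inE /= in_itv/= => /andP[h1 h2].
  by apply: GfunR_continuous; [exact: lt_le_trans h1|exact: le_lt_trans x21].
have [|x] := IVT (ltW x12) cG (v := v).
  by rewrite ge_min (ltW G1v)/= le_max (ltW G2v) orbT.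
rewrite in_itv/= => /andP[h1 h2] <-.
have x0 : 0 < x by exact: lt_le_trans h1.
by exists x; rewrite (ltW x0) GfunE// (le_lt_trans h2).
Qed.

Lemma HfunP v : (Gfun c 0 <= v < G1 c)%E -> 0 <= Hfun c v < 1 /\ Gfun c (Hfun c v) = v.
Proof. by move=> /Gfun_surj[x [x0 x1 <-]]; rewrite HfunK// x0. Qed.

(** * The solution before and after gelation *)

Local Notation P := (invalpha c).
Local Notation B := (btime c).
Local Notation A := (armsR c).
Local Notation T := (fine (Tgel c)).

Definition maximizer t := if t == 0 then 1 else argmax (B t).

Lemma maximizerE t : 0 < t -> maximizer t = argmax (B t).
Proof. by move=> t0; rewrite /maximizer gt_eqF. Qed.

Lemma factorial_cases : (K = +oo%E /\ Tgel c = 0%E) \/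
  exists A0 q, [/\ K = q%:E, arms c = A0%:E, 0 < A0, A0 < q & Tgel c = ((q - A0)^-1)%:E].
Proof.
have [Koo|Koo] := eqVneq K +oo%E; [left|right]; first by rewrite /Tgel Koo eqxx.
have AK := arms_lt_factorial Koo; have K0 := factorial_gt0.
have KE : K = (fine K)%:E by rewrite fineK// ge0_fin_numE ?ltey// ltW.
have AE : arms c = (fine (arms c))%:E.
  by rewrite fineK// ge0_fin_numE ?(lt_trans AK) ?ltey// ltW.
exists (fine (arms c)), (fine K); split => //.
- by rewrite -lte_fin -AE.
- by rewrite -lte_fin -AE -KE.
- rewrite /Tgel (negbTE Koo) AK {1}KE {1}AE -EFinB inver ifF// gt_eqF// subr_gt0.
  by rewrite -lte_fin -AE -KE.
Qed.

Lemma TgelE : Tgel c = T%:E.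
Proof. by case: factorial_cases => [[_ ->]//|[A0 [q [_ _ _ _ ->]]]]. Qed.

Lemma Tgel_ge0 : 0 <= T.
Proof.
case: factorial_cases => [[_ ->]//|[A0 [q [_ _ _ Aq ->]]]] /=.
by rewrite invr_ge0 subr_ge0 ltW.
Qed.

Lemma subcritical_algebra (p q t : R) :
  (1 - q * p) * (1 + p * t) = 1 -> p * (q * (1 + p * t)) = p * t.
Proof.
move=> h; have -> : p * (q * (1 + p * t)) = (1 + p * t) - (1 - q * p) * (1 + p * t) by ring.
by rewrite h; ring.
Qed.

(** As long as beta K <= 1, the maximizer was 1 at all earlier times, so the slope is constantly
    A_0. Since g is the derivative of alpha = 1 / P, alpha is affine, and M = 1 - beta A_0
    determines beta. *)
Lemma subcritical t : 0 < t -> ((B t)%:E * K <= 1)%E ->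
  [/\ arms c = (g (B t))%:E, (P t)^-1 = 1 + g (B t) * t & B t * (1 + g (B t) * t) = t].
Proof.
move=> t0 BK; have [_ M0 _] := btimeP c_ge0 (ltW t0).
have sub s : 0 < s -> s <= t -> arms c = (g (B s))%:E /\ M (B s) = 1 - B s * g (B s).
  move=> s0 st; have [_ Ms0 _] := btimeP c_ge0 (ltW s0).
  have Bs := btime_gt0 c_ge0 s0.
  apply: (argmax_eq1 Bs Ms0); apply/eqP; rewrite (argmax_eq1P Bs Ms0).
  have BB0 := btime_le c_ge0 (ltW s0) st.
  have BB : ((B s)%:E <= (B t)%:E)%E by rewrite lee_fin.
  have h := lee_wpmul2r (ltW factorial_gt0) BB.
  by apply: (le_trans _ BK).
have [AE ME] := sub t t0 (lexx t).
have gs s : 0 < s -> s <= t -> g (B s) = g (B t).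
  by move=> s0 st; have [AEs _] := sub s s0 st; exact: EFin_inj (etrans (esym AEs) AE).
have PE : (P t)^-1 = 1 + g (B t) * t.
  have hP := primitive_invalphaV c_ge0 c_0 mass arms_gt0.
  have := @primitive_bounds _ _ _ (g (B t)) (g (B t)) 0 t hP (lexx 0) (ltW t0) _.
  rewrite (invalpha0 c_ge0) invr1 subr0 => h; apply/eqP; rewrite addrC -subr_eq eq_le andbC.
  by apply: h => r r0 rt; rewrite gs// lexx.
split => //; have P1 : P t = 1 - B t * g (B t) by [].
have Pt0 := invalpha_gt0 c_ge0 (ltW t0).
have h : P t * (1 + g (B t) * t) = 1 by rewrite -PE mulfV// gt_eqF.
have g0 := slope_btime_gt0 c_ge0 c_0 mass arms_gt0 t0.
apply: (mulfI (lt0r_neq0 g0)).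
by rewrite P1 in h; exact: subcritical_algebra h.
Qed.

(** When beta (1 + A_0 t) = t, the condition beta K <= 1 reads t (K - A_0) <= 1. That relation is
    available only before the threshold, so the converse goes through the threshold time itself. *)
Lemma argmax_time t : 0 < t -> (argmax (B t) == 1) = (t <= T).
Proof.
move=> t0; have [_ M0 _] := btimeP c_ge0 (ltW t0); have Bt0 := btime_gt0 c_ge0 t0.
rewrite argmax_eq1P//.
have [[Koo ->]|[A0 [q [KE AE A00 A0q ->]]]] := factorial_cases.
  by rewrite Koo gt0_muley ?lte_fin//= [RHS]leNgt t0.
have q0 := lt_trans A00 A0q; have qA : 0 < q - A0 by rewrite subr_gt0.
have sub s : 0 < s -> ((B s)%:E * K <= 1)%E -> B s * (1 + A0 * s) = s.
  by move=> s0 /(subcritical s0)[e _ +]; rewrite AE in e; have -> := EFin_inj e.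
rewrite /= -[(q - A0)^-1]mul1r ler_pdivlMr//.
apply/idP/idP => [h|h].
  have := sub t t0 h; move: h; rewrite KE -EFinM lee_fin => h e.
  have t1 : 0 < 1 + A0 * t by rewrite addr_gt0// mulr_gt0.
  have := ler_wpM2r (ltW t1) h; rewrite mulrAC e mul1r mulrBr.
  by rewrite (mulrC A0); lra.
rewrite leNgt; apply/negP; rewrite KE -EFinM lte_fin => hB.
have qi0 : 0 < q^-1 by rewrite invr_gt0.
have qB : q^-1 < B t by rewrite -[q^-1]mul1r ltr_pdivrMr.
have Mq : 0 < M q^-1 by apply: lt_le_trans M0 _; apply: envelope_ni => //; exact: ltW.
(* The time at which beta reaches 1 / K. The subcritical relation identifies it with T_gel, and
   beta_t > 1 / K places t after it. *)
have s0 : 0 <= clock c q^-1 by have := clock_nd c_ge0 (lexx 0) (ltW qi0) Mq; rewrite clock0.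
have [Bs0 Ms0 /(clock_inj c_ge0 Bs0 (ltW qi0) Ms0 Mq) Bs] := btimeP c_ge0 s0.
set s := clock c q^-1 in s0 Bs0 Ms0 Bs.
have s1 : 0 < s.
  rewrite lt_neqAle s0 andbT eq_sym; apply/eqP => e.
  by move: qi0; rewrite -Bs e (btime0 c_ge0) ltxx.
have st : s < t.
  rewrite ltNge; apply/negP => /(btime_le c_ge0 (ltW t0)).
  by rewrite Bs leNgt qB.
have : B s * (1 + A0 * s) = s.
  by apply: sub => //; rewrite Bs KE -EFinM mulVf// gt_eqF.
rewrite Bs => e; have {}e : 1 + A0 * s = s * q.
  by apply: (mulfI (lt0r_neq0 qi0)); rewrite e mulrCA mulVf ?mulr1// gt_eqF.
have := h; rewrite leNgt => /negP; apply.
have -> : 1 = s * (q - A0) by move: e; rewrite mulrBr (mulrC A0); lra.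
by rewrite ltr_pM2r.
Qed.

Lemma alpha_gelE : alpha_gel c = (P T)^-1.
Proof.
rewrite /alpha_gel.
have [[Koo TE]|[A0 [q [KE AE A00 A0q TE]]]] := factorial_cases.
  by rewrite TE mule0 adde0 /= (invalpha0 c_ge0) invr1.
have T0 : 0 < T by rewrite TE /= invr_gt0 subr_gt0.
have [_ M0 _] := btimeP c_ge0 (ltW T0); have BT0 := btime_gt0 c_ge0 T0.
have := argmax_time T0; rewrite lexx argmax_eq1P// => /(subcritical T0)[h -> _].
by rewrite h TgelE.
Qed.

Lemma invalphaV_subcritical t : 0 <= t -> (t%:E < Tgel c)%E ->
  ((P t)^-1)%:E = (1 + arms c * t%:E)%E.
Proof.
rewrite le_eqVlt => /predU1P[<- _|t0 tT]; first by rewrite mule0 adde0 (invalpha0 c_ge0) invr1.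
have [_ M0 _] := btimeP c_ge0 (ltW t0); have Bt0 := btime_gt0 c_ge0 t0.
have := argmax_time t0; rewrite ltW; last by rewrite -lte_fin -TgelE.
by rewrite argmax_eq1P// => /(subcritical t0)[-> -> _].
Qed.

Lemma maximizer_le1 t : 0 <= t -> maximizer t <= 1.
Proof.
rewrite le_eqVlt => /predU1P[<-|t0]; first by rewrite /maximizer eqxx.
have [_ M0 _] := btimeP c_ge0 (ltW t0).
by rewrite maximizerE// argmax_le1// btime_gt0.
Qed.

Lemma maximizer_gt0 t : 0 <= t -> 0 < maximizer t.
Proof.
rewrite le_eqVlt => /predU1P[<-|t0]; first by rewrite /maximizer eqxx.
have [_ M0 _] := btimeP c_ge0 (ltW t0).
by rewrite maximizerE// argmax_gt0// btime_gt0.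
Qed.

Lemma maximizer_eq1 t : 0 <= t -> (maximizer t == 1) = (t <= T).
Proof.
rewrite le_eqVlt => /predU1P[<-|t0]; first by rewrite /maximizer !eqxx Tgel_ge0.
by rewrite maximizerE// argmax_time.
Qed.

Lemma maximizer_lt1 t : T < t -> maximizer t < 1.
Proof.
move=> Tt; have t0 := le_lt_trans Tgel_ge0 Tt.
have t0' := ltW t0.
by rewrite lt_neqAle maximizer_le1// andbT maximizer_eq1// leNgt Tt.
Qed.

Lemma genfun_maximizer t : 0 < t -> genfun c (maximizer t) 1 = (g (B t))%:E.
Proof.
move=> t0; have [_ M0 _] := btimeP c_ge0 (ltW t0).
by rewrite maximizerE// genfun_argmax// btime_gt0.
Qed.

Lemma maximizer_stationary t : T < t -> B t * k' (maximizer t) = 1.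
Proof.
move=> Tt; have t0 := le_lt_trans Tgel_ge0 Tt.
have [_ M0 _] := btimeP c_ge0 (ltW t0).
by have := maximizer_lt1 Tt; rewrite maximizerE// => ?; rewrite argmax_stationary// btime_gt0.
Qed.

Lemma Hfun_maximizer t : T < t -> Hfun c (P t)%:E = maximizer t.
Proof.
move=> Tt; have t0 := le_lt_trans Tgel_ge0 Tt.
have l0 := maximizer_gt0 (ltW t0); have l1 := maximizer_lt1 Tt.
have Bt0 := btime_gt0 c_ge0 t0.
rewrite -[RHS](HfunK (ltW l0) l1) GfunE//; congr (Hfun c _%:E).
have kB : k' (maximizer t) = (B t)^-1.
  by rewrite -[LHS](mulKf (lt0r_neq0 Bt0)) maximizer_stationary// mulr1.
rewrite /GfunR kB invrK /genfun1 genfun_maximizer// maximizerE//= /argmax mulrC addrK.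
by [].
Qed.

Lemma btime_continuous t : 0 < t -> {for t, continuous B}.
Proof.
move=> t0; have t1 : 0 <= t + 1 by rewrite addr_ge0// ltW.
have := primitive_continuous t1 (primitive_btime c_ge0).
move=> /(within_continuous_continuous); apply; first by rewrite ltr_wpDl// ltW.
by rewrite in_itv/= t0 ltrDl ltr01.
Qed.

Lemma invalpha_continuous t : 0 < t -> {for t, continuous P}.
Proof.
move=> t0; have t1 : 0 <= t + 1 by rewrite addr_ge0// ltW.
have := primitive_continuous t1 (primitive_invalpha c_ge0 c_0 mass arms_gt0).
move=> /(within_continuous_continuous); apply; first by rewrite ltr_wpDl// ltW.
by rewrite in_itv/= t0 ltrDl ltr01.
Qed.

(** By [lt_argmaxP] and [argmax_ltP], being above or below a given x is a strict inequality between
    beta k'(x) and 1, hence an open condition on t. *)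
Lemma argmax_btime_continuous t : 0 < t -> {for t, continuous (argmax \o B)}.
Proof.
move=> t0; have [_ M0 _] := btimeP c_ge0 (ltW t0); have Bt0 := btime_gt0 c_ge0 t0.
have cB := btime_continuous t0.
have l0 : 0 < argmax (B t) by exact: argmax_gt0.
have l1 : argmax (B t) <= 1 by exact: argmax_le1.
have cBk x : B s * k' x @[s --> t] --> B t * k' x by apply: cvgM => //; exact: cvg_cst.
apply/cvgrPdist_lt => e e0 /=.
set x := Num.max (argmax (B t) - e) (argmax (B t) / 2).
have x0 : 0 < x by rewrite lt_max divr_gt0// orbT.
have xl : x < argmax (B t).
  by rewrite gt_max ltrBlDr ltrDl e0/= ltr_pdivrMr// ltr_pMr// ltr1n.
have x1 := lt_le_trans xl l1.
have hx : B t * k' x < 1 by rewrite -lt_argmaxP.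
set z := argmax (B t) + e / 2.
have z0 : 0 < z by rewrite addr_gt0// divr_gt0.
have hz : z < 1 -> 1 < B t * k' z.
  by move=> z1; rewrite -argmax_ltP// ltrDl divr_gt0.
have nz : \forall s \near t, z < 1 -> 1 < B s * k' z.
  have [z1|z1] := ltP z 1; last by near=> s.
  by have h := cvgr_gt _ (cBk z) _ (hz z1); near=> s => _; near: s; exact: h.
have nx : \forall s \near t, B s * k' x < 1 by exact: cvgr_lt (cBk x) _ hx.
have n0 : \forall s \near t, 0 < s by exact: lt_nbhsr.
near=> s; have s0 : 0 < s by near: s.
have [_ Ms0 _] := btimeP c_ge0 (ltW s0); have Bs0 := btime_gt0 c_ge0 s0.
have s1 : argmax (B s) <= 1 by exact: argmax_le1.
have lx : x < argmax (B s) by rewrite lt_argmaxP//; near: s.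
have lz : argmax (B s) <= z.
  have [z1|z1] := ltP z 1; last exact: le_trans z1.
  by apply/ltW; rewrite argmax_ltP//; move: z1; near: s.
rewrite ltr_norml; apply/andP; split.
  by rewrite ltrBrDr addrC ltrBlDr (le_lt_trans lz)// ltrD2l ltr_pdivrMr// ltr_pMr// ltr1n.
by rewrite ltrBlDl -ltrBlDr (le_lt_trans _ lx)// le_max lexx.
Unshelve. all: by end_near. Qed.

Lemma armsR_continuous t : 0 < t -> {for t, continuous A}.
Proof.
move=> t0; have Bt0 := btime_gt0 c_ge0 t0.
have e : \forall s \near t, (argmax (B s) - P s) / B s * P s = A s.
  near=> s; have s0 : 0 < s by near: s; exact: lt_nbhsr.
  have Bs0 := btime_gt0 c_ge0 s0.
  rewrite /armsR /argmax; congr (_ * _).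
  by rewrite /invalpha addrAC subrr add0r mulrC mulKf// gt_eqF.
suff h : (argmax (B s) - P s) / B s * P s @[s --> t] --> A t by exact: cvg_trans (near_eq_cvg e) h.
rewrite -(nbhs_singleton e).
apply: cvgM; last exact: invalpha_continuous.
apply: cvgM; last by apply: cvgV; [rewrite gt_eqF|exact: btime_continuous].
apply: cvgB; [exact: argmax_btime_continuous|exact: invalpha_continuous].
Unshelve. all: by end_near. Qed.

Lemma armsR_lt s t : 0 < s -> s < t -> A t < A s.
Proof.
move=> s0 st; rewrite /armsR; have t0 := lt_trans s0 st.
apply: (@le_lt_trans _ _ (g (B s) * P t)).
  by rewrite ler_wpM2r ?slope_btime_ni ?(ltW st)//; apply/ltW/invalpha_gt0 => //; exact: ltW.
by rewrite ltr_pM2l ?slope_btime_gt0// invalpha_lt// ltW.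
Qed.

Lemma armsR_lt_arms t : 0 < t -> ((A t)%:E < arms c)%E.
Proof.
move=> t0; have [_ M0 _] := btimeP c_ge0 (ltW t0); have Bt0 := btime_gt0 c_ge0 t0.
apply: lt_le_trans (slope_lee c_ge0 c_0 mass Bt0 M0).
rewrite lte_fin /armsR -[ltRHS]mulr1 ltr_pM2l ?slope_btime_gt0//.
by rewrite -(invalpha0 c_ge0) invalpha_lt.
Qed.

Lemma arms_sol_lt s t : 0 <= s -> s < t -> (arms (sol c t) < arms (sol c s))%E.
Proof.
rewrite le_eqVlt => /predU1P[<- t0|s0 st].
  by rewrite (arms_sol0 c_ge0 c_0) (arms_sol c_ge0 c_0 mass t0); exact: armsR_lt_arms.
have t0 := lt_trans s0 st.
by rewrite (arms_sol c_ge0 c_0 mass s0) (arms_sol c_ge0 c_0 mass t0) lte_fin; exact: armsR_lt.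
Qed.

(** For fixed x < 1, the maximizer exceeds x at small times, so g >= k(x) there, while P tends to 1.
    The limit is thus at least every k(x), also when A_0 = +oo. *)
Lemma armsR_cvg0 : (A t)%:E @[t --> 0^'+] --> arms c.
Proof.
apply: (@cvge_sup_at_right _ 0 1 _ ltr01).
- move=> s t s0; rewrite le_eqVlt => /predU1P[->//|st] _.
  by rewrite lee_fin ltW// armsR_lt.
- by move=> t t0 _; rewrite ltW// armsR_lt_arms.
case=> [C| |] h; [|by rewrite leey|by have := h 2^-1; rewrite invr_gt0 invf_lt1 ?ltr1n ?ltr0n// => /(_ isT isT)].
have key x : 0 < x -> x < 1 -> k x <= C.
  move=> x0 x1.
  have n1 : \forall t \near 0^'+, B t * k' x < 1.
    have hc : B t * k' x @[t --> 0^'+] --> 0 * k' x.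
      by apply: cvgM; [exact: btime_cvg0|exact: cvg_cst].
    by apply: cvgr_lt hc _ _; rewrite mul0r.
  have hP : k x * P t @[t --> 0^'+] --> k x * P 0.
    by apply: cvgM; [exact: cvg_cst|exact: invalpha_cvg0].
  rewrite (invalpha0 c_ge0) mulr1 in hP; apply: (cvgr_to_le hP).
  near=> t; have t0 : 0 < t by near: t; exact: nbhs_right_gt.
  have t1 : t < 1 by near: t; exact: nbhs_right_lt.
  have [_ M0 _] := btimeP c_ge0 (ltW t0); have Bt0 := btime_gt0 c_ge0 t0.
  have xl : x < argmax (B t) by rewrite (lt_argmaxP Bt0 M0 x0 x1); near: t.
  have kg : k x <= g (B t).
    have := genfun_nd c_ge0 ler01 (ltW x0) (ltW xl).
    by rewrite (genfun_argmax Bt0 M0) (genfun1E c_ge0 mass (ltW x0) x1) lee_fin.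
  have := h t t0 t1; rewrite lee_fin; apply: le_trans.
  by rewrite /armsR ler_wpM2r// ltW// invalpha_gt0// ltW.
rewrite armsE//; apply: genfun_left => // x x0 x1.
have xz : x <= (x + 1) / 2 by rewrite midf_le// ltW.
have z1 : (x + 1) / 2 < 1 by rewrite midf_lt.
have z0 : 0 < (x + 1) / 2 by rewrite divr_gt0// ltr_wpDl.
apply: le_trans (genfun_nd c_ge0 ler01 x0 xz) _.
by rewrite (genfun1E c_ge0 mass (ltW z0) z1) lee_fin key.
Unshelve. all: by end_near. Qed.

Lemma arms_sol_continuous : {within `[0, +oo[, continuous (fun t => arms (sol c t))}.
Proof.
apply/subspace_continuousP => t /=; rewrite in_itv/= andbT le_eqVlt => /predU1P[<-|t0].
  have hc : arms (sol c t) @[t --> 0^'+] --> arms (sol c 0).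
    rewrite arms_sol0//; apply: cvg_trans armsR_cvg0; apply: near_eq_cvg.
    near=> s; rewrite arms_sol//; near: s; exact: nbhs_right_gt.
  apply: cvg_trans (cvg_at_right_within hc); apply: cvg_app.
  by apply: within_subset => z /=; rewrite in_itv/= => /andP[].
suff hc : arms (sol c s) @[s --> t] --> arms (sol c t) by exact: cvg_within_filter hc.
rewrite arms_sol//.
have h : (A s)%:E @[s --> t] --> (A t)%:E.
  by apply: cvg_EFin; [exact: nearW|exact: armsR_continuous].
apply: cvg_trans h.
apply: near_eq_cvg; near=> s; rewrite /= arms_sol//; near: s; exact: lt_nbhsr.
Unshelve. all: by end_near. Qed.

(** A = g P, and 1 / P = 1 + (integral of g) is at least 1 + g t because g is nonincreasing in
    time. *)
Lemma armsR_mul_le t : 0 < t -> A t * (1 + g (B t) * t) <= g (B t).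
Proof.
move=> t0; have hP := primitive_invalphaV c_ge0 c_0 mass arms_gt0.
have Pt0 := invalpha_gt0 c_ge0 (ltW t0).
have g0 := slope_btime_gt0 c_ge0 c_0 mass arms_gt0 t0.
have f1 : 1 + g (B t) * t <= (P t)^-1.
  have [hi e] := hP t (ltW t0); rewrite /= in e; rewrite e (invalpha0 c_ge0) invr1 lerD2l.
  have -> : g (B t) * t = \int[lebesgue_measure]_(r in `]0, t]) (g (B t)).
    by rewrite Rintegral_cst// fine_lebesgue_itv ?subr0// ltW.
  apply: le_Rintegral; [exact: measurable_itv|exact: integrable_cst_itv|exact: hi|].
  by move=> r /=; rewrite in_itv/= => /andP[r0 rt]; exact: (slope_btime_ni c_ge0 c_0 mass r0 rt).
apply: le_trans (ler_wpM2l _ f1) _; first by rewrite /armsR mulr_ge0// ltW.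
by rewrite /armsR mulfK// gt_eqF.
Qed.

Lemma ratio_le (x y t : R) : 0 <= t -> 0 < x -> x <= y -> x / (1 + x * t) <= y / (1 + t * y).
Proof.
move=> t0 x0 xy; have y0 := lt_le_trans x0 xy.
rewrite ler_pdivrMr ?ltr_pwDl// ?mulr_ge0 ?(ltW x0)//.
rewrite mulrAC ler_pdivlMr ?ltr_pwDl// ?mulr_ge0 ?(ltW y0)//.
have -> : x * (1 + t * y) = x + t * (x * y) by ring.
have -> : y * (1 + x * t) = y + t * (x * y) by ring.
by rewrite lerD2r.
Qed.

Lemma arms_sol_bounds t : 0 < t ->
  ((arms c < +oo)%E -> (arms (sol c t) <= arms c / (1 + t%:E * arms c))%E) /\
  (arms c = +oo%E -> (arms (sol c t) <= (1 / t)%:E)%E).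
Proof.
move=> t0; have h := armsR_mul_le t0; rewrite arms_sol//.
have g0 := slope_btime_gt0 c_ge0 c_0 mass arms_gt0 t0.
have [_ M0 _] := btimeP c_ge0 (ltW t0); have Bt0 := btime_gt0 c_ge0 t0.
have gt1 : 0 < 1 + g (B t) * t by rewrite addr_gt0// mulr_gt0.
rewrite -ler_pdivlMr// in h; split => [Afin|_]; rewrite ?lee_fin; last first.
  by apply: (le_trans h); rewrite ler_pdivlMr// mulrAC ler_pdivrMr// mul1r lerDr.
have gA := slope_lee c_ge0 c_0 mass Bt0 M0.
have AE : arms c = (fine (arms c))%:E by rewrite fineK// ge0_fin_numE// ltW.
set A0 := fine (arms c) in AE; rewrite AE lee_fin in gA; rewrite AE.
have A00 : 0 < A0 by exact: lt_le_trans gA.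
have At1 : 0 < 1 + t * A0 by rewrite addr_gt0// mulr_gt0.
rewrite -EFinM -EFinD inver gt_eqF// -EFinM lee_fin; apply: le_trans h _.
exact: ratio_le (ltW t0) g0 gA.
Qed.

(** * The function Gamma along alpha *)

Local Notation mu := (@lebesgue_measure R).

Lemma nondecreasing_primitive (Q : R -> R) : (forall x, 0 <= Q x) ->
  (forall x z, x <= z -> Q x <= Q z) ->
  primitive (fun x => \int[mu]_(r in `]0, x]) Q r) Q.
Proof.
move=> Q0 Qnd x x0; rewrite set_itvoc0 Rintegral_set0 add0r; split => //.
apply: measurable_bounded_integrable.
- exact: measurable_itv.
- rewrite /= lebesgue_measure_itv/=.
  by case: ifP => _; rewrite ?ltry// -EFinB ltry.
- by apply: nondecreasing_measurable; [exact: measurable_itv|exact: Qnd].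
exists (Q x); split; first exact: num_real.
move=> z xz r /=; rewrite in_itv/= => /andP[_ rx].
by rewrite ger0_norm// (le_trans _ (ltW xz))// Qnd.
Qed.

Let a t := (P t)^-1.

Let a_lt s t : 0 <= s -> s < t -> a s < a t.
Proof.
move=> s0 st; have t0 := ltW (le_lt_trans s0 st).
by rewrite ltf_pV2 ?posrE; [exact: invalpha_lt|exact: invalpha_gt0|exact: invalpha_gt0].
Qed.

Let a_le s t : 0 <= s -> s <= t -> a s <= a t.
Proof. by move=> s0; rewrite le_eqVlt => /predU1P[->//|/(a_lt s0)/ltW]. Qed.

Let a_bounds s t : 0 < s -> s <= t -> g (B t) * (t - s) <= a t - a s <= g (B s) * (t - s).
Proof.
move=> s0 st; apply: (primitive_bounds (primitive_invalphaV c_ge0 c_0 mass arms_gt0) (ltW s0) st).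
move=> r sr rt; apply/andP; split.
- exact: (slope_btime_ni c_ge0 c_0 mass (lt_trans s0 sr) rt).
- exact: (slope_btime_ni c_ge0 c_0 mass s0 (ltW sr)).
Qed.

(** If alpha stayed below 1 / x, then P > x would give beta >= x^2 t and g >= k(x) > 0, so beta g
    would be unbounded, although the maximizer M + beta g is at most 1. *)
Lemma invalphaV_unbounded r : exists t, T < t /\ r <= a t.
Proof.
apply: contrapT => /forallNP h.
have ha t : T < t -> a t < Num.max r 2.
  move=> Tt; have := h t; move=> /not_andP[//|/negP]; rewrite -ltNge => har.
  by rewrite lt_max har.
(* The maximum with 2 keeps x in ]0, 1[, where k is finite and positive. *)
set x := (Num.max r 2)^-1.
have m2 : 2 <= Num.max r 2 by rewrite le_max lexx orbT.
have m0 : 0 < Num.max r 2 by apply: lt_le_trans m2; rewrite ltr0n.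
have x0 : 0 < x by rewrite invr_gt0.
have x1 : x < 1.
  by rewrite invf_lt1//; apply: lt_le_trans m2; rewrite ltr1n.
have kx : 0 < k x by exact: genfun1_gt0.
have bound t : T < t -> x ^+ 2 * t * k x <= 1.
  move=> Tt; have t0 := le_lt_trans Tgel_ge0 Tt.
  have Pt0 := invalpha_gt0 c_ge0 (ltW t0).
  have xP : x < P t.
    have := ha t Tt; rewrite -[in X in X -> _](invrK (Num.max r 2)) -/x.
    by rewrite ltf_pV2.
  have xB : x ^+ 2 * t <= B t.
    have /andP[+ _] := btime_sandwich c_ge0 (lexx 0) (ltW t0).
    rewrite (btime0 c_ge0) !subr0; apply: le_trans.
    rewrite (ler_wpM2r (ltW t0))//; apply: ler_sqr2; [exact: ltW|exact: ltW].
  have [_ M0 _] := btimeP c_ge0 (ltW t0); have Bt0 := btime_gt0 c_ge0 t0.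
  have kg : k x <= g (B t).
    have xl : x <= argmax (B t).
      apply: le_trans (ltW xP) _; rewrite /argmax lerDl mulr_ge0 ?(ltW Bt0)//.
      by apply: ltW; exact: (slope_btime_gt0 c_ge0 c_0 mass arms_gt0 t0).
    have := genfun_nd c_ge0 ler01 (ltW x0) xl.
    by rewrite (genfun_argmax Bt0 M0) (genfun1E c_ge0 mass (ltW x0) x1) lee_fin.
  have l1 := argmax_le1 Bt0 M0.
  have : B t * g (B t) <= 1 by apply: le_trans l1; rewrite /argmax lerDr ltW.
  apply: le_trans; apply: ler_pM => //; last exact: ltW.
  by rewrite mulr_ge0 ?sqr_ge0 ?(ltW t0).
set t := T + 2 * (x ^+ 2 * k x)^-1.
have xk : 0 < x ^+ 2 * k x by rewrite mulr_gt0// exprn_gt0.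
have Tt : T < t by rewrite ltrDl mulr_gt0// invr_gt0.
have := bound t Tt; rewrite mulrAC -ler_pdivlMl// mulr1 leNgt => /negP; apply.
apply: lt_le_trans (_ : 2 * (x ^+ 2 * k x)^-1 <= t); last by rewrite lerDr Tgel_ge0.
by rewrite ltr_pMl ?invr_gt0// ltr1n.
Qed.

Lemma invalphaV_surj r : a T <= r -> exists t, T <= t /\ a t = r.
Proof.
move=> ar; have [t [Tt rt]] := invalphaV_unbounded r.
have ca : {within `[T, t], continuous a}.
  have t0 := le_trans Tgel_ge0 (ltW Tt).
  have := primitive_continuous t0 (primitive_invalphaV c_ge0 c_0 mass arms_gt0).
  by move=> /continuous_subitv; apply => //; exact: Tgel_ge0.
have [|s] := IVT (ltW Tt) ca (v := r); first by rewrite ge_min ar le_max rt orbT.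
by rewrite in_itv/= => /andP[Ts _] <-; exists s.
Qed.

(* Extending the integrand of Gamma by 0 makes it monotone on the whole line. *)
Let Q r := if a T < r then 1 / genfun1 c (Hfun c (1 / r)%:E) else 0.

Let QE t : T < t -> Q (a t) = (g (B t))^-1.
Proof.
move=> Tt; have t0 := le_lt_trans Tgel_ge0 Tt.
rewrite /Q a_lt ?Tgel_ge0// !div1r /a invrK Hfun_maximizer//.
by rewrite /genfun1 genfun_maximizer.
Qed.

Let Q_cases r : Q r = 0 /\ r <= a T \/ exists t, [/\ T < t, r = a t & Q r = (g (B t))^-1].
Proof.
have [ra|ar] := leP r (a T); [left|right].
  by rewrite /Q ltNge ra.
have [t [Tt tr]] := invalphaV_surj (ltW ar); move: Tt; rewrite le_eqVlt => /predU1P[e|Tt].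
  by move: ar; rewrite -tr e ltxx.
by exists t; rewrite -tr QE.
Qed.

Let Q_ge0 r : 0 <= Q r.
Proof.
have [[-> _]|[t [Tt _ ->]]] := Q_cases r; first exact: lexx.
have t0 := le_lt_trans Tgel_ge0 Tt.
by rewrite invr_ge0; exact: (ltW (slope_btime_gt0 c_ge0 c_0 mass arms_gt0 t0)).
Qed.

Let Q_nd r r' : r <= r' -> Q r <= Q r'.
Proof.
move=> rr; have [[-> _]|[t [Tt rt ->]]] := Q_cases r; first exact: Q_ge0.
have t0 := le_lt_trans Tgel_ge0 Tt.
have [[_ ra]|[t' [Tt' rt' ->]]] := Q_cases r'.
  have := a_lt Tgel_ge0 Tt; rewrite -rt => h.
  by have := lt_le_trans h (le_trans rr ra); rewrite ltxx.
have t'0 := le_lt_trans Tgel_ge0 Tt'.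
have tt : t <= t'.
  rewrite leNgt; apply/negP => /(a_lt (ltW t'0)); rewrite -rt -rt' => h.
  by have := lt_le_trans h rr; rewrite ltxx.
have g1 := slope_btime_gt0 c_ge0 c_0 mass arms_gt0 t0.
have g2 := slope_btime_gt0 c_ge0 c_0 mass arms_gt0 t'0.
by rewrite (lef_pV2 g1 g2); exact: (slope_btime_ni c_ge0 c_0 mass t0 tt).
Qed.

Let f x := \int[mu]_(r in `]0, x]) Q r.

Let f_bounds s t : T < s -> s <= t ->
  Q (a s) * (a t - a s) <= f (a t) - f (a s) <= Q (a t) * (a t - a s).
Proof.
move=> Ts st; have s0 := le_lt_trans Tgel_ge0 Ts.
have as0 : 0 <= a s by rewrite invr_ge0; exact: (ltW (invalpha_gt0 c_ge0 (ltW s0))).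
apply: (primitive_bounds (nondecreasing_primitive Q_ge0 Q_nd) as0 (a_le (ltW s0) st)).
by move=> r sr rt; rewrite !Q_nd// ltW.
Qed.

(** Here d is an increment of time, e that of alpha, and f' that of a primitive of 1 / g in the
    variable alpha. The slopes p and q bound e / d and their inverses bound f' / e, so f' is close
    to d. *)
Lemma quotient_bounds (p q d e : R) : 0 < q -> q <= p -> 0 <= d ->
  q * d <= e <= p * d ->
  forall f', p^-1 * e <= f' <= q^-1 * e -> forall q0, 0 < q0 -> q0 <= q ->
  `|f' - d| <= (p - q) / q0 * d.
Proof.
move=> q_gt0 qp d0 /andP[e1 e2] f' /andP[f1 f2] q0 q00 q0q.
have p0 := lt_le_trans q_gt0 qp.
have h1 : p^-1 * (q * d) <= f' by apply: le_trans f1; rewrite ler_pM2l ?invr_gt0.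
have h2 : f' <= q^-1 * (p * d) by apply: le_trans f2 _; rewrite ler_pM2l ?invr_gt0.
have c1 : (p - q) / q * d <= (p - q) / q0 * d.
  by rewrite ler_wpM2r// ler_wpM2l ?subr_ge0// lef_pV2.
have c2 : (p - q) / p * d <= (p - q) / q0 * d.
  by rewrite ler_wpM2r// ler_wpM2l ?subr_ge0// lef_pV2// (le_trans q0q).
have e3 : (p - q) / q * d = q^-1 * (p * d) - d.
  by field; rewrite gt_eqF.
have e4 : (p - q) / p * d = d - p^-1 * (q * d).
  by field; rewrite gt_eqF.
by rewrite ler_norml; apply/andP; split; lra.
Qed.

Lemma increment_rearrange (x y u v p q r : R) :
  `|x - y - (v - u)| <= (p - q) / r * (v - u) ->
  `|(x - v) - (y - u)| <= (- (q / r) - - (p / r)) * (v - u).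
Proof.
have -> : x - y - (v - u) = x - v - (y - u) by ring.
by have -> : (p - q) / r * (v - u) = (- (q / r) - - (p / r)) * (v - u) by ring.
Qed.

Lemma shift_eq (x y s t : R) : x - t = y - s -> x - y = t - s.
Proof. by move=> h; lra. Qed.

Lemma shift_decomp (x y z s t u : R) : x - z = t - s ->
  x - y - (t - u) = (z - y) - (s - u).
Proof. by move=> h; lra. Qed.

(** The change of variables r = alpha_s: alpha has density g and the integrand at alpha_s is 1 / g,
    with product 1. As g is only known to be monotone, increments are compared instead. *)
Let f_open s t : T < s -> s <= t -> f (a t) - f (a s) = t - s.
Proof.
move=> Ts st; have s0 := le_lt_trans Tgel_ge0 Ts.
have t0 := lt_le_trans s0 st; have Tt := lt_le_trans Ts st.
have gt0 := slope_btime_gt0 c_ge0 c_0 mass arms_gt0 t0.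
apply: shift_eq.
apply: (@increment_eq _ (fun r => f (a r) - r) (fun r => - (g (B r) / g (B t))) id s t st).
- move=> u v su uv vt; have h := slope_btime_ni c_ge0 c_0 mass (lt_le_trans s0 su) uv.
  by rewrite lerN2; apply: ler_wpM2r h; rewrite invr_ge0; exact: ltW gt0.
- by move=> u v _ uv _.
- by apply: continuous_subspaceT => x; exact: cvg_id.
move=> u v su uv vt; have u0 := lt_le_trans s0 su; have v0' := lt_le_trans u0 uv.
have Tu := lt_le_trans Ts su; have Tv := lt_le_trans Tu uv.
have := f_bounds Tu uv; rewrite (QE Tu) (QE Tv) => hf.
have gv := slope_btime_gt0 c_ge0 c_0 mass arms_gt0 v0'.
have guv := slope_btime_ni c_ge0 c_0 mass u0 uv.
have gvt := slope_btime_ni c_ge0 c_0 mass v0' vt.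
have vu : 0 <= v - u by rewrite subr_ge0.
have := quotient_bounds gv guv vu (a_bounds u0 uv) hf gt0 gvt.
exact: increment_rearrange.
Qed.

(** The identity [f_open] needs s > T_gel, since 1 / alpha at T_gel is G(1), outside the domain of
    H; so s decreases to T_gel. *)
Let f_shift t : T <= t -> f (a t) - f (a T) = t - T.
Proof.
rewrite le_eqVlt => /predU1P[<-|Tt]; first by rewrite !subrr.
have T0 := Tgel_ge0; have t0 := le_lt_trans T0 Tt.
have ca : a s @[s --> T^'+] --> a T.
  have := primitive_continuous (ltW t0) (primitive_invalphaV c_ge0 c_0 mass arms_gt0).
  by move=> /continuous_subitv/(_ T0 (lexx t))/(continuous_within_itvP _ Tt)[].
have aT0 : 0 <= a T by rewrite invr_ge0; exact: (ltW (invalpha_gt0 c_ge0 T0)).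
have h s : T < s -> s <= t -> `|f (a t) - f (a T) - (t - T)| <= Q (a t) * (a s - a T) + (s - T).
  move=> Ts st; have e := f_open Ts st.
  have /andP[h1 h2] : 0 * (a s - a T) <= f (a s) - f (a T) <= Q (a t) * (a s - a T).
    apply: (primitive_bounds (nondecreasing_primitive Q_ge0 Q_nd) aT0 (a_le T0 (ltW Ts))).
    move=> r _ rs; rewrite Q_ge0 Q_nd// (le_trans rs)// a_le//.
    exact: ltW (le_lt_trans T0 Ts).
  rewrite mul0r in h1.
  have sT : 0 <= s - T by rewrite subr_ge0 ltW.
  rewrite (shift_decomp (f (a T)) T e).
  by apply: le_trans (ler_normB _ _) _; rewrite !ger0_norm// lerD.
have hc : Q (a t) * (a s - a T) + (s - T) @[s --> T^'+] --> Q (a t) * (a T - a T) + (T - T).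
  apply: cvgD.
    by apply: cvgM; [exact: cvg_cst|apply: cvgB => //; exact: cvg_cst].
  by apply: cvgB; [exact: cvg_at_right_filter cvg_id|exact: cvg_cst].
rewrite !subrr mulr0 addr0 in hc.
apply/eqP; rewrite -subr_eq0 -normr_le0; apply: (cvgr_to_ge hc).
near=> s; apply: h; near: s; [exact: nbhs_right_gt|exact: nbhs_right_le].
Unshelve. all: by end_near. Qed.

Lemma Gamma_invalphaV t : T <= t -> Gamma c (a t) = a T + (t - T).
Proof.
move=> Tt; rewrite /Gamma alpha_gelE -/(a T); congr (_ + _).
have T0 := Tgel_ge0.
have aT0 : 0 <= a T by rewrite invr_ge0; exact: (ltW (invalpha_gt0 c_ge0 T0)).
rewrite -(f_shift Tt) (primitiveB (nondecreasing_primitive Q_ge0 Q_nd) aT0 (a_le T0 Tt)).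
apply: eq_Rintegral => r; rewrite inE /= in_itv/= => /andP[ar _].
by rewrite /Q ar.
Qed.

Lemma Gamma_bij : set_bij `[alpha_gel c, +oo[ `[alpha_gel c, +oo[ (Gamma c).
Proof.
have T0 := Tgel_ge0; rewrite alpha_gelE -/(a T).
have memP r : (r \in `[a T, +oo[) = (a T <= r) by rewrite in_itv/= andbT.
split => [r|r r'|v] /=.
- rewrite !memP => /invalphaV_surj[t [Tt <-]].
  by rewrite (Gamma_invalphaV Tt) lerDl subr_ge0.
- rewrite !inE /= !memP => /invalphaV_surj[t [Tt <-]] /invalphaV_surj[t' [Tt' <-]].
  by rewrite (Gamma_invalphaV Tt) (Gamma_invalphaV Tt') => /addrI/addIr ->.
- rewrite memP => av; have Tt : T <= T + (v - a T) by rewrite lerDl subr_ge0.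
  exists (a (T + (v - a T))); first by rewrite /= memP a_le.
  by rewrite (Gamma_invalphaV Tt) addrAC subrr add0r addrC subrK.
Qed.

Lemma Gamma_inv_alpha t : T <= t ->
  (P t)^-1 = Gamma_inv c (alpha_gel c + t - T).
Proof.
move=> Tt; rewrite alpha_gelE -/(a T) -addrA -(Gamma_invalphaV Tt) /Gamma_inv -/(a t).
have [_ inj _] := Gamma_bij.
rewrite (pinvKV _ inj)// inE /= in_itv/= andbT alpha_gelE.
exact: a_le Tgel_ge0 Tt.
Qed.
End Gelation.

(** * Generating functions and moments of the solution *)

Section Properties.
Variable R : realType.
Variable c : nat -> nat -> R.
Hypothesis c_ge0 : forall a m, 0 <= c a m.
Hypothesis c_0 : forall a, c a 0 = 0.
Hypothesis mass : (total_mass c < +oo)%E.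
Hypothesis arms_gt0 : (0 < arms c)%E.
Local Notation mu := (@lebesgue_measure R).
Local Notation M := (envelope c).
Local Notation g := (slope c).
Local Notation k := (genfun1 c).
Local Notation k' := (dgenfun1 c).
Local Notation K := (factorial_moment2 c).
Local Notation P := (invalpha c).
Local Notation B := (btime c).
Local Notation A := (armsR c).
Local Notation T := (fine (Tgel c)).
Local Notation ell := (maximizer c).
Implicit Types (a m : nat) (b x z t s : R).

(* The function h_t of the paper. *)
Definition characteristic t x y :=
  x * P t + B t * fine (genfun (evol c (B t)) (x * P t) y).

(** All claims rest on k_0(h, y) = u, with u the Burgers solution at (beta_t, x / alpha_t, y).
    Monotonicity in x and y bounds h by the maximizer, hence by 1. *)
Lemma characteristic_spec t x y : 0 <= t -> 0 <= x <= 1 -> 0 <= y <= 1 ->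
  [/\ 0 <= characteristic t x y <= 1,
      phi c (sol c) t (characteristic t x y) y = x%:E &
      genfun (sol c t) x y =
        ((1 / alpha (sol c) t)%:E * genfun c (characteristic t x y) y)%E].
Proof.
move=> t0 /andP[x0 x1] /andP[y0 y1].
rewrite /phi (alpha_sol c_ge0 c_0 mass arms_gt0 t0) (beta_sol c_ge0 c_0 mass arms_gt0 t0).
rewrite (genfun_sol c_ge0 t0 x0 y0) div1r invrK.
move: t0; rewrite le_eqVlt => /predU1P[<-|t0].
  have -> : characteristic 0 x y = x.
    by rewrite /characteristic (invalpha0 c_ge0) (btime0 c_ge0) mul0r addr0 mulr1.
  rewrite (invalpha0 c_ge0) (btime0 c_ge0) invr1 mulr1 mul0e sube0 !mul1e x0 x1; split => //.
  by congr (genfun _ x y); apply/funext => a; apply/funext => m; exact: evol_0.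
have Pt0 := invalpha_gt0 c_ge0 (ltW t0); have Bt0 := btime_gt0 c_ge0 t0.
have [_ M0 _] := btimeP c_ge0 (ltW t0).
have [gE g0 l1 _] := slope_spec c_ge0 c_0 mass Bt0 M0.
have e0 a m : 0 <= evol c (B t) a m by apply: evol_ge0 => //; exact: ltW.
have xP0 : 0 <= x * P t by rewrite mulr_ge0// ltW.
have xPP : x * P t <= P t by rewrite ler_piMl// ltW.
have ug : (genfun (evol c (B t)) (x * P t) y <= (g (B t))%:E)%E.
  rewrite -gE; apply: (@le_trans _ _ (genfun (evol c (B t)) (P t) y)).
    exact: genfun_nd.
  by apply: genfun_ndy => //; exact: ltW.
have u0 : (0 <= genfun (evol c (B t)) (x * P t) y)%E by exact: genfun_ge0.
have uE : genfun (evol c (B t)) (x * P t) y = (fine (genfun (evol c (B t)) (x * P t) y))%:E.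
  by rewrite fineK// ge0_fin_numE// (le_lt_trans ug)// ltry.
rewrite /characteristic; move: uE ug u0.
move: (fine _) => u uE; rewrite uE !lee_fin => ug u0.
have kE : genfun c (x * P t + B t * u) y = u%:E.
  exact: (genfun_evol_fix c_ge0 c_0 y0 (ltW Bt0) xP0 uE).
rewrite kE; split.
- apply/andP; split; first by rewrite addr_ge0// mulr_ge0// ltW.
  by apply: le_trans l1; apply: lerD => //; rewrite ler_pM2l.
- by rewrite -(EFinM (B t)) -EFinB addrK -EFinM mulrCA mulVf ?mulr1// gt_eqF.
- by [].
Qed.

Lemma genfun_sol_arms t : 0 < t -> genfun (sol c t) 1 1 = (A t)%:E.
Proof. by move=> t0; rewrite -arms_sol// armsE// => a m; apply: sol_ge0 => //; exact: ltW. Qed.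

Lemma alpha_genfun_sol t : 0 < t ->
  ((alpha (sol c) t)%:E * genfun (sol c t) 1 1 = genfun c (ell t) 1)%E.
Proof.
move=> t0; rewrite genfun_sol_arms// genfun_maximizer// (alpha_sol c_ge0 c_0 mass arms_gt0 (ltW t0)).
by rewrite -EFinM /armsR mulrCA mulVf ?mulr1// gt_eqF// invalpha_gt0// ltW.
Qed.

(** The integrand is g, the derivative of alpha = 1 / P. *)
Lemma integral_genfun_maximizer t : 0 <= t ->
  (\int[mu]_(s in `[0%R, t]) genfun c (ell s) 1 = ((P t)^-1 - 1)%:E)%E.
Proof.
move=> t0; have [hi e] := primitive_invalphaV c_ge0 c_0 mass arms_gt0 t0.
have /integrableP[mg _] := hi.
have E s : s \in (`]0, t]%classic : set R) -> genfun c (ell s) 1 = (g (B s))%:E.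
  by rewrite inE/= in_itv/= => /andP[s0 _]; rewrite genfun_maximizer.
rewrite -(@integral_itv_obnd_cbnd _ 0 (BRight t) (fun s => genfun c (ell s) 1)); last first.
  by apply: eq_measurable_fun mg => s /E ->.
have -> : (\int[mu]_(s in `]0%R, t]) genfun c (ell s) 1 = \int[mu]_(s in `]0%R, t]) (g (B s))%:E)%E.
  by apply: eq_integral => s /E.
rewrite /= in e; rewrite e (invalpha0 c_ge0) invr1 addrAC subrr add0r fineK//.
exact: integrable_fin_num hi.
Qed.

Lemma arms_sol_ratio t : 0 < t ->
  (arms (sol c t) = genfun c (ell t) 1 /
     (1 + \int[mu]_(s in `[0%R, t]) genfun c (ell s) 1))%E.
Proof.
move=> t0; rewrite integral_genfun_maximizer ?ltW// genfun_maximizer// arms_sol//.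
have Pt0 := invalpha_gt0 c_ge0 (ltW t0).
by rewrite -EFinD addrCA subrr addr0 inver invr_eq0 gt_eqF// -EFinM invrK.
Qed.

Lemma phi_sol t x : 0 <= t ->
  phi c (sol c) t x 1 = ((P t)^-1%:E * (x%:E - (B t)%:E * genfun c x 1))%E.
Proof. by move=> t0; rewrite /phi alpha_sol// beta_sol. Qed.

Lemma phi_maximizer t : 0 <= t -> phi c (sol c) t (ell t) 1 = 1%E.
Proof.
move=> t0; rewrite phi_sol//; move: t0; rewrite le_eqVlt => /predU1P[<-|t0].
  by rewrite (invalpha0 c_ge0) (btime0 c_ge0) invr1 mul0e sube0 mul1e /maximizer eqxx.
have Pt0 := invalpha_gt0 c_ge0 (ltW t0).
rewrite genfun_maximizer// -(EFinM (B t)) -EFinB -EFinM maximizerE// /argmax addrK.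
by rewrite mulVf// gt_eqF.
Qed.

Lemma phi_le1 t x : 0 <= t -> 0 <= x <= 1 -> (phi c (sol c) t x 1 <= 1)%E.
Proof.
move=> t0 /andP[x0 x1]; rewrite phi_sol//; move: t0; rewrite le_eqVlt => /predU1P[<-|t0].
  by rewrite (invalpha0 c_ge0) (btime0 c_ge0) invr1 mul0e sube0 mul1e lee_fin.
have Pt0 := invalpha_gt0 c_ge0 (ltW t0); have Bt0 := btime_gt0 c_ge0 t0.
have := genfun_ge0 c_ge0 ler01 x0.
have := @envelope_ge_fin _ _ c_ge0 mass _ x _ (ltW Bt0) x0 x1.
case: (genfun c x 1) => [u| |//] h _.
  by rewrite -(EFinM (B t)) -EFinB -EFinM lee_fin mulrC ler_pdivrMr// mul1r h.
by rewrite gt0_muley ?lte_fin//= addeNy gt0_muleNy ?leNye// lte_fin invr_gt0.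
Qed.

Lemma phi_stationary t : (Tgel c < +oo)%E -> T < t ->
  is_derive (ell t) (1 : R) (fun x => fine (phi c (sol c) t x 1)) 0.
Proof.
move=> gel Tt; have t0 := le_lt_trans (Tgel_ge0 c_ge0 mass arms_gt0 gel) Tt.
have l0 : 0 < ell t by exact: (maximizer_gt0 c_ge0 c_0 mass (ltW t0)).
have l1 : ell t < 1 by exact: maximizer_lt1.
have -> : 0 = (P t)^-1 * (1 - B t * k' (ell t)).
  by rewrite maximizer_stationary// subrr mulr0.
apply: (@near_eq_is_derive _ _ _ (fun x => (P t)^-1 * (x - B t * k x))).
  near=> x.
  have x0 : 0 < x by near: x; exact: lt_nbhsr.
  have x1 : x < 1 by near: x; exact: lt_nbhsl.
  by rewrite phi_sol ?(ltW t0)// (genfun1E c_ge0 mass (ltW x0) x1).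
have h := genfun1_derive c_ge0 mass l0 l1.
have hB : is_derive (ell t) (1 : R) (fun x => B t * k x) (B t * k' (ell t)).
  exact: is_deriveZ.
apply: is_deriveZ.
Unshelve. all: by end_near. Qed.

(** * Second moment *)

Lemma moment2_factorial (d : nat -> nat -> R) : (forall a m, 0 <= d a m) ->
  moment2 d = (factorial_moment2 d + arms d)%E.
Proof.
move=> d0; rewrite /moment2 /factorial_moment2 /arms /pairing -!/(dsum 0 _) -dsumD.
- by apply: eq_dsum => a m _ _; ring.
- by case=> [|a] m; rewrite ?mul0r// -natr1 addrK !mulr_ge0.
- by move=> a m; rewrite mulr_ge0.
Qed.

Lemma factorial_le_moment2 (d : nat -> nat -> R) : (forall a m, 0 <= d a m) ->
  (factorial_moment2 d <= moment2 d)%E.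
Proof.
move=> d0; rewrite moment2_factorial// leeDl//.
by apply: (@dsum_ge0 _ 0 (fun a m => a%:R * d a m)) => a m; rewrite mulr_ge0.
Qed.

Let d0 t : 0 <= t -> forall a m, 0 <= sol c t a m.
Proof. by move=> t0 a m; exact: sol_ge0. Qed.

Let w0 t (t0 : 0 <= t) := dcoef_ge0 (d0 t0).

Let u t x := fine (genfun (evol c (B t)) (x * P t) 1).

Lemma characteristic1 t : 0 < t -> characteristic t 1 1 = argmax c (B t).
Proof. by move=> t0; rewrite /characteristic mul1r. Qed.

Lemma genfun_sol_fin t x : 0 < t -> 0 <= x -> x <= 1 ->
  genfun (sol c t) x 1 = (P t * u t x)%:E /\ genfun c (characteristic t x 1) 1 = (u t x)%:E.
Proof.
move=> t0 x0 x1; have Pt0 := invalpha_gt0 c_ge0 (ltW t0); have Bt0 := btime_gt0 c_ge0 t0.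
have [_ M0 _] := btimeP c_ge0 (ltW t0).
have [gE g0 l1 _] := slope_spec c_ge0 c_0 mass Bt0 M0.
have e0 a m : 0 <= evol c (B t) a m by apply: evol_ge0 => //; exact: ltW.
have xP0 : 0 <= x * P t by rewrite mulr_ge0// ltW.
have xPP : x * P t <= P t by rewrite ler_piMl// ltW.
have ug : (genfun (evol c (B t)) (x * P t) 1 <= (g (B t))%:E)%E.
  by rewrite -gE; exact: genfun_nd.
have u0 : (0 <= genfun (evol c (B t)) (x * P t) 1)%E by exact: genfun_ge0.
have uE : genfun (evol c (B t)) (x * P t) 1 = (u t x)%:E.
  by rewrite fineK// ge0_fin_numE// (le_lt_trans ug)// ltry.
split; last exact: (genfun_evol_fix c_ge0 c_0 ler01 (ltW Bt0) xP0 uE).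
by rewrite genfun_sol ?(ltW t0)// uE.
Qed.

Lemma characteristic_itv t x : 0 < t -> 0 <= x -> x <= 1 -> 0 <= characteristic t x 1 <= 1.
Proof.
move=> t0 x0 x1; have h1 : 0 <= (1 : R) <= 1 by rewrite ler01 lexx.
have hx : 0 <= x <= 1 by rewrite x0.
by have [] := characteristic_spec (ltW t0) hx h1.
Qed.

Let u_nd t x z : 0 < t -> 0 <= x -> x <= z -> z <= 1 -> u t x <= u t z.
Proof.
move=> t0 x0 xz z1; have Pt0 := invalpha_gt0 c_ge0 (ltW t0).
have [hx _] := genfun_sol_fin t0 x0 (le_trans xz z1).
have [hz _] := genfun_sol_fin t0 (le_trans x0 xz) z1.
have := genfun_nd (d0 (ltW t0)) ler01 x0 xz.
by rewrite hx hz lee_fin ler_pM2l.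
Qed.

Lemma characteristicB t x z : characteristic t z 1 - characteristic t x 1 =
  (z - x) * P t + B t * (u t z - u t x).
Proof. by rewrite /characteristic -/(u t z) -/(u t x); ring. Qed.

Lemma increment_bound_subcritical (p b q x D : R) : 0 < p -> 0 <= b -> b * q < 1 ->
  D <= q * ((1 - x) * p + b * D) -> p * D <= p ^+ 2 * q / (1 - b * q) * (1 - x).
Proof.
move=> p0 b0 bq h; have h1 : 0 < 1 - b * q by rewrite subr_gt0.
have : D * (1 - b * q) <= q * ((1 - x) * p) by move: h; lra.
rewrite -ler_pdivlMr// => /(ler_wpM2l (ltW p0)) /le_trans; apply.
by rewrite le_eqVlt; apply/orP; left; apply/eqP; ring.
Qed.

(** For D = k_0(h(1)) - k_0(h(x)), the slope bound K gives D <= K (h(1) - h(x)), while h(1) - h(x) =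
    (1 - x) P + B D. This can be solved for D because B K < 1, and P D is the increment of k_t. *)
Lemma factorial_sol_le t q : 0 < t -> K = q%:E -> B t * q < 1 ->
  (factorial_moment2 (sol c t) <= (P t ^+ 2 * q / (1 - B t * q))%:E)%E.
Proof.
move=> t0 KE Bq.
have Pt0 := invalpha_gt0 c_ge0 (ltW t0); have Bt0 := btime_gt0 c_ge0 t0.
have [_ M0 _] := btimeP c_ge0 (ltW t0).
have l1 : characteristic t 1 1 = 1.
  rewrite characteristic1//; apply/eqP; rewrite eq_le (argmax_le1 c_ge0 c_0 mass Bt0 M0)/=.
  rewrite leNgt; apply/negP => hl; have := argmax_stationary c_ge0 c_0 mass Bt0 M0 hl.
  have := dgenfun1_le c_ge0 mass (ltW (argmax_gt0 c_ge0 c_0 mass Bt0 M0)) hl.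
  rewrite KE lee_fin => hk e.
  by have := le_lt_trans (ler_wpM2l (ltW Bt0) hk) Bq; rewrite e ltxx.
rewrite (factorial_pser (d0 (ltW t0))); apply: pser_left => // [|x x0 x1]; first exact: dcoef_ge0 (w0 (ltW t0)).
have [gx kx] := genfun_sol_fin t0 x0 (ltW x1).
have [g1 k1] := genfun_sol_fin t0 ler01 (lexx 1).
have h1 := pser_tangent_right (w0 (ltW t0)) x0 (ltW x1).
rewrite -!(genfun_pser (d0 (ltW t0)))// gx g1 in h1.
have /andP[hx0 hx1] := characteristic_itv t0 x0 (ltW x1).
have h2 := pser_tangent_left (dcoef_ge0 c_ge0) hx0 hx1.
rewrite -(factorial_pser c_ge0) KE -!(genfun_pser c_ge0)// kx -{1}l1 k1 in h2.
have h3 : u t 1 - u t x <= q * ((1 - x) * P t + B t * (u t 1 - u t x)).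
  rewrite -characteristicB l1 mulrC lerBlDl.
  by move: h2; rewrite -EFinM -EFinD lee_fin.
have h4 := increment_bound_subcritical Pt0 (ltW Bt0) Bq h3.
have x1' : 0 < 1 - x by rewrite subr_gt0.
rewrite -(@lee_pmul2l _ (1 - x)%:E)// ?lte_fin// -EFinM.
have h5 : ((1 - x)%:E * pser (dcoef (dcoef (sol c t))) x <= (P t * u t 1 - P t * u t x)%:E)%E.
  by rewrite (EFinB (P t * u t 1)) leeBrDl.
apply: le_trans h5 _; rewrite lee_fin -mulrBr (mulrC (1 - x)); exact: h4.
Qed.

Lemma moment2_sol_fin t : (Tgel c < +oo)%E -> 0 <= t -> (t%:E < Tgel c)%E ->
  (moment2 (sol c t) < +oo)%E.
Proof.
move=> gel; have [[Koo ->]|[A0 [q [KE AE A00 A0q TE]]]] := factorial_cases c_ge0 mass arms_gt0 gel.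
  by move=> t0; rewrite lte_fin ltNge t0.
rewrite le_eqVlt => /predU1P[<- _|t0 tT].
  have -> : sol c 0 = c by apply/funext => a; apply/funext => m; exact: sol_init.
  by rewrite moment2_factorial// KE AE -EFinD ltry.
have T0 : 0 < T by rewrite TE /= invr_gt0 subr_gt0.
have tT' : t < T by rewrite -lte_fin -(TgelE c_ge0 mass arms_gt0 gel).
have BT0 := btime_gt0 c_ge0 T0; have [_ MT0 _] := btimeP c_ge0 (ltW T0).
have BTq : B T * q <= 1.
  have := argmax_time c_ge0 c_0 mass arms_gt0 gel T0; rewrite lexx.
  by rewrite (argmax_eq1P c_ge0 c_0 mass gel BT0 MT0) KE -EFinM lee_fin.
have Bq : B t * q < 1.
  apply: lt_le_trans BTq; rewrite (ltr_pM2r (lt_trans A00 A0q)).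
  exact: (btime_lt c_ge0 (ltW t0) tT').
rewrite (moment2_factorial (d0 (ltW t0))) arms_sol//.
apply: (@le_lt_trans _ _ ((P t ^+ 2 * q / (1 - B t * q))%:E + (A t)%:E)%E).
  by rewrite leeD2r// factorial_sol_le.
by rewrite -EFinD ltry.
Qed.

Lemma moment2_sol_bounded : (moment2 c < +oo)%E ->
  exists C : R, \forall t \near 0^'+, (moment2 (sol c t) <= C%:E)%E.
Proof.
move=> m2; have KK := le_lt_trans (factorial_le_moment2 c_ge0) m2.
have K0 : (0 <= K)%E.
  by rewrite (factorial_pser c_ge0); apply: pser_ge0 => //; exact: dcoef_ge0 (dcoef_ge0 c_ge0).
have KE : K = (fine K)%:E by rewrite fineK// ge0_fin_numE.
have q0 : 0 <= fine K by apply: fine_ge0.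
move: KE q0; move: (fine K) => q KE q0.
have Afin : (arms c < +oo)%E.
  by move: m2; rewrite moment2_factorial// KE; case: (arms c) => [r| |] //=; rewrite ?ltry ?ltNyr.
have A0 : (0 <= arms c)%E by exact: ltW.
have AE : arms c = (fine (arms c))%:E by rewrite fineK// ge0_fin_numE.
(* Once B K < 1 / 2, the bound P^2 K / (1 - B K) is at most 2 K. *)
exists (2 * q + fine (arms c)).
have hc : B t * q @[t --> 0^'+] --> 0 * q by apply: cvgM; [exact: btime_cvg0|exact: cvg_cst].
have hq : \forall t \near 0^'+, B t * q < 2^-1.
  by apply: cvgr_lt hc _ _; rewrite mul0r invr_gt0.
near=> t; have t0 : 0 < t by near: t; exact: nbhs_right_gt.
have Bq : B t * q < 2^-1 by near: t.
have Pt0 := invalpha_gt0 c_ge0 (ltW t0); have Bt0 := btime_gt0 c_ge0 t0.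
have [_ M0 _] := btimeP c_ge0 (ltW t0).
have Bq1 : B t * q < 1 by apply: lt_trans Bq _; rewrite invf_lt1// ltr1n.
have Bq2 : 0 < 1 - B t * q by rewrite subr_gt0.
rewrite (moment2_factorial (d0 (ltW t0))) EFinD; apply: leeD.
  apply: le_trans (factorial_sol_le t0 KE Bq1) _; rewrite lee_fin.
  rewrite ler_pdivrMr// (@le_trans _ _ q)//.
    by rewrite ler_piMl// exprn_ile1 ?(ltW Pt0)//; exact: invalpha_le1 (ltW t0).
  rewrite mulrAC ler_peMl// mulrBr mulr1 lerBrDr.
  by have := ltW Bq; rewrite -(ler_pM2l (ltr0Sn R 1)) divff ?gt_eqF// => hh; rewrite -natr1 [leRHS]addrC lerD2l.
rewrite arms_sol// -AE.
have [gE g0 _ _] := slope_spec c_ge0 c_0 mass Bt0 M0.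
apply: le_trans (slope_lee c_ge0 c_0 mass Bt0 M0); rewrite lee_fin /armsR ler_piMr//.
exact: invalpha_le1 (ltW t0).
Unshelve. all: by end_near. Qed.

(** * Infinite second moment from the gelation time on *)

Section Supercritical.
Hypothesis gel : (Tgel c < +oo)%E.

Lemma btime_critical : 0 < T -> ((B T)%:E * K = 1)%E.
Proof.
move=> T0; have [[_ TE]|[A0 [q [KE AE A00 A0q TE]]]] := factorial_cases c_ge0 mass arms_gt0 gel.
  by move: T0; rewrite TE ltxx.
have BT0 := btime_gt0 c_ge0 T0; have [_ MT0 _] := btimeP c_ge0 (ltW T0).
have := argmax_time c_ge0 c_0 mass arms_gt0 gel T0; rewrite lexx.
rewrite (argmax_eq1P c_ge0 c_0 mass gel BT0 MT0).
move=> /(subcritical c_ge0 c_0 mass arms_gt0 gel T0)[gA _ BE].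
have {}gA : g (B T) = A0 by apply: EFin_inj; rewrite -gA.
rewrite gA in BE; have qA : 0 < q - A0 by rewrite subr_gt0.
have e : 1 + A0 * T = T * q.
  have : T * (q - A0) = 1 by rewrite TE /= mulVf// gt_eqF.
  by rewrite mulrBr (mulrC A0); lra.
rewrite KE -EFinM; congr (_%:E).
apply: (mulfI (lt0r_neq0 T0)); rewrite mulr1 -[RHS]BE e; ring.
Qed.

(** At T_gel the maximizer is 1 and beta K = 1, with K the supremum of k'. Later, beta k' = 1 at the
    maximizer and k' is continuous. *)
Lemma slope_near_maximizer t e : 0 < t -> T <= t -> 0 < e -> e < 1 ->
  exists z, [/\ 0 < z, z < 1, z < ell t & 1 - e < B t * k' z].
Proof.
move=> t0; rewrite le_eqVlt => /predU1P[tT|Tt] e0 e1.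
  have BK : ((B t)%:E * K = 1)%E by rewrite -tT; apply: btime_critical; rewrite tT.
  have Bt0 := btime_gt0 c_ge0 t0.
  have l1 : ell t = 1 by apply/eqP; rewrite (maximizer_eq1 c_ge0 c_0 mass arms_gt0 gel (ltW t0)) tT.
  have [|z [z0 z1 kz]] := @dgenfun1_gt_exists _ c c_ge0 mass gel ((1 - e) / B t).
    rewrite -(@lte_pmul2l _ (B t)%:E)// BK -EFinM mulrCA divff ?gt_eqF// mulr1.
    by rewrite lte_fin ltrBlDr ltrDl.
  exists z; split => //; first by rewrite l1.
  by rewrite mulrC -ltr_pdivrMr.
have l0 : 0 < ell t by exact: (maximizer_gt0 c_ge0 c_0 mass (ltW t0)).
have l1 : ell t < 1 by exact: maximizer_lt1.
have hc : B t * k' z @[z --> ell t] --> B t * k' (ell t).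
  by apply: cvgM; [exact: cvg_cst|exact: dgenfun1_continuous].
have hc' : B t * k' z @[z --> (ell t)^'-] --> B t * k' (ell t) by exact: cvg_at_left_filter.
have he : 1 - e < B t * k' (ell t).
  by rewrite (maximizer_stationary c_ge0 c_0 mass arms_gt0 gel Tt) ltrBlDr ltrDl.
have h : \forall z \near (ell t)^'-, 1 - e < B t * k' z by exact: (cvgr_gt _ hc' _ he).
have h0 : \forall z \near (ell t)^'-, 0 < z by exact: nbhs_left_gt.
have h1 : \forall z \near (ell t)^'-, z < ell t by exact: nbhs_left_lt.
have hh : \forall z \near (ell t)^'-, [/\ 1 - e < B t * k' z, 0 < z & z < ell t].
  by near=> z; split; near: z; [exact: h|exact: h0|exact: h1].
have [z [hz hz0 hz1]] := @filter_ex _ _ (at_left_proper_filter (ell t)) _ hh.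
by exists z; split => //; exact: lt_trans hz1 l1.
Unshelve. all: by end_near. Qed.

(** D is the increment of k_0 along h, bounded below by the slope r of k_0 and above by the assumed
    second moment q. Since 1 - b r < e, the first bound forces D to be of order (1 - x) / e. *)
Lemma blowup_algebra (p b r q e x D : R) : 0 < p -> 0 < b -> 0 <= q -> 0 < e -> e < 1 ->
  x < 1 -> 0 <= D -> 1 - e < b * r -> r * ((1 - x) * p + b * D) <= D -> p * D <= q * (1 - x) ->
  (1 - e) * p ^+ 2 <= b * q * e.
Proof.
move=> p0 b0 q0 e0 e1 x1 D0 hr h1 h2.
have x1' : 0 < 1 - x by rewrite subr_gt0.
rewrite -(ler_pM2r x1').
have s1 : r * (1 - x) * p <= D * (1 - b * r) by move: h1; lra.
have s2 : b * (r * (1 - x) * p) <= b * (D * (1 - b * r)) by rewrite ler_pM2l.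
have s3 : (1 - e) * ((1 - x) * p) <= (b * r) * ((1 - x) * p).
  by rewrite ler_wpM2r ?(ltW hr)// mulr_ge0// ltW.
have s4 : D * (1 - b * r) <= D * e by rewrite ler_wpM2l//; lra.
have s5 : b * (D * (1 - b * r)) <= b * (D * e) by rewrite ler_pM2l.
have s6 : (1 - e) * ((1 - x) * p) <= b * (D * e).
  by apply: le_trans s3 _; apply: le_trans s5; apply: le_trans s2; rewrite le_eqVlt; apply/orP; left; apply/eqP; ring.
have s7 : p * ((1 - e) * ((1 - x) * p)) <= p * (b * (D * e)) by rewrite ler_pM2l.
have s8 : b * e * (p * D) <= b * e * (q * (1 - x)) by rewrite ler_pM2l// mulr_gt0.
have e9 : (1 - e) * p ^+ 2 * (1 - x) = p * ((1 - e) * ((1 - x) * p)) by ring.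
have e10 : p * (b * (D * e)) = b * e * (p * D) by ring.
have e11 : b * q * e * (1 - x) = b * e * (q * (1 - x)) by ring.
by rewrite e9 e11; apply: le_trans s8; rewrite -e10.
Qed.

Lemma half_split_lt (p s e : R) : 0 < p -> e * (p + s) = p / 2 -> s * e < (1 - e) * p.
Proof. by move=> p0 h; lra. Qed.

(** If the factorial moment were a finite q, h would be Lipschitz near 1, and h(x) would come close
    to the maximizer, where beta k' is arbitrarily close to 1. Then (1 - e) P^2 <= beta q e for all
    e in ]0, 1[, which fails for small e. *)
Lemma moment2_sol_infinite t : 0 <= t -> (Tgel c <= t%:E)%E -> moment2 (sol c t) = +oo%E.
Proof.
move=> t0 Tt; have {}Tt : T <= t by rewrite -lee_fin -(TgelE c_ge0 mass arms_gt0 gel).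
apply/eqP; rewrite -leye_eq; apply: le_trans (factorial_le_moment2 (d0 t0)).
move: t0; rewrite le_eqVlt => /predU1P[te|t0].
  have T0 := Tgel_ge0 c_ge0 mass arms_gt0 gel.
  have -> : sol c t = c by rewrite -te; apply/funext => a; apply/funext => m; exact: sol_init.
  have [[-> _]//|[A0 [q [_ _ _ A0q TE]]]] := factorial_cases c_ge0 mass arms_gt0 gel.
  by move: Tt; rewrite -te TE /= invr_le0 leNgt subr_gt0 A0q.
rewrite leNgt; apply/negP => Ffin.
have F0 : (0 <= factorial_moment2 (sol c t))%E.
  rewrite (factorial_pser (d0 (ltW t0))); apply: pser_ge0 => //; exact: dcoef_ge0 (w0 (ltW t0)).
have FE : factorial_moment2 (sol c t) = (fine (factorial_moment2 (sol c t)))%:E.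
  by rewrite fineK// ge0_fin_numE.
have q0 : 0 <= fine (factorial_moment2 (sol c t)) by exact: fine_ge0.
move: FE q0; move: (fine _) => q FE q0.
have Pt0 := invalpha_gt0 c_ge0 (ltW t0); have Bt0 := btime_gt0 c_ge0 t0.
have key e : 0 < e -> e < 1 -> (1 - e) * P t ^+ 2 <= B t * q * e.
  move=> e0 e1; have [z [z0 z1 zl kz]] := slope_near_maximizer t0 Tt e0 e1.
  have lE : characteristic t 1 1 = ell t by rewrite characteristic1// maximizerE.
  have tang x : 0 <= x -> x < 1 -> P t * (u t 1 - u t x) <= q * (1 - x).
    move=> x0 x1; have h := pser_tangent_left (w0 (ltW t0)) x0 (ltW x1).
    have [gx _] := genfun_sol_fin t0 x0 (ltW x1).
    have [g1 _] := genfun_sol_fin t0 ler01 (lexx 1).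
    rewrite -!(genfun_pser (d0 (ltW t0)))// -(factorial_pser (d0 (ltW t0))) gx g1 FE in h.
    by move: h; rewrite -EFinM -EFinD lee_fin mulrBr (mulrC q) lerBlDl.
  have [x [x0 x1 zx]] : exists x, [/\ 0 <= x, x < 1 & z <= characteristic t x 1].
    (* A Lipschitz constant of h at 1: h(1) - h(x) = (1 - x) P + B D with P D <= q (1 - x). *)
    pose C := P t + B t * (q / P t).
    have C0 : 0 < C by rewrite ltr_pwDl// mulr_ge0 ?divr_ge0 ?(ltW Bt0) ?(ltW Pt0).
    have lz : 0 < ell t - z by rewrite subr_gt0.
    exists (Num.max 0 (1 - (ell t - z) / C)); rewrite le_max lexx.
    have hx1 : Num.max 0 (1 - (ell t - z) / C) < 1 by rewrite gt_max ltr01 ltrBlDr ltrDl divr_gt0.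
    have hx0 : 0 <= Num.max 0 (1 - (ell t - z) / C) by rewrite le_max lexx.
    have hx2 : 1 - Num.max 0 (1 - (ell t - z) / C) <= (ell t - z) / C.
      by rewrite lerBlDr addrC -lerBlDr le_max lexx orbT.
    split => //; move: hx0 hx1 hx2; move: (Num.max 0 _) => x x0 x1 hx.
    have hD : u t 1 - u t x <= q / P t * (1 - x).
      by rewrite mulrAC ler_pdivlMr// mulrC tang.
    have : ell t - characteristic t x 1 <= ell t - z.
      rewrite -lE characteristicB lE; apply: (@le_trans _ _ (C * (1 - x))).
        have -> : C * (1 - x) = (1 - x) * P t + B t * (q / P t * (1 - x)) by rewrite /C; ring.
        by rewrite lerD2l ler_pM2l.
      by rewrite mulrC -ler_pdivlMr.
    by rewrite lerD2l lerN2.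
  have /andP[c0 c1] := characteristic_itv t0 x0 (ltW x1).
  have [_ kx] := genfun_sol_fin t0 x0 (ltW x1).
  have [_ k1] := genfun_sol_fin t0 ler01 (lexx 1).
  have D0 : 0 <= u t 1 - u t x by rewrite subr_ge0 u_nd// ltW.
  have dpos : 0 < ell t - characteristic t x 1.
    rewrite -lE characteristicB ltr_pwDl ?mulr_gt0 ?subr_gt0// mulr_ge0//.
    exact: ltW.
  have cl : characteristic t x 1 < ell t by rewrite -subr_gt0.
  have ll1 := maximizer_le1 c_ge0 c_0 mass (ltW t0).
  have cl1 := lt_le_trans cl ll1.
  have h := pser_tangent_right (dcoef_ge0 c_ge0) c0 (ltW cl).
  have l0 := ltW (le_lt_trans c0 cl).
  rewrite -!(genfun_pser c_ge0)// kx -lE k1 (dgenfun1E c_ge0 mass c0 cl1) characteristicB in h.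
  have kzc : k' z <= k' (characteristic t x 1).
    move: zx; rewrite le_eqVlt => /predU1P[->//|zx].
    by apply: ltW; exact: (dgenfun1_lt c_ge0 mass gel (ltW z0) zx cl1).
  apply: (@blowup_algebra (P t) (B t) (k' (characteristic t x 1)) q e x (u t 1 - u t x)) => //.
  - by apply: lt_le_trans kz _; rewrite ler_pM2l.
  - by move: h; rewrite -EFinM -EFinD lee_fin mulrC lerBrDl.
  - exact: tang.
(* Half of the value of e at which the two sides of the inequality agree. *)
pose e := P t ^+ 2 / (2 * (P t ^+ 2 + B t * q)).
have p2 : 0 < P t ^+ 2 by rewrite exprn_gt0.
have Bq : 0 <= B t * q by rewrite mulr_ge0// ltW.
have S0 : 0 < P t ^+ 2 + B t * q by rewrite ltr_pwDl.
have e0 : 0 < e by rewrite divr_gt0// mulr_gt0.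
have eE : e * (P t ^+ 2 + B t * q) = P t ^+ 2 / 2.
  by rewrite /e; field; rewrite gt_eqF.
have e1 : e < 1.
  rewrite ltr_pdivrMr ?mulr_gt0// mul1r mulr2n mulrDl mul1r.
  by rewrite -[ltLHS]addr0 ler_ltD ?lerDl.
have := key e e0 e1; rewrite leNgt => /negP; apply.
exact: half_split_lt p2 eE.
Qed.

End Supercritical.

End Properties.

(** * Reduction to data vanishing at mass 0 *)

Section ClippedData.
Variable R : realType.
Implicit Types f : nat -> nat -> R.

Lemma arms_clip f : arms (clip f) = arms f.
Proof. exact: pairing_clip. Qed.

Lemma total_mass_clip f : total_mass (clip f) = total_mass f.
Proof. exact: pairing_clip. Qed.

Lemma factorial_clip f : factorial_moment2 (clip f) = factorial_moment2 f.
Proof. exact: pairing_clip. Qed.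

Lemma moment2_clip f : moment2 (clip f) = moment2 f.
Proof. exact: pairing_clip. Qed.

Lemma genfun_clip_fun f : genfun (clip f) = genfun f.
Proof. by apply/funext => x; apply/funext => y; exact: genfun_clip. Qed.

Lemma phi_clip f : phi (clip f) = phi f.
Proof. by rewrite /phi genfun_clip_fun. Qed.

Lemma Tgel_clip f : Tgel (clip f) = Tgel f.
Proof. by rewrite /Tgel arms_clip factorial_clip. Qed.

Lemma Gfun_clip f : Gfun (clip f) = Gfun f.
Proof. by rewrite /Gfun genfun1_clip. Qed.

Lemma G1_clip f : G1 (clip f) = G1 f.
Proof. by rewrite /G1 Gfun_clip. Qed.

Lemma Hfun_clip f : Hfun (clip f) = Hfun f.
Proof. by rewrite /Hfun Gfun_clip. Qed.

Lemma alpha_gel_clip f : alpha_gel (clip f) = alpha_gel f.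
Proof. by rewrite /alpha_gel arms_clip Tgel_clip. Qed.

Lemma Gamma_clip f : Gamma (clip f) = Gamma f.
Proof. by rewrite /Gamma alpha_gel_clip genfun1_clip Hfun_clip. Qed.

Lemma Gamma_inv_clip f : Gamma_inv (clip f) = Gamma_inv f.
Proof. by rewrite /Gamma_inv alpha_gel_clip Gamma_clip. Qed.

Variable f : nat -> nat -> R.
Hypothesis f_ge0 : forall a m, (0 < m)%N -> 0 <= f a m.
Hypothesis mass : (total_mass f < +oo)%E.
Hypothesis arms_gt0 : (0 < arms f)%E.

Let c_ge0 := clip_ge0 f_ge0.
Let c_0 a : clip f a 0 = 0. Proof. by []. Qed.
Let c_mass : (total_mass (clip f) < +oo)%E. Proof. by rewrite total_mass_clip. Qed.
Let c_arms : (0 < arms (clip f))%E. Proof. by rewrite arms_clip. Qed.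

Lemma smoluchowski_solution_sol : smoluchowski_solution f (sol (clip f)).
Proof.
split.
- by move=> t a m t0 _; exact: (sol_ge0 c_ge0 a m t0).
- by move=> a m m0; rewrite (sol_init c_ge0 c_0) clipE.
- move=> a m m0.
  exact: primitive_right_measurable (primitive_sol c_ge0 c_0 c_mass c_arms a m).
- by move=> t t0; exact: (sol_integrable c_ge0 c_0 c_mass c_arms t0).
- move=> t a m t0 m0; have := sol_eq c_ge0 c_0 c_mass c_arms a (ltW t0) m0.
  by rewrite (clipE f a m0).
- move=> h; apply: (moment2_sol_bounded c_ge0 c_0 c_mass c_arms).
  by rewrite moment2_clip.
Qed.

Lemma smoluchowski_solution_unique (d : R -> nat -> nat -> R) : smoluchowski_solution f d ->
  forall (t : R) (a m : nat), 0 <= t -> (0 < m)%N -> d t a m = sol (clip f) t a m.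
Proof.
move=> /solution_clip h t a m t0 m0; rewrite -(clipE (d t) a m0).
exact: (solution_unique c_ge0 c_0 c_mass c_arms h).
Qed.

End ClippedData.

Theorem theorem4p2 (R : realType) (c0 : nat -> nat -> R)
  (c0_ge0 : forall a m : nat, (0 < m)%N -> 0 <= c0 a m)
  (c0_mass : (total_mass c0 < +oo)%E)
  (A0_gt0 : (0 < arms c0)%E) :
  (arms c0 = +oo%E -> factorial_moment2 c0 = +oo%E) /\
  exists c : R -> nat -> nat -> R,
    smoluchowski_solution c0 c /\
    (forall c' : R -> nat -> nat -> R, smoluchowski_solution c0 c' ->
       forall (t : R) (a m : nat), 0 <= t -> (0 < m)%N -> c' t a m = c t a m) /\
    ((Tgel c0 < +oo)%E ->
     ({within `[0, +oo[, continuous (fun t : R => arms (c t))} /\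
      (forall s t : R, 0 <= s -> s < t -> (arms (c t) < arms (c s))%E) /\
      (forall t : R, 0 < t ->
         ((arms c0 < +oo)%E ->
            (arms (c t) <= arms c0 / (1 + t%:E * arms c0))%E) /\
         (arms c0 = +oo%E -> (arms (c t) <= (1 / t)%:E)%E)) /\
      (forall t : R, 0 <= t -> (t%:E < Tgel c0)%E ->
         (alpha c t)%:E = (1 + arms c0 * t%:E)%E) /\
      ({in `[0, 1[ &, forall x x' : R, x < x' -> (Gfun c0 x < Gfun c0 x')%E} /\
       (Gfun c0 x @[x --> 0^'+] --> Gfun c0 0) /\
       (Gfun c0 0 <= 0)%E /\
       (Gfun c0 x @[x --> 1^'-] --> G1 c0) /\
       (0 < G1 c0)%E /\
       ((arms c0 < +oo)%E -> G1 c0 = (1 - arms c0 / factorial_moment2 c0)%E) /\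
       (arms c0 = +oo%E -> G1 c0 = 1%E) /\
       (forall x : R, 0 <= x < 1 -> (Gfun c0 0 <= Gfun c0 x < G1 c0)%E) /\
       (forall v : \bar R, (Gfun c0 0 <= v < G1 c0)%E ->
          0 <= Hfun c0 v < 1 /\ Gfun c0 (Hfun c0 v) = v)) /\
      set_bij `[alpha_gel c0, +oo[ `[alpha_gel c0, +oo[ (Gamma c0) /\
      (forall t : R, 0 <= t -> (Tgel c0 <= t%:E)%E ->
         ((arms c0 < +oo)%E ->
            alpha c t = Gamma_inv c0 (alpha_gel c0 + t - fine (Tgel c0))) /\
         (arms c0 = +oo%E -> alpha c t = Gamma_inv c0 (1 + t)))) /\
     (exists ell : R -> R,
        (forall t : R, 0 <= t ->
           0 <= ell t <= 1 /\
           (forall x : R, 0 <= x <= 1 ->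
              (phi c0 c t x 1 <= phi c0 c t (ell t) 1)%E) /\
           phi c0 c t (ell t) 1 = 1%E /\
           ((t%:E <= Tgel c0)%E -> ell t = 1) /\
           ((Tgel c0 < t%:E)%E ->
              0 < ell t < 1 /\
              is_derive (ell t) 1 (fun x => fine (phi c0 c t x 1)) 0 /\
              ell t = Hfun c0 (1 / alpha c t)%:E)) /\
        (forall t : R, 0 < t ->
           ((alpha c t)%:E * arms (c t) = (alpha c t)%:E * genfun (c t) 1 1)%E /\
           ((alpha c t)%:E * genfun (c t) 1 1 = genfun c0 (ell t) 1)%E /\
           (arms (c t) = genfun c0 (ell t) 1 /
              (1 + \int[lebesgue_measure]_(s in `[0%R, t])
                     genfun c0 (ell s) 1))%E)) /\
     (exists h : R -> R -> R -> R,
        forall t x y : R, 0 <= t -> 0 <= x <= 1 -> 0 <= y <= 1 ->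
          0 <= h t x y <= 1 /\
          phi c0 c t (h t x y) y = x%:E /\
          genfun (c t) x y = ((1 / alpha c t)%:E * genfun c0 (h t x y) y)%E) /\
     (forall t : R, 0 <= t ->
        ((t%:E < Tgel c0)%E -> (moment2 (c t) < +oo)%E) /\
        ((Tgel c0 <= t%:E)%E -> moment2 (c t) = +oo%E))).
Proof.
have ge0 := clip_ge0 c0_ge0.
have c_0 a : clip c0 a 0 = 0 by [].
have mass : (total_mass (clip c0) < +oo)%E by rewrite total_mass_clip.
have pos : (0 < arms (clip c0))%E by rewrite arms_clip.
split; first by move=> h; rewrite -factorial_clip; apply: arms_infinite_factorial; rewrite ?arms_clip.
exists (sol (clip c0)); split; first exact: smoluchowski_solution_sol.
split; first by move=> c' h; exact: smoluchowski_solution_unique.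
rewrite -(Tgel_clip c0) => gel.
rewrite -(arms_clip c0) -(factorial_clip c0) -(genfun_clip_fun c0) -(phi_clip c0).
rewrite -(Gfun_clip c0) -(G1_clip c0) -(Hfun_clip c0) -(alpha_gel_clip c0).
rewrite -(Gamma_clip c0) -(Gamma_inv_clip c0).
(* All quantities are now expressed through the clipped data, which can be replaced by any data
   non-negative everywhere and zero at mass 0. *)
move: ge0 c_0 mass pos gel; move: (clip c0) => c ge0 c_0 mass pos gel.
have T0 := Tgel_ge0 ge0 mass pos gel.
have TE := TgelE ge0 mass pos gel.
have aE t : 0 <= t -> alpha (sol c) t = (invalpha c t)^-1 by exact: alpha_sol.
split; [split; [|split; [|split; [|split; [|split; [|split]]]]]|split; [|split]].
- exact: (arms_sol_continuous ge0 c_0 mass pos gel).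
- by move=> s t s0 st; exact: (arms_sol_lt ge0 c_0 mass pos s0 st).
- by move=> t t0; exact: (arms_sol_bounds ge0 c_0 mass pos t0).
- by move=> t t0 tT; rewrite (aE t t0); exact: (invalphaV_subcritical ge0 c_0 mass pos gel t0 tT).
- have [GfunR [_ _]] := Gfun_right ge0 mass pos gel.
  have [Gl _] := Gfun_left ge0 mass pos gel.
  split; [|split; [|split; [|split; [|split; [|split; [|split; [|split]]]]]]].
  + move=> x x'; rewrite !in_itv/= => /andP[x0 _] /andP[_ x1] xx.
    exact: (Gfun_lt ge0 mass pos gel x0 xx x1).
  + exact: GfunR.
  + exact: (Gfun0_le0 ge0 mass pos gel).
  + exact: Gl.
  + exact: (G1_gt0 ge0 c_0 mass pos gel).
  + exact: (G1_fin ge0 c_0 mass pos gel).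
  + exact: (G1_inf ge0 mass pos gel).
  + move=> x /andP[x0 x1]; apply/andP; split; [exact: (Gfun_ge ge0 mass pos gel x0 x1)|exact: (Gfun_lt_G1 ge0 mass pos gel x0 x1)].
  + by move=> v; exact: (HfunP ge0 mass pos gel).
- exact: (Gamma_bij ge0 c_0 mass pos gel).
- move=> t t0; rewrite TE lee_fin => Tt; rewrite (aE t t0).
  have h := Gamma_inv_alpha ge0 c_0 mass pos gel Tt.
  split => [_|Aoo]; first exact: h.
  (* When A_0 = +oo, K is infinite, T_gel = 0 and [alpha_gel] is 1. *)
  rewrite h (alpha_gelE ge0 c_0 mass pos gel); congr (Gamma_inv c _).
  have -> : fine (Tgel c) = 0.
    by rewrite /Tgel (arms_infinite_factorial ge0 mass Aoo) eqxx.
  by rewrite (invalpha0 ge0) invr1 subr0.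
- exists (maximizer c); split => [t t0|t t0]; last first.
    split; first by rewrite (armsE (fun a m => sol_ge0 ge0 a m (ltW t0))).
    split; first exact: (alpha_genfun_sol ge0 c_0 mass pos t0).
    exact: (arms_sol_ratio ge0 c_0 mass pos t0).
  have l0 := maximizer_gt0 ge0 c_0 mass t0.
  have l1 := maximizer_le1 ge0 c_0 mass t0.
  have lT := maximizer_eq1 ge0 c_0 mass pos gel t0.
  split; first by rewrite (ltW l0).
  split.
    move=> x x01; rewrite (phi_maximizer ge0 c_0 mass pos t0).
    exact: (phi_le1 ge0 c_0 mass pos t0 x01).
  split; first exact: (phi_maximizer ge0 c_0 mass pos t0).
  split; first by rewrite TE lee_fin -lT => /eqP.
  rewrite TE lte_fin => Tt; split.
    by apply/andP; split; [exact: l0|exact: (maximizer_lt1 ge0 c_0 mass pos gel Tt)].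
  split; first exact: (phi_stationary ge0 c_0 mass pos gel Tt).
  by rewrite (aE t t0) div1r invrK (Hfun_maximizer ge0 c_0 mass pos gel Tt).
- exists (characteristic c) => t x y t0 x01 y01.
  by have [h1 h2 h3] := characteristic_spec ge0 c_0 mass pos t0 x01 y01.
- move=> t t0; split => tT.
    exact: (moment2_sol_fin ge0 c_0 mass pos gel t0 tT).
  exact: (moment2_sol_infinite ge0 c_0 mass pos gel t0 tT).
Qed.
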